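(* The following hold for the class $\mathcal{S}^*_p$ of parabolic starlike functions: (i) $R_{\mathcal{S}_p^*}(\mathcal{T}_1)= (3-\sqrt{5})/4$ $(\approx 0.190983)$; (ii) $R_{\mathcal{S}_p^*}(\mathcal{T}_2)= (5-\sqrt{17})/4$ $(\approx 0.219224)$; (iii) $R_{\mathcal{S}_p^*}(\mathcal{T}_3)=1/\sqrt{35}$ $(\approx 0.169031)$.
   Context: Let $\mathbb{D}=\{z\in\mathbb{C}:|z|<1\}$ and let $\mathcal{A}$ be the class of analytic functions $f:\mathbb{D}\to\mathbb{C}$ with $f(0)=0$, $f'(0)=1$. For analytic $f,g$ on $\mathbb{D}$, $f\prec g$ ($f$ is subordinate to $g$) means $f=g\circ w$ for some analytic $w:\mathbb{D}\to\mathbb{D}$ with $w(0)=0$. Square roots are principal branches unless indicated otherwise, and quotients such as $f/g$, $g/(zp)$, $zf'/f$ are understood with removable singularities at $0$ filled in. Define $\mathcal{T}_1$: all $f\in\mathcal{A}$ such that $f/g\prec e^z$ and $g/(zp)\prec e^z$ for some $g\in\mathcal{A}$ and some $p\prec\sqrt{1+z}$; $\mathcal{T}_2$: all $f\in\mathcal{A}$ such that $f/g\prec \sqrt{1+z}$ and $g/(zp)\prec \sqrt{1+z}$ for some $g\in\mathcal{A}$ and some $p\prec e^z$; $\mathcal{T}_3$: all $f\in\mathcal{A}$ such that $f/g\prec z+\sqrt{1+z^2}$ and $g/(zp)\prec z+\sqrt{1+z^2}$ for some $g\in\mathcal{A}$ and some $p\prec z+\sqrt{1+z^2}$. $\mathcal{S}^*_p$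 is the class of $f\in\mathcal{A}$ with $zf'(z)/f(z)\prec\varphi_{PAR}(z)=1+\frac{2}{\pi^2}\left(\log\frac{1+\sqrt z}{1-\sqrt z}\right)^2$, $\mathrm{Im}\sqrt z\ge 0$, where $\varphi_{PAR}$ maps $\mathbb{D}$ onto $\{w:\mathrm{Re}\,w>|w-1|\}$; equivalently, $\mathrm{Re}(zf'(z)/f(z))>|zf'(z)/f(z)-1|$ for all $z\in\mathbb{D}$. For classes $\mathcal{G},\mathcal{M}\subset\mathcal{A}$, the $\mathcal{G}$-radius $R_{\mathcal{G}}(\mathcal{M})$ is $\inf\{\rho_f: f\in\mathcal{M}\}$, where $\rho_f$ is the largest number in $(0,1]$ such that for every $0<r\le\rho_f$ the function $f$ has the property defining $\mathcal{G}$ in the disk $|z|<r$, i.e. $z\mapsto f(rz)/r$ belongs to $\mathcal{G}$. *)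

(* Defs.v *)
From Stdlib Require Export Reals.
From Coquelicot Require Export Coquelicot.
Open Scope R_scope.
Open Scope C_scope.

Definition Cexp (z : C) : C :=
  ((exp (Re z) * cos (Im z))%R, (exp (Re z) * sin (Im z))%R).

(* Principal argument, in (-PI, PI]; the value at 0 is irrelevant. *)
Definition Carg (z : C) : R :=
  if Rle_dec 0 (Im z) then acos (Re z / Cmod z) else (- acos (Re z / Cmod z))%R.

Definition Clog (z : C) : C := (ln (Cmod z), Carg z).

(* Principal branch: nonnegative real part; on the negative real axis,
   nonnegative imaginary part. *)
Definition Csqrt (z : C) : C :=
  (sqrt ((Cmod z + Re z) / 2),
   if Rle_dec 0 (Im z) then sqrt ((Cmod z - Re z) / 2)
   else (- sqrt ((Cmod z - Re z) / 2))%R).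

(* The root with Im >= 0.  Both roots of a positive real number qualify; the
   positive one is taken, which is harmless in [phi_PAR] because the latter is
   even in the root. *)
Definition Csqrt_upper (z : C) : C :=
  if Rle_dec 0 (Im (Csqrt z)) then Csqrt z else - Csqrt z.

(* A function on the unit disk is a total function [C -> C] of which only the
   values on the disk matter. *)

Definition unit_disk (z : C) : Prop := (Cmod z < 1)%R.

Definition analytic (f : C -> C) : Prop :=
  forall z : C, unit_disk z ->
    ex_derive (K := C_AbsRing) (V := C_NormedModule) f z.

Definition class_A (f : C -> C) : Prop :=
  analytic f /\ f 0 = 0 /\
  is_derive (K := C_AbsRing) (V := C_NormedModule) f (RtoC 0) (RtoC 1).

Definition subordinate (f g : C -> C) : Prop :=
  analytic f /\
  exists w : C -> C,
    analytic w /\ (forall z, unit_disk z -> unit_disk (w z)) /\ w 0 = 0 /\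
    (forall z, unit_disk z -> f z = g (w z)).

(* [q] is the quotient [a / b] with its removable singularity at 0 filled in:
   0 is the only zero of [b] allowed in the disk, and [q 0] is determined by
   the analyticity of [q]. *)
Definition filled_quotient (a b q : C -> C) : Prop :=
  analytic q /\
  forall z, unit_disk z -> z <> 0 -> b z <> 0 /\ q z = a z / b z.

Definition quotient_subordinate (a b phi : C -> C) : Prop :=
  exists q : C -> C, filled_quotient a b q /\ subordinate q phi.

Definition phi_sqrt (z : C) : C := Csqrt (1 + z).

Definition phi_lune (z : C) : C := z + Csqrt (1 + z * z).

Definition phi_PAR (z : C) : C :=
  let s := Csqrt_upper z in
  let l := Clog ((1 + s) / (1 - s)) in
  1 + RtoC (2 / (PI * PI)) * (l * l).

Definition class_T (phi psi f : C -> C) : Prop :=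
  class_A f /\
  exists g p : C -> C,
    class_A g /\ subordinate p psi /\
    quotient_subordinate f g phi /\
    quotient_subordinate g (fun z => z * p z) phi.

Definition class_T1 : (C -> C) -> Prop := class_T Cexp phi_sqrt.
Definition class_T2 : (C -> C) -> Prop := class_T phi_sqrt Cexp.
Definition class_T3 : (C -> C) -> Prop := class_T phi_lune phi_lune.

Definition parabolic_starlike (f : C -> C) : Prop :=
  class_A f /\ quotient_subordinate (fun z => z * C_derive f z) f phi_PAR.

Definition dilation (r : R) (f : C -> C) (z : C) : C :=
  f (RtoC r * z) / RtoC r.

Definition admissible_radius (G : (C -> C) -> Prop) (f : C -> C) (rho : R)
    : Prop :=
  (0 < rho <= 1)%R /\
  forall r : R, (0 < r <= rho)%R -> G (dilation r f).

Definition is_function_radius (G : (C -> C) -> Prop) (f : C -> C) (rho : R)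
    : Prop :=
  admissible_radius G f rho /\
  forall rho' : R, admissible_radius G f rho' -> (rho' <= rho)%R.

(* The first conjunct says that the radius of every member of [M] is well
   defined, so that the infimum does range over all of [M]. *)
Definition is_class_radius (G M : (C -> C) -> Prop) (r : R) : Prop :=
  (forall f, M f -> exists rho, is_function_radius G f rho) /\
  is_glb_Rbar (fun rho => exists f, M f /\ is_function_radius G f rho)
    (Finite r).

(* Main.v *)
Require Import Defs.
From Stdlib Require Import Lra Lia Classical ClassicalEpsilon.

(* Every [f] in the three classes has the form [z phi(w1) phi(w2) psi(w3)] with
   Schwarz functions [w1], [w2], [w3], so that [z f' / f - 1] is the sum of the
   terms [z w' (phi' / phi)(w)].  A point [1 + x] lies in the parabolic region
   iff [|x| - Re x < 1], and [x |-> |x| - Re x] is subadditive, so the three terms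
   can be estimated separately.  By Dieudonné's lemma
   [|z w' - w| <= (r^2 - |w|^2) / (1 - r^2)] for [r = |z|], hence [|z w'| <= r] for
   small [r]; this bounds the terms for [e^z] and [sqrt (1 + z)] by [r] and
   [r / (2 (1 - r))].  For [z + sqrt (1 + z^2)] the term is [z w' / sqrt (1 + w^2)],
   which is compared with [w / sqrt (1 + w^2)].  Equality holds for
   [z phi(z)^2 psi(z)] at [z = - R], where [z f' / f = 1 / 2].

   Dieudonné's lemma, and the analyticity of [z f' / f], come from the mean value
   property on circles, that is, Goursat's theorem on a rectangle in the
   coordinate [log z]. *)

(** * Complex differentiability *)

(** For the exponential and the square root it suffices to bound moduli: at [z = - R] every term of
    the extremal function is a negative real, and there [|x| - Re x = 2 |x|], so nothing is lost.
    For [z + sqrt (1 + z^2)] moduli alone are too weak: [1 / |sqrt (1 + w^2)|] is largest at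
    imaginary [w], and the condition [6 r / sqrt (1 - r^2) < 1] would only give [1 / sqrt 37]. Here
    [|x| - Re x] itself must be estimated, which uses the link between [z w'] and [w] in Dieudonné's
    lemma. The value [1 / 2] is the vertex of the boundary parabola, hence the sharpness.

    Two obstacles shape the rest. Subordination asks for an analytic Schwarz function, so membership
    in the parabolic region is turned into subordination by an explicit analytic inverse of
    [phi_PAR]. And quotients with a filled-in singularity are only known to be continuous at that
    point, so the mean value property is proved with one exceptional circle through it. *)

Definition ccont (f : C -> C) (z : C) : Prop :=
  forall eps : R, (0 < eps)%R -> exists d : R, (0 < d)%R /\
    forall y : C, (Cmod (y - z) < d)%R -> (Cmod (f y - f z) < eps)%R.

(* Caratheodory's formulation: the slope function is continuous. *)
Definition cderiv (f : C -> C) (z l : C) : Prop :=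
  exists s : C -> C, ccont s z /\ s z = l /\
    forall y : C, f y = f z + s y * (y - z).

Lemma Cmod_minus_sym (a b : C) : Cmod (a - b) = Cmod (b - a).
Proof. rewrite <- Cmod_opp. f_equal. ring. Qed.

Lemma Cmod_triangle_minus (a b : C) : (Cmod (a - b) <= Cmod a + Cmod b)%R.
Proof. unfold Cminus. rewrite <- (Cmod_opp b). apply Cmod_triangle. Qed.

Lemma Cmod_triangle_rev (a b : C) : (Cmod a - Cmod b <= Cmod (a - b))%R.
Proof.
assert (H := Cmod_triangle (a - b) b).
replace (a - b + b) with a in H by ring. lra.
Qed.

Lemma Cmod_triangle_via (c a b : C) : (Cmod (a - b) <= Cmod (a - c) + Cmod (c - b))%R.
Proof. replace (a - b) with ((a - c) + (c - b)) by ring. apply Cmod_triangle. Qed.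

Lemma Cmod_pos (z : C) : z <> 0 -> (0 < Cmod z)%R.
Proof. apply Cmod_gt_0. Qed.

Lemma Cmod_real (x : R) : (0 <= x)%R -> Cmod (RtoC x) = x.
Proof. intros H. rewrite Cmod_R. now apply Rabs_pos_eq. Qed.

Lemma RtoC_neq_0 (x : R) : x <> 0%R -> RtoC x <> 0.
Proof. intros H E. apply H. now apply RtoC_inj. Qed.

Lemma ccont_const (c z : C) : ccont (fun _ => c) z.
Proof.
intros e He. exists 1%R. split; [lra|]. intros y _.
replace (c - c) with (RtoC 0) by ring. now rewrite Cmod_0.
Qed.

Lemma ccont_id (z : C) : ccont (fun y => y) z.
Proof. intros e He. exists e. tauto. Qed.

Lemma ccont_plus (f g : C -> C) (z : C) :
  ccont f z -> ccont g z -> ccont (fun y => f y + g y) z.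
Proof.
intros Hf Hg e He.
destruct (Hf (e/2)%R) as [d1 [Hd1 H1]]; [lra|].
destruct (Hg (e/2)%R) as [d2 [Hd2 H2]]; [lra|].
exists (Rmin d1 d2). split; [now apply Rmin_glb_lt|]. intros y Hy.
assert (A1 := H1 y (Rlt_le_trans _ _ _ Hy (Rmin_l _ _))).
assert (A2 := H2 y (Rlt_le_trans _ _ _ Hy (Rmin_r _ _))).
replace (f y + g y - (f z + g z)) with ((f y - f z) + (g y - g z)) by ring.
eapply Rle_lt_trans; [apply Cmod_triangle|]. lra.
Qed.

Lemma ccont_opp (f : C -> C) (z : C) : ccont f z -> ccont (fun y => - f y) z.
Proof.
intros Hf e He. destruct (Hf e He) as [d [Hd H]]. exists d. split; [easy|].
intros y Hy. replace (- f y - - f z) with (- (f y - f z)) by ring.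
rewrite Cmod_opp. auto.
Qed.

Lemma ccont_minus (f g : C -> C) (z : C) :
  ccont f z -> ccont g z -> ccont (fun y => f y - g y) z.
Proof. intros Hf Hg. apply ccont_plus; [easy|]. now apply ccont_opp. Qed.

Lemma ccont_mult (f g : C -> C) (z : C) :
  ccont f z -> ccont g z -> ccont (fun y => f y * g y) z.
Proof.
intros Hf Hg e He.
set (A := (Cmod (f z) + 1)%R). set (B := (Cmod (g z) + 1)%R).
assert (HA : (0 < A)%R) by (unfold A; assert (H := Cmod_ge_0 (f z)); lra).
assert (HB : (0 < B)%R) by (unfold B; assert (H := Cmod_ge_0 (g z)); lra).
destruct (Hf (Rmin 1 (e / (2 * B)))%R) as [d1 [Hd1 H1]].
{ apply Rmin_glb_lt; [lra|]. apply Rdiv_lt_0_compat; lra. }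
destruct (Hg (e / (2 * A))%R) as [d2 [Hd2 H2]].
{ apply Rdiv_lt_0_compat; lra. }
exists (Rmin d1 d2). split; [now apply Rmin_glb_lt|]. intros y Hy.
assert (A1 := H1 y (Rlt_le_trans _ _ _ Hy (Rmin_l _ _))).
assert (A2 := H2 y (Rlt_le_trans _ _ _ Hy (Rmin_r _ _))).
assert (A3 := Rlt_le_trans _ _ _ A1 (Rmin_l _ _)).
assert (A4 := Rlt_le_trans _ _ _ A1 (Rmin_r _ _)).
replace (f y * g y - f z * g z) with (f y * (g y - g z) + (f y - f z) * g z) by ring.
eapply Rle_lt_trans; [apply Cmod_triangle|]. rewrite !Cmod_mult.
assert (A5 : (Cmod (f y) <= A)%R).
{ unfold A. assert (H := Cmod_triangle_rev (f y) (f z)). lra. }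
assert (A6 : (Cmod (f y) * Cmod (g y - g z) <= A * Cmod (g y - g z))%R).
{ apply Rmult_le_compat_r; [apply Cmod_ge_0|easy]. }
assert (A7 : (A * Cmod (g y - g z) < A * (e / (2 * A)))%R) by now apply Rmult_lt_compat_l.
assert (A8 : (Cmod (f y - f z) * Cmod (g z) <= e / (2 * B) * B)%R).
{ apply Rmult_le_compat; try apply Cmod_ge_0; [lra|]. unfold B. lra. }
replace (A * (e / (2 * A)))%R with (e/2)%R in A7 by (field; lra).
replace (e / (2 * B) * B)%R with (e/2)%R in A8 by (field; lra).
lra.
Qed.

Lemma ccont_inv (f : C -> C) (z : C) :
  ccont f z -> f z <> 0 -> ccont (fun y => / f y) z.
Proof.
intros Hf Hz e He. assert (Hm := Cmod_pos _ Hz). set (m := Cmod (f z)) in *.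
destruct (Hf (Rmin (m / 2) (e * (m * m) / 2))%R) as [d [Hd H]].
{ apply Rmin_glb_lt; [lra|]. apply Rdiv_lt_0_compat; [|lra].
  repeat apply Rmult_lt_0_compat; lra. }
exists d. split; [easy|]. intros y Hy. specialize (H y Hy).
assert (A1 := Rlt_le_trans _ _ _ H (Rmin_l _ _)).
assert (A2 := Rlt_le_trans _ _ _ H (Rmin_r _ _)).
assert (A3 : (m / 2 < Cmod (f y))%R).
{ assert (T := Cmod_triangle_rev (f z) (f y)). rewrite Cmod_minus_sym in T.
  fold m in T. lra. }
assert (Hy0 : f y <> 0) by (apply Cmod_gt_0; lra).
replace (/ f y - / f z) with (- (f y - f z) / (f y * f z)) by (field; auto).
rewrite Cmod_div by now apply Cmult_neq_0.
rewrite Cmod_opp, Cmod_mult. fold m.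
apply Rlt_div_l; [nra|].
assert (0 < e * m)%R by now apply Rmult_lt_0_compat. nra.
Qed.

Lemma ccont_div (f g : C -> C) (z : C) :
  ccont f z -> ccont g z -> g z <> 0 -> ccont (fun y => f y / g y) z.
Proof. intros Hf Hg Hz. apply ccont_mult; [easy|]. now apply ccont_inv. Qed.

Lemma ccont_comp (f g : C -> C) (z : C) :
  ccont f z -> ccont g (f z) -> ccont (fun y => g (f y)) z.
Proof.
intros Hf Hg e He. destruct (Hg e He) as [d1 [Hd1 H1]].
destruct (Hf d1 Hd1) as [d [Hd H]]. exists d. split; [easy|]. auto.
Qed.

Lemma ccont_ext_loc (f g : C -> C) (z : C) (r : R) :
  (0 < r)%R -> (forall y, (Cmod (y - z) < r)%R -> f y = g y) -> ccont f z -> ccont g z.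
Proof.
intros Hr Heq Hf e He. destruct (Hf e He) as [d [Hd H]].
exists (Rmin d r). split; [now apply Rmin_glb_lt|]. intros y Hy.
rewrite <- !Heq.
- apply H. eapply Rlt_le_trans; [exact Hy|apply Rmin_l].
- replace (z - z) with (RtoC 0) by ring. now rewrite Cmod_0.
- eapply Rlt_le_trans; [exact Hy|apply Rmin_r].
Qed.

Lemma cderiv_ccont (f : C -> C) (z l : C) : cderiv f z l -> ccont f z.
Proof.
intros [s [Hs [_ H]]].
apply (ccont_ext_loc (fun y => f z + s y * (y - z)) f z 1); [lra|now intros; rewrite <- H|].
apply ccont_plus; [apply ccont_const|]. apply ccont_mult; [easy|].
apply ccont_minus; [apply ccont_id|apply ccont_const].
Qed.

(** The bridge to estimates. The bound is non-strict, so that [y = z] is not an exception; in the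
    converse direction the slope function is the difference quotient, completed by [l] at [z]. *)
Lemma cderiv_iff (f : C -> C) (z l : C) :
  cderiv f z l <-> forall eps : R, (0 < eps)%R -> exists d : R, (0 < d)%R /\
    forall y, (Cmod (y - z) < d)%R ->
      (Cmod (f y - f z - l * (y - z)) <= eps * Cmod (y - z))%R.
Proof.
split.
- intros [s [Hs [Hl H]]] e He. destruct (Hs e He) as [d [Hd Hd']].
  exists d. split; [easy|]. intros y Hy. rewrite H, <- Hl.
  replace (f z + s y * (y - z) - f z - s z * (y - z)) with ((s y - s z) * (y - z)) by ring.
  rewrite Cmod_mult. apply Rmult_le_compat_r; [apply Cmod_ge_0|]. left. auto.
- intros H.
  exists (fun y => if Ceq_dec y z then l else (f y - f z) / (y - z)).
  assert (E : forall y, y <> z -> y - z <> 0) by (intros y; apply Cminus_eq_contra).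
  split; [|split].
  + intros e He. destruct (H (e/2)%R) as [d [Hd Hd']]; [lra|].
    exists d. split; [easy|]. intros y Hy.
    destruct (Ceq_dec z z) as [_|n]; [|easy].
    destruct (Ceq_dec y z) as [_|n].
    * replace (l - l) with (RtoC 0) by ring. now rewrite Cmod_0.
    * specialize (Hd' y Hy). specialize (E y n). assert (P := Cmod_pos _ E).
      replace ((f y - f z) / (y - z) - l) with ((f y - f z - l * (y - z)) / (y - z)) by now field.
      rewrite Cmod_div by easy. apply Rle_lt_trans with (e/2)%R; [|lra].
      apply Rle_div_l; easy.
  + destruct (Ceq_dec z z) as [_|n]; [|easy]. easy.
  + intros y. destruct (Ceq_dec y z) as [->|n]; [ring|]. field. auto.
Qed.

Lemma is_derive_cderiv (f : C -> C) (z l : C) :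
  is_derive (K := C_AbsRing) (V := C_NormedModule) f z l <-> cderiv f z l.
Proof.
rewrite cderiv_iff. split.
- intros [_ H] e He.
  destruct (H z (fun P HP => HP) (mkposreal e He)) as [d Hd].
  exists d. split; [apply cond_pos|]. intros y Hy.
  specialize (Hd y Hy). simpl in Hd.
  change (Cmod ((f y - f z) - (y - z) * l) <= e * Cmod (y - z))%R in Hd.
  now rewrite (Cmult_comm l).
- intros H. split; [apply is_linear_scal_l|].
  intros x Hx e.
  (* The definition of the differential quantifies over every limit [x] of the filter at [z]; limits
     are unique. *)
  replace x with z.
  2:{ apply (is_filter_lim_locally_unique (K := C_AbsRing) (V := AbsRing_NormedModule C_AbsRing)); exact Hx. }
  destruct (H e (cond_pos e)) as [d [Hd Hd']].
  exists (mkposreal d Hd). intros y Hy. specialize (Hd' y Hy).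
  change (Cmod ((f y - f z) - (y - z) * l) <= e * Cmod (y - z))%R.
  now rewrite (Cmult_comm _ l).
Qed.

Lemma cderiv_ext_loc (f g : C -> C) (z l : C) (r : R) :
  (0 < r)%R -> (forall y, (Cmod (y - z) < r)%R -> f y = g y) -> cderiv f z l -> cderiv g z l.
Proof.
intros Hr Heq. rewrite !cderiv_iff. intros Hf e He. destruct (Hf e He) as [d [Hd H]].
exists (Rmin d r). split; [now apply Rmin_glb_lt|]. intros y Hy.
rewrite <- !Heq.
- apply H. eapply Rlt_le_trans; [exact Hy|apply Rmin_l].
- replace (z - z) with (RtoC 0) by ring. now rewrite Cmod_0.
- eapply Rlt_le_trans; [exact Hy|apply Rmin_r].
Qed.

Lemma cderiv_const (c z : C) : cderiv (fun _ => c) z 0.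
Proof. exists (fun _ => RtoC 0). split; [apply ccont_const|split; [easy|]]. intros; ring. Qed.

Lemma cderiv_id (z : C) : cderiv (fun y => y) z 1.
Proof. exists (fun _ => RtoC 1). split; [apply ccont_const|split; [easy|]]. intros; ring. Qed.

Lemma cderiv_plus (f g : C -> C) (z a b : C) :
  cderiv f z a -> cderiv g z b -> cderiv (fun y => f y + g y) z (a + b).
Proof.
intros [s [Hs [<- H]]] [t [Ht [<- K]]]. exists (fun y => s y + t y).
split; [now apply ccont_plus|split; [easy|]]. intros y. rewrite H, K. ring.
Qed.

Lemma cderiv_mult (f g : C -> C) (z a b : C) :
  cderiv f z a -> cderiv g z b -> cderiv (fun y => f y * g y) z (a * g z + f z * b).
Proof.
intros Hf Hg. assert (Cg := cderiv_ccont _ _ _ Hg).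
destruct Hf as [s [Hs [<- H]]], Hg as [t [Ht [<- K]]].
exists (fun y => s y * g y + f z * t y). split; [|split; [easy|]].
- apply ccont_plus; apply ccont_mult; try easy. apply ccont_const.
- intros y. rewrite H. rewrite (K y). ring.
Qed.

Lemma cderiv_opp (f : C -> C) (z a : C) : cderiv f z a -> cderiv (fun y => - f y) z (- a).
Proof.
intros [s [Hs [<- H]]]. exists (fun y => - s y).
split; [now apply ccont_opp|split; [easy|]]. intros y. rewrite H. ring.
Qed.

Lemma cderiv_minus (f g : C -> C) (z a b : C) :
  cderiv f z a -> cderiv g z b -> cderiv (fun y => f y - g y) z (a - b).
Proof. intros Hf Hg. apply cderiv_plus; [easy|]. now apply cderiv_opp. Qed.

(** Slope functions multiply, so nothing is divided by [f y - f z] and its possible zeros near [z]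
    do no harm. *)
Lemma cderiv_comp (f g : C -> C) (z a b : C) :
  cderiv f z a -> cderiv g (f z) b -> cderiv (fun y => g (f y)) z (b * a).
Proof.
intros Hf. assert (Cf := cderiv_ccont _ _ _ Hf).
destruct Hf as [s [Hs [<- H]]]. intros [t [Ht [<- K]]].
exists (fun y => t (f y) * s y). split; [|split; [easy|]].
- apply ccont_mult; [|easy]. now apply ccont_comp.
- intros y. rewrite K. rewrite (H y) at 2. ring.
Qed.

Lemma cderiv_inv (f : C -> C) (z a : C) :
  cderiv f z a -> f z <> 0 -> cderiv (fun y => / f y) z (- a / (f z * f z)).
Proof.
intros Hf Hz. assert (Cf := cderiv_ccont _ _ _ Hf).
(* Within [r] of [z] the function [f] has no zero, and there [1 / f] agrees with the function whose
   slope is written down below. *)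
destruct (Cf (Cmod (f z)) (Cmod_pos _ Hz)) as [r [Hr Hr']].
destruct Hf as [s [Hs [<- H]]].
assert (Hc : cderiv (fun y => / f z + (- s y / (f y * f z)) * (y - z)) z (- s z / (f z * f z))).
{ exists (fun y => - s y / (f y * f z)). split; [|split; [easy|]].
  - apply ccont_div; [now apply ccont_opp| |now apply Cmult_neq_0].
    apply ccont_mult; [easy|apply ccont_const].
  - intros y. ring. }
revert Hc. apply (cderiv_ext_loc _ _ _ _ r Hr).
intros y Hy. assert (Hy0 : f y <> 0).
{ intros E. specialize (Hr' y Hy). rewrite E in Hr'.
  replace (0 - f z) with (- f z) in Hr' by ring. rewrite Cmod_opp in Hr'. lra. }
replace (/ f z + - s y / (f y * f z) * (y - z)) with ((f y - s y * (y - z)) / (f y * f z)) by (field; auto).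
replace (f y - s y * (y - z)) with (f z) by (rewrite (H y); ring). field; auto.
Qed.

Lemma cderiv_div (f g : C -> C) (z a b : C) :
  cderiv f z a -> cderiv g z b -> g z <> 0 ->
  cderiv (fun y => f y / g y) z ((a * g z - f z * b) / (g z * g z)).
Proof.
intros Hf Hg Hz.
replace ((a * g z - f z * b) / (g z * g z)) with (a * / g z + f z * (- b / (g z * g z))) by (field; auto).
apply (cderiv_mult f (fun y => / g y)); [easy|]. now apply cderiv_inv.
Qed.

Definition cdiff (f : C -> C) (z : C) : Prop := exists l, cderiv f z l.

Lemma cdiff_ccont (f : C -> C) (z : C) : cdiff f z -> ccont f z.
Proof. intros [l H]. now apply cderiv_ccont in H. Qed.

Lemma cdiff_const (c z : C) : cdiff (fun _ => c) z.
Proof. eexists; apply cderiv_const. Qed.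

Lemma cdiff_id (z : C) : cdiff (fun y => y) z.
Proof. eexists; apply cderiv_id. Qed.

Lemma cdiff_plus (f g : C -> C) (z : C) : cdiff f z -> cdiff g z -> cdiff (fun y => f y + g y) z.
Proof. intros [a Ha] [b Hb]. eexists. now apply cderiv_plus; eauto. Qed.

Lemma cdiff_minus (f g : C -> C) (z : C) : cdiff f z -> cdiff g z -> cdiff (fun y => f y - g y) z.
Proof. intros [a Ha] [b Hb]. eexists. now apply cderiv_minus; eauto. Qed.

Lemma cdiff_mult (f g : C -> C) (z : C) : cdiff f z -> cdiff g z -> cdiff (fun y => f y * g y) z.
Proof. intros [a Ha] [b Hb]. eexists. now apply cderiv_mult; eauto. Qed.

Lemma cdiff_div (f g : C -> C) (z : C) :
  cdiff f z -> cdiff g z -> g z <> 0 -> cdiff (fun y => f y / g y) z.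
Proof. intros [a Ha] [b Hb] Hz. eexists. now apply cderiv_div; eauto. Qed.

Lemma cdiff_comp (f g : C -> C) (z : C) :
  cdiff f z -> cdiff g (f z) -> cdiff (fun y => g (f y)) z.
Proof. intros [a Ha] [b Hb]. eexists. now apply cderiv_comp; eauto. Qed.

Lemma cdiff_ext_loc (f g : C -> C) (z : C) (r : R) :
  (0 < r)%R -> (forall y, (Cmod (y - z) < r)%R -> f y = g y) -> cdiff f z -> cdiff g z.
Proof. intros Hr Heq [l H]. exists l. revert H. now apply (cderiv_ext_loc _ _ _ _ r). Qed.

Lemma cderiv_C_derive (f : C -> C) (z l : C) : cderiv f z l -> C_derive f z = l.
Proof. intros H. apply is_C_derive_unique. now apply is_derive_cderiv. Qed.

Lemma cdiff_C_derive (f : C -> C) (z : C) : cdiff f z -> cderiv f z (C_derive f z).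
Proof. intros [l H]. now rewrite (cderiv_C_derive _ _ _ H). Qed.

Lemma analytic_iff (f : C -> C) : analytic f <-> forall z, unit_disk z -> cdiff f z.
Proof.
split; intros H z Hz; destruct (H z Hz) as [l Hl]; exists l; now apply is_derive_cderiv.
Qed.

(** * Complex line integrals and Goursat's theorem *)

Definition pcont (f : R -> C) (t : R) : Prop :=
  forall eps : R, (0 < eps)%R -> exists d : R, (0 < d)%R /\
    forall s : R, (Rabs (s - t) < d)%R -> (Cmod (f s - f t) < eps)%R.

Definition is_cint (f : R -> C) (a b : R) (I : C) : Prop :=
  is_RInt (fun t => fst (f t)) a b (fst I) /\ is_RInt (fun t => snd (f t)) a b (snd I).

Definition cint (f : R -> C) (a b : R) : C :=
  (RInt (fun t => fst (f t)) a b, RInt (fun t => snd (f t)) a b).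

Lemma Cmod_Ci : Cmod Ci = 1%R.
Proof.
unfold Ci, Cmod. simpl. replace (0 * (0 * 1) + 1 * (1 * 1))%R with 1%R by ring. apply sqrt_1.
Qed.

Lemma Cmod_le_Rabs (z : C) : (Cmod z <= Rabs (fst z) + Rabs (snd z))%R.
Proof.
replace z with (RtoC (fst z) + Ci * RtoC (snd z)) at 1.
- eapply Rle_trans; [apply Cmod_triangle|]. rewrite Cmod_mult, !Cmod_R, Cmod_Ci. lra.
- destruct z; unfold Ci, RtoC, Cplus, Cmult; simpl; f_equal; ring.
Qed.

Lemma Rabs_fst_Cmod (z : C) : (Rabs (fst z) <= Cmod z)%R.
Proof. apply re_le_Cmod. Qed.

Lemma Rabs_snd_Cmod (z : C) : (Rabs (snd z) <= Cmod z)%R.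
Proof.
replace (Cmod z) with (Cmod (Ci * z)) by (rewrite Cmod_mult, Cmod_Ci; ring).
replace (snd z) with (- fst (Ci * z)%C)%R by (destruct z; unfold Ci, Cmult; simpl; ring).
rewrite Rabs_Ropp. apply Rabs_fst_Cmod.
Qed.

Lemma continuous_eps (f : R -> R) (t : R) :
  (forall eps : R, (0 < eps)%R -> exists d : R, (0 < d)%R /\
    forall s : R, (Rabs (s - t) < d)%R -> (Rabs (f s - f t) < eps)%R) -> continuous f t.
Proof.
intros H P [e He]. destruct (H e (cond_pos e)) as [d [Hd Hd']].
exists (mkposreal d Hd). intros y Hy. apply He. apply Hd'. exact Hy.
Qed.

Lemma eps_continuous (f : R -> R) (t : R) : continuous f t ->
  (forall eps : R, (0 < eps)%R -> exists d : R, (0 < d)%R /\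
    forall s : R, (Rabs (s - t) < d)%R -> (Rabs (f s - f t) < eps)%R).
Proof.
intros H e He.
destruct (H (fun y => Rabs (y - f t) < e)%R) as [d Hd].
{ exists (mkposreal e He). intros y Hy. exact Hy. }
exists d. split; [apply cond_pos|]. intros s Hs. apply Hd. exact Hs.
Qed.

Lemma pcont_fst (f : R -> C) (t : R) : pcont f t -> continuous (fun s => fst (f s)) t.
Proof.
intros H. apply continuous_eps. intros e He. destruct (H e He) as [d [Hd Hd']].
exists d. split; [easy|]. intros s Hs. eapply Rle_lt_trans; [|apply (Hd' s Hs)].
apply (Rabs_fst_Cmod (f s - f t)).
Qed.

Lemma pcont_snd (f : R -> C) (t : R) : pcont f t -> continuous (fun s => snd (f s)) t.
Proof.
intros H. apply continuous_eps. intros e He. destruct (H e He) as [d [Hd Hd']].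
exists d. split; [easy|]. intros s Hs. eapply Rle_lt_trans; [|apply (Hd' s Hs)].
apply (Rabs_snd_Cmod (f s - f t)).
Qed.

Lemma pcont_intro (f : R -> C) (t : R) :
  continuous (fun s => fst (f s)) t -> continuous (fun s => snd (f s)) t -> pcont f t.
Proof.
intros H1 H2 e He.
destruct (eps_continuous _ _ H1 (e/2)%R) as [d1 [Hd1 K1]]; [lra|].
destruct (eps_continuous _ _ H2 (e/2)%R) as [d2 [Hd2 K2]]; [lra|].
exists (Rmin d1 d2). split; [now apply Rmin_glb_lt|]. intros s Hs.
specialize (K1 s (Rlt_le_trans _ _ _ Hs (Rmin_l _ _))).
specialize (K2 s (Rlt_le_trans _ _ _ Hs (Rmin_r _ _))).
eapply Rle_lt_trans; [apply Cmod_le_Rabs|]. simpl.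
change (Rabs (fst (f s) - fst (f t)) + Rabs (snd (f s) - snd (f t)) < e)%R. lra.
Qed.

Lemma pcont_ccont (g : R -> C) (f : C -> C) (t : R) :
  pcont g t -> ccont f (g t) -> pcont (fun s => f (g s)) t.
Proof.
intros Hg Hf e He. destruct (Hf e He) as [d1 [Hd1 H1]].
destruct (Hg d1 Hd1) as [d [Hd H]]. exists d. split; [easy|]. auto.
Qed.

Lemma pcont_mult (f g : R -> C) (t : R) : pcont f t -> pcont g t -> pcont (fun s => f s * g s) t.
Proof.
intros Hf Hg.
assert (F1 := pcont_fst _ _ Hf). assert (F2 := pcont_snd _ _ Hf).
assert (G1 := pcont_fst _ _ Hg). assert (G2 := pcont_snd _ _ Hg).
apply pcont_intro; simpl.
- apply (continuous_minus (V := R_NormedModule) (fun s => fst (f s) * fst (g s))%R (fun s => snd (f s) * snd (g s))%R);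
    apply (continuous_mult (K := R_AbsRing)); easy.
- apply (continuous_plus (V := R_NormedModule) (fun s => fst (f s) * snd (g s))%R (fun s => snd (f s) * fst (g s))%R);
    apply (continuous_mult (K := R_AbsRing)); easy.
Qed.

Lemma cint_correct (f : R -> C) (a b : R) : (a <= b)%R ->
  (forall t, (a <= t <= b)%R -> pcont f t) -> is_cint f a b (cint f a b).
Proof.
intros Hab H. split; apply (RInt_correct (V := R_CompleteNormedModule));
  apply (ex_RInt_continuous (V := R_CompleteNormedModule)); intros t Ht;
  rewrite Rmin_left, Rmax_right in Ht by lra;
  [apply pcont_fst|apply pcont_snd]; auto.
Qed.

Lemma is_cint_unique (f : R -> C) (a b : R) (I : C) : is_cint f a b I -> cint f a b = I.
Proof.
intros [H1 H2]. unfold cint.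
rewrite (is_RInt_unique (V := R_CompleteNormedModule) _ _ _ _ H1).
rewrite (is_RInt_unique (V := R_CompleteNormedModule) _ _ _ _ H2).
now destruct I.
Qed.

Lemma is_cint_plus (f g : R -> C) (a b : R) (I J : C) :
  is_cint f a b I -> is_cint g a b J -> is_cint (fun t => f t + g t) a b (I + J).
Proof. intros [F1 F2] [G1 G2]. split; now apply (is_RInt_plus (V := R_NormedModule)). Qed.

Lemma is_cint_scal (k : C) (f : R -> C) (a b : R) (I : C) :
  is_cint f a b I -> is_cint (fun t => k * f t) a b (k * I).
Proof.
intros [F1 F2]. split; simpl.
- apply (is_RInt_minus (V := R_NormedModule)); now apply (is_RInt_scal (V := R_NormedModule)).
- apply (is_RInt_plus (V := R_NormedModule)); now apply (is_RInt_scal (V := R_NormedModule)).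
Qed.

Lemma is_cint_minus (f g : R -> C) (a b : R) (I J : C) :
  is_cint f a b I -> is_cint g a b J -> is_cint (fun t => f t - g t) a b (I - J).
Proof. intros [F1 F2] [G1 G2]. split; now apply (is_RInt_minus (V := R_NormedModule)). Qed.

Lemma is_cint_conj (f : R -> C) (a b : R) (I : C) :
  is_cint f a b I -> is_cint (fun t => Cconj (f t)) a b (Cconj I).
Proof. intros [F1 F2]. split; [easy|]. now apply (is_RInt_opp (V := R_NormedModule)). Qed.

Lemma is_cint_ext (f g : R -> C) (a b : R) (I : C) : (a <= b)%R ->
  (forall t, (a <= t <= b)%R -> f t = g t) -> is_cint f a b I -> is_cint g a b I.
Proof.
intros Hab H [F1 F2].
split; [revert F1|revert F2]; apply is_RInt_ext; intros t Ht;
  rewrite Rmin_left, Rmax_right in Ht by lra; rewrite H; auto; lra.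
Qed.

Lemma is_cint_Chasles (f : R -> C) (a b c : R) (I J : C) :
  is_cint f a b I -> is_cint f b c J -> is_cint f a c (I + J).
Proof.
intros [F1 F2] [G1 G2].
split; now apply (is_RInt_Chasles (V := R_NormedModule)) with b.
Qed.

(** The linear approximations in Goursat's theorem are integrated exactly along each side of a
    rectangle. *)
Lemma is_cint_affine (A B : C) (a b : R) :
  is_cint (fun t => A + RtoC t * B) a b (A * RtoC (b - a) + B * RtoC ((b * b - a * a) / 2)).
Proof.
assert (H : forall p q : R, is_RInt (fun t => p + t * q)%R a b (p * (b - a) + q * ((b * b - a * a) / 2))%R).
{ intros p q.
  replace (p * (b - a) + q * ((b * b - a * a) / 2))%R
    with (minus ((fun t => p * t + q * (t * t / 2))%R b) ((fun t => p * t + q * (t * t / 2))%R a)).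
  2:{ unfold minus, plus, opp; simpl. field. }
  apply (is_RInt_derive (V := R_CompleteNormedModule) (fun t => p * t + q * (t * t / 2))%R).
  - intros x _. auto_derive; [easy|]. field.
  - intros x _. apply (continuous_plus (V := R_NormedModule) (fun _ => p) (fun t => t * q)%R).
    + apply continuous_const.
    + apply (continuous_mult (K := R_AbsRing)); [apply continuous_id|apply continuous_const]. }
destruct A as [a1 a2], B as [b1 b2]. split; simpl.
- replace (a1 * (b - a) - a2 * 0 + (b1 * ((b * b - a * a) / 2) - b2 * 0))%R
    with (a1 * (b - a) + b1 * ((b * b - a * a) / 2))%R by ring.
  eapply is_RInt_ext; [|apply H]. intros x _. simpl. ring.
- replace (a1 * 0 + a2 * (b - a) + (b1 * 0 + b2 * ((b * b - a * a) / 2)))%R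
    with (a2 * (b - a) + b2 * ((b * b - a * a) / 2))%R by ring.
  eapply is_RInt_ext; [|apply H]. intros x _. simpl. ring.
Qed.

Lemma is_cint_const (k : C) (a b : R) : is_cint (fun _ => k) a b (k * RtoC (b - a)).
Proof.
assert (H := is_cint_affine k 0 a b).
replace (k * RtoC (b - a) + 0 * RtoC ((b * b - a * a) / 2)) with (k * RtoC (b - a)) in H by ring.
destruct H as [H1 H2].
split; [revert H1|revert H2]; apply is_RInt_ext; intros x _; simpl; ring.
Qed.

(* Rotating the integrand makes the integral a nonnegative real. *)
Lemma is_cint_bound (f : R -> C) (a b M : R) (I : C) : (a <= b)%R ->
  (forall t, (a <= t <= b)%R -> (Cmod (f t) <= M)%R) -> is_cint f a b I ->
  (Cmod I <= M * (b - a))%R.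
Proof.
intros Hab HM HI. destruct (Ceq_dec I 0) as [->|n].
{ rewrite Cmod_0. apply Rmult_le_pos; [|lra].
  apply Rle_trans with (Cmod (f a)); [apply Cmod_ge_0|apply HM; lra]. }
assert (P := Cmod_pos _ n).
assert (n' : RtoC (Cmod I) <> 0) by (intros E; apply RtoC_inj in E; lra).
assert (H := is_cint_scal (Cconj I / RtoC (Cmod I)) f a b I HI).
assert (E : Cconj I / RtoC (Cmod I) * I = RtoC (Cmod I)).
{ replace (Cconj I / RtoC (Cmod I) * I) with ((I * Cconj I) / RtoC (Cmod I)) by (field; easy).
  rewrite <- Cmod2_conj, RtoC_pow. field; easy. }
assert (E2 : Cmod (Cconj I / RtoC (Cmod I)) = 1%R).
{ rewrite Cmod_div, Cmod_conj, Cmod_real by (easy || lra). field; lra. }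
rewrite E in H. destruct H as [H _]. simpl fst in H at 2.
assert (K := is_RInt_const (V := R_NormedModule) a b M).
assert (L := is_RInt_le _ _ _ _ _ _ Hab H K).
rewrite Rmult_comm. apply L. intros t Ht.
eapply Rle_trans; [apply Rle_abs|]. eapply Rle_trans; [apply Rabs_fst_Cmod|].
rewrite Cmod_mult, E2, Rmult_1_l. apply HM. lra.
Qed.

(** The boundary integral taken counterclockwise; [Ci] comes from [dz = i dy] on the vertical
    sides. *)
Definition rect_int (F : C -> C) (a b c d : R) : C :=
  cint (fun x => F (x, c)) a b - cint (fun x => F (x, d)) a b
  + Ci * (cint (fun y => F (b, y)) c d - cint (fun y => F (a, y)) c d).

Lemma pcont_horizontal (F : C -> C) (x y : R) : ccont F (x, y) -> pcont (fun t => F (t, y)) x.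
Proof.
intros H. apply (pcont_ccont (fun t => (t, y))); [|easy]. apply pcont_intro; simpl.
- apply continuous_id.
- apply continuous_const.
Qed.

Lemma pcont_vertical (F : C -> C) (x y : R) : ccont F (x, y) -> pcont (fun t => F (x, t)) y.
Proof.
intros H. apply (pcont_ccont (fun t => (x, t))); [|easy]. apply pcont_intro; simpl.
- apply continuous_const.
- apply continuous_id.
Qed.

Lemma cint_Chasles (f : R -> C) (a b c : R) : (a <= b <= c)%R ->
  (forall t, (a <= t <= c)%R -> pcont f t) -> cint f a c = cint f a b + cint f b c.
Proof.
intros Hab H. apply is_cint_unique. apply is_cint_Chasles with b; apply cint_correct; try lra;
  intros t Ht; apply H; lra.
Qed.

Lemma rect_int_split (F : C -> C) (a m b c n d : R) : (a <= m <= b)%R -> (c <= n <= d)%R ->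
  (forall x y, (a <= x <= b)%R -> (c <= y <= d)%R -> ccont F (x, y)) ->
  rect_int F a b c d = rect_int F a m c n + rect_int F m b c n
    + rect_int F a m n d + rect_int F m b n d.
Proof.
intros Hx Hy H. unfold rect_int.
rewrite (cint_Chasles (fun x => F (x, c)) a m b), (cint_Chasles (fun x => F (x, d)) a m b),
  (cint_Chasles (fun y => F (b, y)) c n d), (cint_Chasles (fun y => F (a, y)) c n d); try easy.
- ring.
- intros t Ht. apply pcont_vertical, H; lra.
- intros t Ht. apply pcont_vertical, H; lra.
- intros t Ht. apply pcont_horizontal, H; lra.
- intros t Ht. apply pcont_horizontal, H; lra.
Qed.

(** The integral of an affine function around the rectangle is zero, so only the deviation counts,
    at most [M] times the perimeter. *)
Lemma rect_int_near_affine (F : C -> C) (a b c d M : R) (A B : C) : (a <= b)%R -> (c <= d)%R ->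
  (forall x y, (a <= x <= b)%R -> (c <= y <= d)%R -> ccont F (x, y)) ->
  (forall x y, (a <= x <= b)%R -> (c <= y <= d)%R -> (Cmod (F (x, y) - (A + (x, y) * B)) <= M)%R) ->
  (Cmod (rect_int F a b c d) <= M * (2 * (b - a) + 2 * (d - c)))%R.
Proof.
intros Hab Hcd HF HM.
assert (Hh : forall y, (c <= y <= d)%R -> exists e, (Cmod e <= M * (b - a))%R /\
  cint (fun x => F (x, y)) a b = (A + (0, y) * B) * RtoC (b - a) + B * RtoC ((b * b - a * a) / 2) + e).
{ intros y Hy.
  assert (H1 : is_cint (fun x => F (x, y)) a b (cint (fun x => F (x, y)) a b)).
  { apply cint_correct; [easy|]. intros x Hx. apply pcont_horizontal. auto. }
  assert (H2 := is_cint_affine (A + (0, y) * B) B a b).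
  assert (H3 := is_cint_minus _ _ _ _ _ _ H1 H2).
  eexists. split.
  - eapply is_cint_bound; [easy| |exact H3]. intros t Ht. simpl.
    replace (F (t, y) - (A + (0, y) * B + RtoC t * B)) with (F (t, y) - (A + (t, y) * B)); [auto|].
    f_equal. replace (t, y) with ((0, y) + RtoC t); [ring|].
    unfold RtoC, Cplus; simpl; f_equal; ring.
  - ring. }
assert (Hv : forall x, (a <= x <= b)%R -> exists e, (Cmod e <= M * (d - c))%R /\
  cint (fun y => F (x, y)) c d = (A + (x, 0) * B) * RtoC (d - c) + Ci * B * RtoC ((d * d - c * c) / 2) + e).
{ intros x Hx.
  assert (H1 : is_cint (fun y => F (x, y)) c d (cint (fun y => F (x, y)) c d)).
  { apply cint_correct; [easy|]. intros y Hy. apply pcont_vertical. auto. }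
  assert (H2 := is_cint_affine (A + (x, 0) * B) (Ci * B) c d).
  assert (H3 := is_cint_minus _ _ _ _ _ _ H1 H2).
  eexists. split.
  - eapply is_cint_bound; [easy| |exact H3]. intros t Ht. simpl.
    replace (F (x, t) - (A + (x, 0) * B + RtoC t * (Ci * B))) with (F (x, t) - (A + (x, t) * B)); [auto|].
    f_equal. replace (x, t) with ((x, 0) + Ci * RtoC t); [ring|].
    unfold RtoC, Cplus, Ci, Cmult; simpl; f_equal; ring.
  - ring. }
destruct (Hh c) as [e1 [B1 E1]]; [lra|]. destruct (Hh d) as [e2 [B2 E2]]; [lra|].
destruct (Hv b) as [e3 [B3 E3]]; [lra|]. destruct (Hv a) as [e4 [B4 E4]]; [lra|].
unfold rect_int. rewrite E1, E2, E3, E4.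
match goal with |- (Cmod ?X <= _)%R => replace X with ((e1 - e2) + Ci * (e3 - e4)) end.
- assert (T1 := Cmod_triangle (e1 - e2) (Ci * (e3 - e4))).
  assert (T2 := Cmod_triangle_minus e1 e2). assert (T3 := Cmod_triangle_minus e3 e4).
  rewrite Cmod_mult in T1. rewrite Cmod_Ci in T1. lra.
- clear. destruct A, B, e1, e2, e3, e4. unfold RtoC, Cplus, Ci, Cmult, Cminus, Copp; simpl. f_equal; field.
Qed.

(** The supremum of the left endpoints works, since every left endpoint lies below every right
    endpoint. *)
Lemma nested_intervals (u w : nat -> R) :
  (forall n, (0 <= w n)%R) -> (forall n, (u n <= u (S n))%R) ->
  (forall n, (u (S n) + w (S n) <= u n + w n)%R) ->
  exists x, forall n, (u n <= x <= u n + w n)%R.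
Proof.
intros Hw Hu Huw.
assert (Hm : forall n k, (u n <= u (n + k)%nat)%R).
{ intros n; induction k; [rewrite Nat.add_0_r; lra|]. rewrite Nat.add_succ_r. specialize (Hu (n + k)%nat). lra. }
assert (HM : forall n k, (u (n + k)%nat + w (n + k)%nat <= u n + w n)%R).
{ intros n; induction k; [rewrite Nat.add_0_r; lra|]. rewrite Nat.add_succ_r. specialize (Huw (n + k)%nat). lra. }
assert (Hb : forall n m, (u m <= u n + w n)%R).
{ intros n m. destruct (Nat.le_ge_cases n m) as [H|H].
  - specialize (HM n (m - n)%nat). replace (n + (m - n))%nat with m in HM by lia. specialize (Hw m). lra.
  - specialize (Hm m (n - m)%nat). replace (m + (n - m))%nat with n in Hm by lia. specialize (Hw n). lra. }
destruct (completeness (fun x => exists n, x = u n)) as [x [H1 H2]].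
- exists (u O + w O)%R. intros y [n ->]. apply Hb.
- exists (u O). now exists O.
- exists x. intros n. split.
  + apply H1. now exists n.
  + apply H2. intros y [m ->]. apply Hb.
Qed.

(** Quartering: some quarter keeps at least a fourth of the modulus of the integral. Near the common
    point of the nested rectangles, differentiability bounds the integral by [e] times a square of
    lengths, which also shrinks like [4^(-n)]; comparing the two leaves [J0 <= e K] for every
    [e]. *)
Theorem goursat (F : C -> C) (a b c d : R) : (a <= b)%R -> (c <= d)%R ->
  (forall x y, (a <= x <= b)%R -> (c <= y <= d)%R -> cdiff F (x, y)) ->
  rect_int F a b c d = 0.
Proof.
intros Hab Hcd HF.
assert (HC : forall x y, (a <= x <= b)%R -> (c <= y <= d)%R -> ccont F (x, y)).
{ intros. apply cdiff_ccont. auto. }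
set (J0 := Cmod (rect_int F a b c d)).
set (W := (b - a)%R). set (H := (d - c)%R).
set (w := fun n : nat => (W / 2 ^ n)%R). set (h := fun n : nat => (H / 2 ^ n)%R).
assert (P2 : forall n, (0 < 2 ^ n)%R) by (intros; apply pow_lt; lra).
assert (W0 : (0 <= W)%R) by (unfold W; lra). assert (H0 : (0 <= H)%R) by (unfold H; lra).
assert (w0 : forall n, (0 <= w n)%R) by (intros n; apply Rdiv_le_0_compat; auto).
assert (h0 : forall n, (0 <= h n)%R) by (intros n; apply Rdiv_le_0_compat; auto).
assert (wS : forall n, w n = (2 * w (S n))%R).
{ intros n. unfold w. simpl. field. apply Rgt_not_eq, P2. }
assert (hS : forall n, h n = (2 * h (S n))%R).
{ intros n. unfold h. simpl. field. apply Rgt_not_eq, P2. }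
set (big := fun n (p : R * R) =>
  (J0 / 4 ^ n <= Cmod (rect_int F (fst p) (fst p + w n) (snd p) (snd p + h n)))%R).
set (inside := fun n (p : R * R) =>
  (a <= fst p)%R /\ (fst p + w n <= b)%R /\ (c <= snd p)%R /\ (snd p + h n <= d)%R).
set (next := fun n (p q : R * R) =>
  (fst p <= fst q)%R /\ (fst q + w (S n) <= fst p + w n)%R /\
  (snd p <= snd q)%R /\ (snd q + h (S n) <= snd p + h n)%R).
assert (step : forall n p, inside n p -> big n p -> exists q, next n p q /\ big (S n) q).
{ intros n p Hi Hb. unfold big, inside, next in *. destruct p as [x y]. simpl fst in *. simpl snd in *.
  assert (E := rect_int_split F x (x + w (S n)) (x + w n) y (y + h (S n)) (y + h n)).
  assert (A1 := w0 (S n)). assert (A2 := h0 (S n)). assert (A3 := wS n). assert (A4 := hS n).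
  rewrite E in Hb; [clear E|lra|lra|intros; apply HC; lra].
  assert (E4 : (J0 / 4 ^ n = 4 * (J0 / 4 ^ S n))%R).
  { simpl. field. apply Rgt_not_eq, pow_lt. lra. }
  rewrite E4 in Hb. set (k := (J0 / 4 ^ S n)%R) in *.
  replace (x + w n)%R with ((x + w (S n)) + w (S n))%R in Hb by lra.
  replace (y + h n)%R with ((y + h (S n)) + h (S n))%R in Hb by lra.
  match type of Hb with (_ <= Cmod (?A + ?B + ?C + ?D))%R =>
    assert (T1 := Cmod_triangle (A + B + C) D);
    assert (T2 := Cmod_triangle (A + B) C); assert (T3 := Cmod_triangle A B);
    destruct (Rle_dec k (Cmod A)) as [K1|K1];
    [exists (x, y)|destruct (Rle_dec k (Cmod B)) as [K2|K2];
    [exists ((x + w (S n))%R, y)|destruct (Rle_dec k (Cmod C)) as [K3|K3];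
    [exists (x, (y + h (S n))%R)|exists ((x + w (S n))%R, (y + h (S n))%R)]]] end;
  simpl fst; simpl snd; (split; [repeat split; lra|]); try assumption; lra. }
(* The choice is made total, with default [p], so that it can be iterated by plain recursion; the
   invariants are recovered by induction in [Hs]. *)
assert (sel : forall n p, exists q, inside n p -> big n p -> next n p q /\ big (S n) q).
{ intros n p. destruct (classic (inside n p /\ big n p)) as [[A B]|N].
  - destruct (step n p A B) as [q Hq]. now exists q.
  - exists p. tauto. }
set (f := fun np => proj1_sig (constructive_indefinite_description _ (sel (fst np) (snd np)))).
assert (Hf : forall n p, inside n p -> big n p -> next n p (f (n, p)) /\ big (S n) (f (n, p))).
{ intros n p. exact (proj2_sig (constructive_indefinite_description _ (sel n p))). }
set (s := fix s n := match n with O => (a, c) | S k => f (k, s k) end).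
assert (Hs : forall n, inside n (s n) /\ big n (s n)).
{ induction n.
  - unfold inside, big, w, h, W, H. simpl fst; simpl snd. simpl pow. rewrite !Rdiv_1_r.
    replace (a + (b - a))%R with b by ring. replace (c + (d - c))%R with d by ring.
    split; [lra|]. unfold J0. lra.
  - destruct IHn as [I B]. destruct (Hf n (s n) I B) as [N B'].
    change (f (n, s n)) with (s (S n)) in *. simpl fst in *. simpl snd in *. split; [|easy].
    unfold inside, next in *. simpl fst in *; simpl snd in *. lra. }
assert (Hn : forall n, next n (s n) (s (S n))).
{ intros n. destruct (Hs n) as [I B]. now destruct (Hf n (s n) I B) as [N B']. }
destruct (nested_intervals (fun n => fst (s n)) w w0) as [x Hx]; [intros n; apply (Hn n)..|].
destruct (nested_intervals (fun n => snd (s n)) h h0) as [y Hy]; [intros n; apply (Hn n)..|].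
assert (Hp : cdiff F (x, y)).
{ destruct (Hs O) as [I _]. specialize (Hx O). specialize (Hy O). cbv beta in Hx, Hy. destruct I as (I1 & I2 & I3 & I4). apply HF; split; lra. }
destruct Hp as [l Hl]. rewrite cderiv_iff in Hl.
assert (key : forall e, (0 < e)%R -> (J0 <= e * (2 * (W + H) * (W + H)))%R).
{ intros e He. destruct (Hl e He) as [dl [Hdl Hdl']].
  assert (exists n, (w n + h n < dl)%R) as [n Hn'].
  { destruct (nfloor_ex ((W + H) / dl)%R) as [n Hn']; [apply Rdiv_le_0_compat; lra|].
    exists n. unfold w, h. rewrite <- Rdiv_plus_distr. apply Rlt_div_l; [apply P2|].
    assert (INR n + 1 <= 2 ^ n)%R.
    { clear. induction n; [simpl; lra|]. rewrite S_INR. simpl pow.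
      assert (H := pos_INR n). lra. }
    destruct Hn' as [_ Hn']. apply Rlt_div_l in Hn'; [|easy].
    assert (dl * (INR n + 1) <= dl * 2 ^ n)%R by (apply Rmult_le_compat_l; lra). lra. }
  destruct (Hs n) as [I B]. unfold inside, big in I, B.
  specialize (Hx n). specialize (Hy n). cbv beta in Hx, Hy.
  set (u := fst (s n)) in *. set (v := snd (s n)) in *.
  (* The affine function is the tangent at the common point; every point of the rectangle is within
     [w n + h n < dl] of it. *)
  assert (Q := rect_int_near_affine F u (u + w n) v (v + h n) (e * (w n + h n)) (F (x, y) - l * (x, y)) l).
  assert (A1 := w0 n). assert (A2 := h0 n).
  assert (Q' : (Cmod (rect_int F u (u + w n) v (v + h n)) <= e * (w n + h n) * (2 * (w n) + 2 * (h n)))%R).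
  { replace (2 * w n + 2 * h n)%R with (2 * (u + w n - u) + 2 * (v + h n - v))%R by ring.
    apply Q; [lra|lra|intros; apply HC; lra|].
    intros x' y' Hx' Hy'.
    assert (D : (Cmod ((x', y') - (x, y)) <= w n + h n)%R).
    { eapply Rle_trans; [apply Cmod_le_Rabs|]. simpl. apply Rplus_le_compat; apply Rabs_le; lra. }
    replace (F (x', y') - (F (x, y) - l * (x, y) + (x', y') * l))
      with (F (x', y') - F (x, y) - l * ((x', y') - (x, y))) by ring.
    eapply Rle_trans; [apply Hdl'; lra|]. apply Rmult_le_compat_l; lra. }
  assert (E : (e * (w n + h n) * (2 * w n + 2 * h n) = e * (2 * (W + H) * (W + H)) / 4 ^ n)%R).
  { replace 4%R with (2 * 2)%R by ring. rewrite Rpow_mult_distr. unfold w, h. field.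
    apply Rgt_not_eq, P2. }
  rewrite E in Q'. assert (P4 : (0 < 4 ^ n)%R) by (apply pow_lt; lra).
  assert (L := Rle_trans _ _ _ B Q'). unfold Rdiv in L.
  apply Rmult_le_reg_r in L; [easy|]. now apply Rinv_0_lt_compat. }
apply Cmod_eq_0. fold J0. apply Rle_antisym; [|apply Cmod_ge_0].
set (K := (2 * (W + H) * (W + H))%R) in *. assert (0 <= K)%R by (unfold K; nra).
destruct (Rle_lt_dec J0 0) as [?|L]; [easy|].
specialize (key (J0 / (2 * (K + 1)))%R).
assert (J1 : (0 < J0 / (2 * (K + 1)))%R) by (apply Rdiv_lt_0_compat; lra).
specialize (key J1). replace (J0 / (2 * (K + 1)) * K)%R with (J0 * (K / (2 * (K + 1))))%R in key by (field; lra).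
assert (K / (2 * (K + 1)) < 1)%R by (apply Rlt_div_l; lra). nra.
Qed.

(** * The mean value property *)

Lemma Cexp_plus (a b : C) : Cexp (a + b) = Cexp a * Cexp b.
Proof.
unfold Cexp. rewrite re_plus, im_plus, exp_plus, cos_plus, sin_plus.
unfold Cmult; simpl. f_equal; ring.
Qed.

Lemma Cmod_Cexp (z : C) : Cmod (Cexp z) = exp (Re z).
Proof.
unfold Cexp, Cmod; simpl.
replace (_ + _)%R with (Rsqr (exp (Re z)) * (Rsqr (sin (Im z)) + Rsqr (cos (Im z))))%R
  by (unfold Rsqr; ring).
rewrite sin2_cos2, Rmult_1_r. apply sqrt_Rsqr. left. apply exp_pos.
Qed.

Lemma Cexp_neq_0 (z : C) : Cexp z <> 0.
Proof. apply Cmod_gt_0. rewrite Cmod_Cexp. apply exp_pos. Qed.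

Lemma Cexp_0 : Cexp 0 = 1.
Proof. unfold Cexp; simpl. rewrite exp_0, cos_0, sin_0. unfold RtoC. rewrite Rmult_1_l, Rmult_0_r. easy. Qed.

Lemma exp_mono (x y : R) : (x <= y)%R -> (exp x <= exp y)%R.
Proof. intros [H| ->]; [left; now apply exp_increasing|lra]. Qed.

Lemma derivable_pt_lim_expand (f : R -> R) (l e : R) : derivable_pt_lim f 0 l -> (0 < e)%R ->
  exists d, (0 < d)%R /\ forall h, (Rabs h < d)%R -> (Rabs (f h - f 0%R - l * h) <= e * Rabs h)%R.
Proof.
intros H He. destruct (H e He) as [d Hd]. exists d. split; [apply cond_pos|]. intros h Hh.
destruct (Req_dec h 0) as [->|n].
- replace (f 0 - f 0 - l * 0)%R with 0%R by ring. rewrite Rabs_R0. lra.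
- specialize (Hd h n Hh). rewrite Rplus_0_l in Hd.
  replace (f h - f 0 - l * h)%R with (((f h - f 0) / h - l) * h)%R by (field; easy).
  rewrite Rabs_mult. apply Rmult_le_compat_r; [apply Rabs_pos|]. lra.
Qed.

(** The real expansions of [exp], [cos] and [sin] at 0 have remainders [r1], [r2], [r3] of size at
    most [e' m], and every mixed product is small because [m < e']. *)
Lemma Cexp_cderiv_0 : cderiv Cexp 0 1.
Proof.
apply cderiv_iff. intros e He.
(* The error is at most [4 e' m] in the real part ([r1], and [r2] with a factor at most 3) and
   [5 e' m] in the imaginary part (five summands), hence 9. *)
set (e' := Rmin 1 (e / 9)). assert (He' : (0 < e')%R) by (apply Rmin_glb_lt; lra).
assert (He1 : (e' <= 1)%R) by apply Rmin_l. assert (He9 : (e' <= e / 9)%R) by apply Rmin_r.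
destruct (derivable_pt_lim_expand _ _ e' derivable_pt_lim_exp_0 He') as [d1 [Hd1 K1]].
destruct (derivable_pt_lim_expand _ _ e' derivable_pt_lim_cos_0 He') as [d2 [Hd2 K2]].
destruct (derivable_pt_lim_expand _ _ e' derivable_pt_lim_sin_0 He') as [d3 [Hd3 K3]].
exists (Rmin (Rmin d1 d2) (Rmin d3 e')).
split; [repeat apply Rmin_glb_lt; lra|]. intros h Hh.
replace (h - 0) with h in * by ring.
assert (B1 := Rlt_le_trans _ _ _ Hh (Rle_trans _ _ _ (Rmin_l _ _) (Rmin_l _ _))).
assert (B2 := Rlt_le_trans _ _ _ Hh (Rle_trans _ _ _ (Rmin_l _ _) (Rmin_r _ _))).
assert (B3 := Rlt_le_trans _ _ _ Hh (Rle_trans _ _ _ (Rmin_r _ _) (Rmin_l _ _))).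
assert (B4 := Rlt_le_trans _ _ _ Hh (Rle_trans _ _ _ (Rmin_r _ _) (Rmin_r _ _))).
clear Hh. set (m := Cmod h) in *.
assert (Mx := Rabs_fst_Cmod h). assert (My := Rabs_snd_Cmod h). fold m in Mx, My.
assert (m0 : (0 <= m)%R) by apply Cmod_ge_0.
destruct h as [x y]. simpl in Mx, My.
specialize (K1 x (Rle_lt_trans _ _ _ Mx B1)). specialize (K2 y (Rle_lt_trans _ _ _ My B2)).
specialize (K3 y (Rle_lt_trans _ _ _ My B3)).
rewrite exp_0 in K1. rewrite cos_0 in K2. rewrite sin_0 in K3.
rewrite Cexp_0. eapply Rle_trans; [apply Cmod_le_Rabs|]. unfold Cexp; simpl.
set (r1 := (exp x - 1 - 1 * x)%R) in *. set (r2 := (cos y - 1 - 0 * y)%R) in *.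
set (r3 := (sin y - 0 - 1 * y)%R) in *.
replace (exp x * cos y + - (1) + - (1 * x - 0 * y))%R with (r1 + (1 + x + r1) * r2)%R
  by (unfold r1, r2; ring).
replace (exp x * sin y + - 0 + - (1 * y + 0 * x))%R with (r3 + x * y + x * r3 + r1 * y + r1 * r3)%R
  by (unfold r1, r3; ring).
assert (L1 : (Rabs r1 <= e' * m)%R) by nra. assert (L2 : (Rabs r2 <= e' * m)%R) by nra.
assert (L3 : (Rabs r3 <= e' * m)%R) by nra.
apply Rabs_le_between in L1, L2, L3, Mx, My.
assert (S1 : (e' * m <= 1)%R) by nra.
assert (Q1 : (Rabs ((1 + x + r1) * r2) <= 3 * (e' * m))%R).
{ rewrite Rabs_mult. apply Rmult_le_compat; try apply Rabs_pos; apply Rabs_le; lra. }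
assert (Q : forall u v, (- m <= u <= m)%R -> (- m <= v <= m)%R -> (Rabs (u * v) <= e' * m)%R).
{ intros u v Hu Hv. rewrite Rabs_mult. apply Rmult_le_compat; try apply Rabs_pos; apply Rabs_le; lra. }
assert (Z : (e' * m <= m)%R) by nra.
assert (Q2 := Q x y Mx My). assert (Q3 := Q x r3 Mx ltac:(lra)).
assert (Q4 := Q r1 y ltac:(lra) My). assert (Q5 := Q r1 r3 ltac:(lra) ltac:(lra)).
apply Rle_trans with (9 * (e' * m))%R; [|nra].
apply Rabs_le_between in Q1, Q2, Q3, Q4, Q5.
replace (9 * (e' * m))%R with (4 * (e' * m) + 5 * (e' * m))%R by ring.
apply Rplus_le_compat; apply Rabs_le; lra.
Qed.

Lemma Cexp_cderiv (z : C) : cderiv Cexp z (Cexp z).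
Proof.
replace (Cexp z) with (0 * Cexp (z - z) + Cexp z * (1 * (1 - 0))).
2:{ replace (z - z) with (RtoC 0) by ring. ring. }
apply (cderiv_ext_loc (fun y => Cexp z * Cexp (y - z)) _ _ _ 1); [lra| |].
{ intros y _. rewrite <- Cexp_plus. f_equal. ring. }
apply (cderiv_mult (fun _ => Cexp z) (fun y => Cexp (y - z))); [apply cderiv_const|].
apply (cderiv_comp (fun y => y - z)).
- apply cderiv_minus; [apply cderiv_id|apply cderiv_const].
- replace (z - z) with (RtoC 0) by ring. apply Cexp_cderiv_0.
Qed.

Lemma Cexp_cdiff (z : C) : cdiff Cexp z.
Proof. eexists; apply Cexp_cderiv. Qed.

(** * Circle integrals and their independence of the radius *)

Lemma Cexp_period (x : R) : Cexp (x, (2 * PI)%R) = Cexp (x, 0%R).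
Proof. unfold Cexp; simpl. now rewrite cos_2PI, sin_2PI, cos_0, sin_0. Qed.

(** The integral of [f(z) / (i z) dz] over the circle of radius [exp s], which is a vertical segment
    in the coordinate [log z]. *)
Definition circle_int (f : C -> C) (s : R) : C :=
  cint (fun t => f (Cexp (s, t))) 0 (2 * PI).

Lemma two_PI_pos : (0 < 2 * PI)%R.
Proof. assert (H := PI_RGT_0). lra. Qed.

Lemma Cmod_Cexp_pair (s t : R) : Cmod (Cexp (s, t)) = exp s.
Proof. apply Cmod_Cexp. Qed.

Lemma circle_pcont (f : C -> C) (s t : R) : ccont f (Cexp (s, t)) -> pcont (fun t => f (Cexp (s, t))) t.
Proof.
intros H. apply (pcont_vertical (fun z => f (Cexp z))). apply ccont_comp; [|easy].
apply cdiff_ccont, Cexp_cdiff.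
Qed.

Lemma circle_int_correct (f : C -> C) (s : R) : (forall z, Cmod z = exp s -> ccont f z) ->
  is_cint (fun t => f (Cexp (s, t))) 0 (2 * PI) (circle_int f s).
Proof.
intros H. apply cint_correct; [assert (P := two_PI_pos); lra|].
intros t _. apply circle_pcont, H, Cmod_Cexp_pair.
Qed.

(** The horizontal sides of the rectangle cancel by periodicity of [Cexp]; its vertical sides are
    the two circles. *)
Lemma circle_int_annulus (f : C -> C) (s1 s2 : R) : (s1 <= s2)%R ->
  (forall z, (exp s1 <= Cmod z <= exp s2)%R -> cdiff f z) ->
  circle_int f s1 = circle_int f s2.
Proof.
intros H12 Hf.
assert (G := goursat (fun z => f (Cexp z)) s1 s2 0 (2 * PI) H12 (Rlt_le _ _ two_PI_pos)).
assert (G' : rect_int (fun z => f (Cexp z)) s1 s2 0 (2 * PI) = 0).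
{ apply G. intros x y Hx _. apply cdiff_comp; [apply Cexp_cdiff|]. apply Hf.
  rewrite Cmod_Cexp_pair. split; apply exp_mono; lra. }
unfold rect_int in G'.
replace (cint (fun x => f (Cexp (x, (2 * PI)%R))) s1 s2)
  with (cint (fun x => f (Cexp (x, 0%R))) s1 s2) in G'.
2:{ unfold cint. f_equal; apply RInt_ext; intros x _; now rewrite Cexp_period. }
fold (circle_int f s1) (circle_int f s2) in G'.
assert (E : Ci * (circle_int f s2 - circle_int f s1) = 0) by (rewrite <- G'; ring).
assert (E2 : circle_int f s2 - circle_int f s1 = 0).
{ replace (circle_int f s2 - circle_int f s1) with (- (Ci * (Ci * (circle_int f s2 - circle_int f s1)))).
  - rewrite E. ring.
  - replace (- (Ci * (Ci * (circle_int f s2 - circle_int f s1))))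
      with ((- (Ci * Ci)) * (circle_int f s2 - circle_int f s1)) by ring.
    replace (- (Ci * Ci)) with (RtoC 1); [ring|].
    unfold Ci, Cmult, Copp, RtoC; simpl; f_equal; ring. }
symmetry. now apply Ceq_minus.
Qed.

(** Both components of [f o Cexp] are uniformly continuous on the compact rectangle of half-width
    [d0] around [s]; each gets half of the tolerance. *)
Lemma circle_int_cont (f : C -> C) (S s : R) : (s < S)%R ->
  (forall z, (0 < Cmod z < exp S)%R -> ccont f z) ->
  forall e, (0 < e)%R -> exists d, (0 < d)%R /\ forall s', (Rabs (s' - s) < d)%R ->
    (Cmod (circle_int f s' - circle_int f s) <= e)%R.
Proof.
intros HS Hf e He. set (d0 := ((S - s) / 2)%R). assert (Hd0 : (0 < d0)%R) by (unfold d0; lra).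
assert (P := two_PI_pos).
assert (Hc : forall x y, (s - d0 <= x <= s + d0)%R -> (0 <= y <= 2 * PI)%R ->
  ccont (fun z => f (Cexp z)) (x, y)).
{ intros x y Hx _. apply ccont_comp; [apply cdiff_ccont, Cexp_cdiff|]. apply Hf.
  rewrite Cmod_Cexp_pair. split; [apply exp_pos|]. apply exp_increasing. unfold d0 in *; lra. }
assert (He' : (0 < e / (2 * (2 * PI)))%R) by (apply Rdiv_lt_0_compat; lra).
assert (C2 : forall (k : C -> R), (forall a b : C, (Rabs (k a - k b) <= Cmod (a - b))%R) ->
  forall x y, (s - d0 <= x <= s + d0)%R -> (0 <= y <= 2 * PI)%R ->
  continuity_2d_pt (fun u v => k (f (Cexp (u, v)))) x y).
{ intros k Hk x y Hx Hy eps. destruct (Hc x y Hx Hy eps (cond_pos eps)) as [d [Hd Hd']].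
  assert (Hd2 : (0 < d / 2)%R) by lra.
  exists (mkposreal _ Hd2). intros u v Hu Hv. simpl in Hu, Hv.
  eapply Rle_lt_trans; [apply Hk|]. apply Hd'.
  eapply Rle_lt_trans; [apply Cmod_le_Rabs|]. simpl.
  change (Rabs (u - x) + Rabs (v - y) < d)%R. lra. }
destruct (uniform_continuity_2d _ _ _ _ _ (C2 (fun z => fst z)
  (fun a b => Rabs_fst_Cmod (a - b))) (mkposreal _ He')) as [d1 U1].
destruct (uniform_continuity_2d _ _ _ _ _ (C2 (fun z => snd z)
  (fun a b => Rabs_snd_Cmod (a - b))) (mkposreal _ He')) as [d2 U2].
exists (Rmin d0 (Rmin d1 d2)). split.
{ repeat apply Rmin_glb_lt; [easy|apply cond_pos|apply cond_pos]. }
intros s' Hs'.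
assert (B0 := Rlt_le_trans _ _ _ Hs' (Rmin_l _ _)).
assert (B12 := Rlt_le_trans _ _ _ Hs' (Rmin_r _ _)).
assert (B1 := Rlt_le_trans _ _ _ B12 (Rmin_l _ _)).
assert (B2 := Rlt_le_trans _ _ _ B12 (Rmin_r _ _)).
assert (Bs := B0). apply Rabs_lt_between in Bs.
replace e with (2 * (e / (2 * (2 * PI))) * (2 * PI - 0))%R by (field; apply PI_neq0).
apply (is_cint_bound (fun t => f (Cexp (s', t)) - f (Cexp (s, t))) 0 (2 * PI)); [lra| |].
- intros t Ht. eapply Rle_trans; [apply Cmod_le_Rabs|]. simpl.
  assert (V1 := U1 s t s' t ltac:(lra) Ht ltac:(lra) Ht B1).
  assert (V2 := U2 s t s' t ltac:(lra) Ht ltac:(lra) Ht B2).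
  rewrite Rminus_eq_0, Rabs_R0 in V1, V2. specialize (V1 (cond_pos _)). specialize (V2 (cond_pos _)).
  simpl in V1, V2. unfold Rminus in V1, V2. lra.
- apply is_cint_minus; apply cint_correct; try lra; intros t Ht;
    apply (pcont_vertical (fun z => f (Cexp z))); apply Hc; lra.
Qed.

Lemma Cmod_le_eps (z : C) (k : R) : (0 < k)%R -> (forall e, (0 < e)%R -> (Cmod z <= k * e)%R) -> z = 0.
Proof.
intros Hk H. apply Cmod_eq_0. apply Rle_antisym; [|apply Cmod_ge_0].
apply Rnot_lt_le. intros L. specialize (H (Cmod z / (2 * k))%R).
assert (P : (0 < Cmod z / (2 * k))%R) by (apply Rdiv_lt_0_compat; lra). specialize (H P).
replace (k * (Cmod z / (2 * k)))%R with (Cmod z / 2)%R in H by (field; lra). lra.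
Qed.

(* Goursat gives constancy on both sides of [|z| = tau], continuity in the
   radius glues the two values. *)
Lemma circle_int_const (f : C -> C) (S tau s1 s2 : R) : (s1 <= s2 < S)%R ->
  (forall z, (0 < Cmod z < exp S)%R -> ccont f z) ->
  (forall z, (0 < Cmod z < exp S)%R -> Cmod z <> tau -> cdiff f z) ->
  circle_int f s1 = circle_int f s2.
Proof.
intros Hs Hc Hd.
assert (away : forall u v, (u <= v < S)%R -> (forall x, (u <= x <= v)%R -> exp x <> tau) ->
  circle_int f u = circle_int f v).
{ intros u v Huv Hn. apply circle_int_annulus; [lra|]. intros z Hz.
  assert (E := exp_pos u). assert (z0 : (0 < Cmod z)%R) by lra.
  assert (Ez := exp_ln _ z0). apply Hd.
  - split; [easy|]. eapply Rle_lt_trans; [apply Hz|]. apply exp_increasing. lra.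
  - rewrite <- Ez. apply Hn. rewrite <- (ln_exp u), <- (ln_exp v). split; apply ln_le; lra. }
destruct (classic (exists x, (s1 <= x <= s2)%R /\ exp x = tau)) as [[x [Hx Ex]]|N].
2:{ apply away; [easy|]. intros x Hx E. apply N. now exists x. }
assert (U : forall y, exp y = tau -> y = x) by (intros y Hy; apply exp_inv; congruence).
apply Ceq_minus. apply (Cmod_le_eps _ 2); [lra|]. intros e He.
destruct (circle_int_cont f S x ltac:(lra) Hc e He) as [d [Hd0 Hd']].
assert (L : (Cmod (circle_int f s1 - circle_int f x) <= e)%R).
{ destruct (Req_dec s1 x) as [->|n].
  - replace (circle_int f x - circle_int f x) with (RtoC 0) by ring. rewrite Cmod_0. lra.
  (* The integral is constant from [s1] up to a radius on the same side of the exceptional circle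
     and within [d] of it. *)
  - rewrite (away s1 (Rmax s1 (x - d / 2))).
    + apply Hd'. unfold Rmax. destruct Rle_dec; rewrite Rabs_left; lra.
    + unfold Rmax. destruct Rle_dec; lra.
    + intros y Hy E. specialize (U y E). subst y. revert Hy. unfold Rmax. destruct Rle_dec; lra. }
assert (M : (Cmod (circle_int f s2 - circle_int f x) <= e)%R).
{ destruct (Req_dec s2 x) as [->|n].
  - replace (circle_int f x - circle_int f x) with (RtoC 0) by ring. rewrite Cmod_0. lra.
  - rewrite <- (away (Rmin s2 (x + d / 2)) s2).
    + apply Hd'. unfold Rmin. destruct Rle_dec; rewrite Rabs_right; lra.
    + unfold Rmin. destruct Rle_dec; lra.
    + intros y Hy E. specialize (U y E). subst y. revert Hy. unfold Rmin. destruct Rle_dec; lra. }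
assert (T := Cmod_triangle_via (circle_int f x) (circle_int f s1) (circle_int f s2)).
rewrite (Cmod_minus_sym (circle_int f x)) in T. lra.
Qed.

(** The circle integral is independent of the radius and tends to [2 PI f(0)] as the circle shrinks.
    The circle of radius [tau] is where the quotients to which this is applied have their filled-in
    point. *)
Theorem mean_value_property (f : C -> C) (S tau s : R) : (s < S)%R ->
  (forall z, (Cmod z < exp S)%R -> ccont f z) ->
  (forall z, (0 < Cmod z < exp S)%R -> Cmod z <> tau -> cdiff f z) ->
  circle_int f s = RtoC (2 * PI) * f 0.
Proof.
intros Hs Hc Hd. assert (P := two_PI_pos).
apply Ceq_minus. apply (Cmod_le_eps _ (2 * PI)); [easy|]. intros e He.
assert (H0 : ccont f 0).
{ apply Hc. rewrite Cmod_0. apply exp_pos. }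
destruct (H0 e He) as [d [Hd0 Hd']].
set (s' := Rmin s (ln (d / 2))).
rewrite <- (circle_int_const f S tau s' s); [| |intros; apply Hc; lra|easy].
2:{ split; [apply Rmin_l|easy]. }
replace (2 * PI * e)%R with (e * (2 * PI - 0))%R by ring.
replace (RtoC (2 * PI) * f 0) with (f 0 * RtoC (2 * PI - 0)).
2:{ rewrite Rminus_0_r. ring. }
assert (Es : (exp s' < d)%R).
{ apply Rle_lt_trans with (d / 2)%R; [|lra]. rewrite <- (exp_ln (d / 2)) by lra.
  apply exp_mono, Rmin_r. }
apply (is_cint_bound (fun t => f (Cexp (s', t)) - f 0) 0 (2 * PI)); [lra| |].
- intros t _. left. apply Hd'. replace (Cexp (s', t) - 0) with (Cexp (s', t)) by ring.
  now rewrite Cmod_Cexp_pair.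
- apply is_cint_minus; [|apply is_cint_const]. apply circle_int_correct. intros z Hz. apply Hc.
  rewrite Hz. apply exp_increasing. assert (X : (s' <= s)%R) by apply Rmin_l. lra.
Qed.

(** A maximum principle for the centre only; automorphisms of the disk bring other points there. The
    bound is asked near the unit circle up to [e], since nothing is known on the circle itself. *)
Theorem center_bound (f : C -> C) (tau B : R) :
  (forall z, unit_disk z -> ccont f z) ->
  (forall z, unit_disk z -> z <> 0 -> Cmod z <> tau -> cdiff f z) ->
  (forall e, (0 < e)%R -> exists s, (0 <= s < 1)%R /\
     forall z, (s < Cmod z < 1)%R -> (Cmod (f z) <= B + e)%R) ->
  (Cmod (f 0) <= B)%R.
Proof.
intros Hc Hd HB. apply le_epsilon. intros e He.
destruct (HB e He) as [s [Hs Hs']]. assert (P := two_PI_pos).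
set (r := ((s + 1) / 2)%R). assert (Hr : (s < r < 1)%R) by (unfold r; lra).
assert (Er : exp (ln r) = r) by (apply exp_ln; lra).
assert (M : circle_int f (ln r) = RtoC (2 * PI) * f 0).
{ apply (mean_value_property f 0 tau).
  - rewrite <- ln_1. apply ln_increasing; lra.
  - rewrite exp_0. exact Hc.
  - rewrite exp_0. intros z Hz. apply Hd; [apply Hz|]. apply Cmod_gt_0, Hz. }
assert (I : (Cmod (circle_int f (ln r)) <= (B + e) * (2 * PI - 0))%R).
{ apply (is_cint_bound (fun t => f (Cexp (ln r, t))) 0 (2 * PI)); [lra| |].
  - intros t _. apply Hs'. rewrite Cmod_Cexp_pair, Er. lra.
  - apply circle_int_correct. intros z Hz. apply Hc. unfold unit_disk. rewrite Hz, Er. lra. }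
rewrite M, Cmod_mult, Cmod_real in I by lra. nra.
Qed.

(** * The lemmas of Schwarz and Dieudonné *)

Definition mobius (a z : C) : C := (z + a) / (1 + Cconj a * z).

Lemma mobius_den (a z : C) : unit_disk a -> unit_disk z -> (1 - Cmod a <= Cmod (1 + Cconj a * z))%R.
Proof.
unfold unit_disk. intros Ha Hz. assert (T := Cmod_triangle_rev 1 (- (Cconj a * z))).
replace (1 - - (Cconj a * z)) with (1 + Cconj a * z) in T by ring.
rewrite Cmod_opp, Cmod_mult, Cmod_conj, Cmod_1 in T.
assert (A := Cmod_ge_0 a). assert (B := Cmod_ge_0 z). nra.
Qed.

Lemma mobius_den_neq (a z : C) : unit_disk a -> unit_disk z -> 1 + Cconj a * z <> 0.
Proof.
intros Ha Hz. apply Cmod_gt_0. assert (H := mobius_den a z Ha Hz). unfold unit_disk in *. lra.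
Qed.

Lemma mobius_identity (a z : C) :
  (Cmod (1 + Cconj a * z) ^ 2 - Cmod (z + a) ^ 2 = (1 - Cmod a ^ 2) * (1 - Cmod z ^ 2))%R.
Proof. rewrite !Cmod2_alt. destruct a, z; simpl. ring. Qed.

Lemma mobius_disk (a z : C) : unit_disk a -> unit_disk z -> unit_disk (mobius a z).
Proof.
intros Ha Hz. assert (D := mobius_den_neq a z Ha Hz). assert (I := mobius_identity a z).
unfold unit_disk, mobius in *. rewrite Cmod_div by easy. assert (P := Cmod_pos _ D).
apply Rlt_div_l; [easy|]. rewrite Rmult_1_l.
assert (A := Cmod_ge_0 a). assert (B := Cmod_ge_0 z).
assert (0 < (1 - Cmod a ^ 2) * (1 - Cmod z ^ 2))%R by (apply Rmult_lt_0_compat; nra).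
assert (Q := Cmod_ge_0 (z + a)). apply Rnot_le_lt. intros L. nra.
Qed.

(** Shows that [|mobius a z|] tends to 1 uniformly at the boundary, so that dividing by it costs
    little there. By [mobius_identity], [1 - m^2 = (1 - |a|^2) (1 - |z|^2) / d^2] with
    [d >= 1 - |a|], and [1 + |a|] and [1 + |z|] are at most 2. *)
Lemma mobius_lower (a z : C) : unit_disk a -> unit_disk z ->
  (1 - 4 / (1 - Cmod a) * (1 - Cmod z) <= Cmod (mobius a z))%R.
Proof.
intros Ha Hz. assert (M := mobius_disk a z Ha Hz). assert (D := mobius_den_neq a z Ha Hz).
assert (L := mobius_den a z Ha Hz). assert (I := mobius_identity a z).
unfold unit_disk in *. set (m := Cmod (mobius a z)) in *.
assert (E : Cmod (z + a) = (m * Cmod (1 + Cconj a * z))%R).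
{ unfold m. rewrite <- Cmod_mult. f_equal. unfold mobius. field. easy. }
rewrite E in I. assert (m0 : (0 <= m)%R) by apply Cmod_ge_0.
set (d := Cmod (1 + Cconj a * z)) in *. set (r := Cmod a) in *. set (t := Cmod z) in *.
assert (r0 : (0 <= r)%R) by apply Cmod_ge_0. assert (t0 : (0 <= t)%R) by apply Cmod_ge_0.
assert (I' : ((1 - m * m) * (d * d) = (1 - r) * (1 + r) * ((1 - t) * (1 + t)))%R) by (simpl in I; lra).
assert (B1 : ((1 - m * m) * ((1 - r) * (1 - r)) <= (1 - m * m) * (d * d))%R).
{ apply Rmult_le_compat_l; nra. }
assert (B2 : ((1 - r) * (1 + r) * ((1 - t) * (1 + t)) <= (1 - r) * (4 * (1 - t)))%R).
{ rewrite Rmult_assoc. apply Rmult_le_compat_l; [lra|].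
  replace (4 * (1 - t))%R with (2 * ((1 - t) * 2))%R by ring.
  apply Rmult_le_compat; try nra. }
assert (B3 : ((1 - r) * ((1 - m * m) * (1 - r)) <= (1 - r) * (4 * (1 - t)))%R) by nra.
apply Rmult_le_reg_l in B3; [|lra].
assert (B4 : (1 - m * m <= 4 / (1 - r) * (1 - t))%R).
{ replace (4 / (1 - r) * (1 - t))%R with (4 * (1 - t) / (1 - r))%R by (field; lra).
  apply Rle_div_r; lra. }
nra.
Qed.

Lemma mobius_0 (a : C) : mobius a 0 = a.
Proof. unfold mobius. replace (1 + Cconj a * 0) with (RtoC 1) by ring. field. Qed.

Lemma mobius_cdiff (a z : C) : unit_disk a -> unit_disk z -> cdiff (mobius a) z.
Proof.
intros Ha Hz. apply cdiff_div.
- apply cdiff_plus; [apply cdiff_id|apply cdiff_const].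
- apply cdiff_plus; [apply cdiff_const|].
  apply (cdiff_mult (fun _ => Cconj a) (fun y => y)); [apply cdiff_const|apply cdiff_id].
- now apply mobius_den_neq.
Qed.

Lemma mobius_cderiv_0 (a : C) : cderiv (mobius a) 0 (RtoC (1 - Cmod a ^ 2)).
Proof.
replace (RtoC (1 - Cmod a ^ 2)) with
  (((1 + 0) * (1 + Cconj a * 0) - (0 + a) * (0 + (0 * 0 + Cconj a * 1))) / ((1 + Cconj a * 0) * (1 + Cconj a * 0))).
2:{ rewrite RtoC_minus, Cmod2_conj. replace (1 + Cconj a * 0) with (RtoC 1) by ring. field. }
apply (cderiv_div (fun z => z + a) (fun z => 1 + Cconj a * z)).
- apply cderiv_plus; [apply cderiv_id|apply cderiv_const].
- apply cderiv_plus; [apply cderiv_const|].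
  apply (cderiv_mult (fun _ => Cconj a) (fun y => y)); [apply cderiv_const|apply cderiv_id].
- replace (1 + Cconj a * 0) with (RtoC 1) by ring. apply RtoC_neq_0. lra.
Qed.

Lemma mobius_zero (a z : C) : unit_disk a -> unit_disk z -> mobius a z = 0 -> Cmod z = Cmod a.
Proof.
intros Ha Hz H. assert (D := mobius_den_neq a z Ha Hz).
replace z with (- a); [apply Cmod_opp|].
assert (E : z + a = mobius a z * (1 + Cconj a * z)) by (unfold mobius; field; easy).
rewrite H in E. replace z with ((z + a) - a) by ring. rewrite E. ring.
Qed.

(** * Schwarz functions and their slopes *)

Definition schwarz_fun (w : C -> C) : Prop :=
  (forall z, unit_disk z -> cdiff w z) /\ (forall z, unit_disk z -> unit_disk (w z)) /\ w 0 = 0.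

Definition slope (w : C -> C) (z : C) : C :=
  if Ceq_dec z 0 then C_derive w 0 else w z / z.

Lemma unit_disk_0 : unit_disk 0.
Proof. unfold unit_disk. rewrite Cmod_0. lra. Qed.

Lemma slope_cdiff (w : C -> C) (z : C) : schwarz_fun w -> unit_disk z -> z <> 0 -> cdiff (slope w) z.
Proof.
intros [Hw _] Hz n. apply (cdiff_ext_loc (fun y => w y / y) _ _ (Cmod z) (Cmod_pos _ n)).
- intros y Hy. unfold slope. destruct (Ceq_dec y 0) as [->|_]; [|easy].
  replace (0 - z) with (- z) in Hy by ring. rewrite Cmod_opp in Hy. lra.
- apply cdiff_div; [auto|apply cdiff_id|easy].
Qed.

(** At the origin the slope function of Caratheodory's formulation is itself the continuous
    extension of [w z / z]. *)
Lemma slope_ccont (w : C -> C) (z : C) : schwarz_fun w -> unit_disk z -> ccont (slope w) z.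
Proof.
intros Hw Hz. destruct (Ceq_dec z 0) as [->|n]; [|now apply cdiff_ccont, slope_cdiff].
destruct Hw as [Hd [_ H0]].
assert (H := cdiff_C_derive _ _ (Hd 0 Hz)). destruct H as [s [Hs [E H]]].
apply (ccont_ext_loc s _ _ 1); [lra| |easy]. intros y _. unfold slope.
destruct (Ceq_dec y 0) as [->|n]; [easy|]. rewrite H, H0. field. easy.
Qed.

(** An automorphism moves [a] to the centre. The only point where the composite may fail to be
    differentiable is the zero of the automorphism, which lies on the circle of radius [|a|]. *)
Lemma slope_le_1 (w : C -> C) (a : C) : schwarz_fun w -> unit_disk a -> (Cmod (slope w a) <= 1)%R.
Proof.
intros Hw Ha. rewrite <- (mobius_0 a).
apply (center_bound (fun z => slope w (mobius a z)) (Cmod a)).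
- intros z Hz. apply ccont_comp; [now apply cdiff_ccont, mobius_cdiff|].
  apply slope_ccont; [easy|]. now apply mobius_disk.
- intros z Hz _ Hn. apply cdiff_comp; [now apply mobius_cdiff|].
  apply slope_cdiff; [easy|now apply mobius_disk|]. intros E. apply Hn. now apply mobius_zero in E.
- intros e He. set (k := (4 / (1 - Cmod a))%R).
  assert (Ha' := Ha). unfold unit_disk in Ha'.
  assert (Hk : (0 < k)%R) by (apply Rdiv_lt_0_compat; lra).
  (* For [|z| > s], [k (1 - |z|) < e / (1 + e) = 1 - 1 / (1 + e)], so [|m| > 1 / (1 + e)] and
     [|w m / m| <= 1 + e]. *)
  set (s := Rmax (Cmod a) (1 - e / (k * (1 + e)))).
  assert (Hq : (0 < e / (k * (1 + e)))%R) by (apply Rdiv_lt_0_compat; nra).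
  assert (S1 : (Cmod a <= s)%R) by apply Rmax_l.
  assert (S2 : (1 - e / (k * (1 + e)) <= s)%R) by apply Rmax_r.
  exists s. split.
  { split; [assert (H := Cmod_ge_0 a); lra|]. apply Rmax_lub_lt; lra. }
  intros z Hz. assert (Dz : unit_disk z) by (unfold unit_disk; lra).
  assert (L := mobius_lower a z Ha Dz). fold k in L.
  assert (Dm := mobius_disk a z Ha Dz). set (m := mobius a z) in *.
  assert (B : (k * (1 - Cmod z) < k * (e / (k * (1 + e))))%R) by (apply Rmult_lt_compat_l; lra).
  replace (k * (e / (k * (1 + e))))%R with (1 - / (1 + e))%R in B by (field; lra).
  assert (Hinv : (0 < / (1 + e))%R) by (apply Rinv_0_lt_compat; lra).
  assert (n : m <> 0) by (apply Cmod_gt_0; lra).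
  unfold slope. destruct (Ceq_dec m 0) as [?|_]; [easy|].
  rewrite Cmod_div by easy. apply Rle_div_l; [lra|].
  assert (W := proj1 (proj2 Hw) m Dm). unfold unit_disk in W.
  apply Rle_trans with (1 * 1)%R; [lra|].
  replace (1 * 1)%R with ((1 + e) * / (1 + e))%R by (field; lra).
  apply Rmult_le_compat_l; lra.
Qed.

Lemma schwarz_lemma (w : C -> C) (z : C) : schwarz_fun w -> unit_disk z -> (Cmod (w z) <= Cmod z)%R.
Proof.
intros Hw Hz. destruct (Ceq_dec z 0) as [->|n].
- destruct Hw as [_ [_ ->]]. lra.
- assert (H := slope_le_1 w z Hw Hz). unfold slope in H. destruct (Ceq_dec z 0) as [?|_]; [easy|].
  rewrite Cmod_div in H by easy. apply Rle_div_l in H; [lra|now apply Cmod_pos].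
Qed.

(* [h] may fail to be differentiable on one circle: the slope of a Schwarz
   function is not known to be differentiable at the origin. *)
Lemma schwarz_pick_center (h : C -> C) (tau lam : R) (l : C) : (0 < lam < 1)%R ->
  (forall z, unit_disk z -> ccont h z) ->
  (forall z, unit_disk z -> Cmod z <> tau -> cdiff h z) ->
  (forall z, unit_disk z -> (Cmod (h z) <= lam)%R) ->
  cderiv h 0 l -> (Cmod l <= 1 - Cmod (h 0) ^ 2)%R.
Proof.
intros Hlam Hc Hd Hb Hl. set (b := h 0) in *.
assert (Db : unit_disk (- b)).
{ unfold unit_disk. rewrite Cmod_opp. specialize (Hb 0 unit_disk_0). fold b in Hb. lra. }
assert (Dh : forall z, unit_disk z -> unit_disk (h z)).
{ intros z Hz. unfold unit_disk. specialize (Hb z Hz). lra. }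
destruct Hl as [s [Hs [<- Hsl]]]. fold b in Hsl.
assert (D : forall z, unit_disk z -> 1 + Cconj (- b) * h z <> 0).
{ intros z Hz. apply mobius_den_neq; auto. }
(* [q] equals the slope function [s], which is continuous at 0; the quotient form gives regularity
   elsewhere. *)
set (q := fun z => if Ceq_dec z 0 then s 0 else (h z - b) / z).
assert (qs : forall z, q z = s z).
{ intros z. unfold q. destruct (Ceq_dec z 0) as [->|n]; [easy|]. rewrite Hsl. field. easy. }
assert (qd : forall z, unit_disk z -> z <> 0 -> Cmod z <> tau -> cdiff q z).
{ intros z Hz n Ht. apply (cdiff_ext_loc (fun y => (h y - b) / y) _ _ (Cmod z) (Cmod_pos _ n)).
  - intros y Hy. unfold q. destruct (Ceq_dec y 0) as [->|_]; [|easy].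
    replace (0 - z) with (- z) in Hy by ring. rewrite Cmod_opp in Hy. lra.
  - apply cdiff_div; [|apply cdiff_id|easy]. apply cdiff_minus; [auto|apply cdiff_const]. }
assert (qc : forall z, unit_disk z -> ccont q z).
{ intros z Hz. destruct (Ceq_dec z 0) as [->|n].
  - apply (ccont_ext_loc s _ _ 1); [lra| |easy]. intros y _. now rewrite qs.
  - apply (ccont_ext_loc (fun y => (h y - b) / y) _ _ (Cmod z) (Cmod_pos _ n)).
    + intros y Hy. unfold q. destruct (Ceq_dec y 0) as [->|_]; [|easy].
      replace (0 - z) with (- z) in Hy by ring. rewrite Cmod_opp in Hy. lra.
    + apply ccont_div; [|apply ccont_id|easy]. apply ccont_minus; [auto|apply ccont_const]. }
(* Away from 0 this is [mobius (- b) (h z) / z], of modulus below [1 / |z|]; at 0 it is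
   [l / (1 - |b|^2)]. *)
assert (B := center_bound (fun z => q z / (1 + Cconj (- b) * h z)) tau 1).
cbv beta in B. rewrite qs in B. fold b in B.
assert (E : 1 + Cconj (- b) * b = RtoC (1 - Cmod b ^ 2)).
{ rewrite RtoC_minus, Cmod2_conj, Copp_conj. ring. }
assert (P : (0 < 1 - Cmod b ^ 2)%R).
{ unfold unit_disk in Db. rewrite Cmod_opp in Db. assert (H := Cmod_ge_0 b). nra. }
rewrite E, Cmod_div, Cmod_real in B; [|lra|intros X; apply RtoC_inj in X; lra].
cut (Cmod (s 0) / (1 - Cmod b ^ 2) <= 1)%R; [intros X; apply Rle_div_l in X; lra|].
apply B; clear B.
- intros z Hz. apply ccont_div; [auto| |auto].
  apply ccont_plus; [apply ccont_const|]. apply ccont_mult; [apply ccont_const|auto].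
- intros z Hz n Ht. apply cdiff_div; [auto| |auto].
  apply cdiff_plus; [apply cdiff_const|].
  apply (cdiff_mult (fun _ => Cconj (- b)) h); [apply cdiff_const|auto].
- intros e He. exists (/ (1 + e))%R.
  assert (Hinv : (0 < / (1 + e))%R) by (apply Rinv_0_lt_compat; lra).
  assert (Hinv1 : ((1 + e) * / (1 + e) = 1)%R) by (field; lra).
  split; [nra|]. intros z Hz.
  assert (Dz : unit_disk z) by (unfold unit_disk; lra).
  assert (n : z <> 0) by (apply Cmod_gt_0; lra).
  unfold q. destruct (Ceq_dec z 0) as [?|_]; [easy|].
  assert (M := mobius_disk (- b) (h z) Db (Dh z Dz)). unfold unit_disk, mobius in M.
  replace ((h z - b) / z / (1 + Cconj (- b) * h z)) with ((h z + - b) / (1 + Cconj (- b) * h z) / z)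
    by (field; auto).
  rewrite Cmod_div by easy. apply Rle_div_l; nra.
Qed.

(* Schwarz-Pick for [w z / z], scaled by [lam < 1] to keep the image away
   from the unit circle. *)
Theorem dieudonne (w : C -> C) (a l : C) : schwarz_fun w -> unit_disk a -> cderiv w a l ->
  (Cmod (a * l - w a) * (1 - Cmod a ^ 2) <= Cmod a ^ 2 - Cmod (w a) ^ 2)%R.
Proof.
intros Hw Ha Hl. destruct (Ceq_dec a 0) as [->|n].
{ destruct Hw as [_ [_ ->]]. replace (0 * l - 0) with (RtoC 0) by ring. rewrite Cmod_0. lra. }
assert (Pa := Cmod_pos _ n). assert (Ha' := Ha). unfold unit_disk in Ha'.
set (d := (l * a - w a * 1) / (a * a)).
assert (Hsl : cderiv (slope w) a d).
{ apply (cderiv_ext_loc (fun y => w y / y) _ _ _ (Cmod a) Pa).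
  - intros y Hy. unfold slope. destruct (Ceq_dec y 0) as [->|_]; [|easy].
    replace (0 - a) with (- a) in Hy by ring. rewrite Cmod_opp in Hy. lra.
  - apply (cderiv_div w (fun y => y)); [easy|apply cderiv_id|easy]. }
set (x := (Cmod d * (1 - Cmod a ^ 2))%R). set (y := Cmod (slope w a)).
assert (K : forall lam, (0 < lam < 1)%R -> (lam * x <= 1 - lam ^ 2 * y ^ 2)%R).
{ intros lam Hlam.
  assert (B := schwarz_pick_center (fun z => RtoC lam * slope w (mobius a z)) (Cmod a) lam
     (0 * slope w (mobius a 0) + RtoC lam * (d * RtoC (1 - Cmod a ^ 2))) Hlam).
  cbv beta in B. rewrite mobius_0 in B.
  replace (0 * slope w a + RtoC lam * (d * RtoC (1 - Cmod a ^ 2))) with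
    (RtoC lam * (d * RtoC (1 - Cmod a ^ 2))) in B by ring.
  rewrite !Cmod_mult, (Cmod_real lam), (Cmod_real (1 - Cmod a ^ 2)) in B by nra.
  fold y x in B. rewrite Rpow_mult_distr in B. apply B.
  - intros z Hz. apply ccont_mult; [apply ccont_const|].
    apply ccont_comp; [now apply cdiff_ccont, mobius_cdiff|].
    apply slope_ccont; [easy|now apply mobius_disk].
  - intros z Hz Hn. apply (cdiff_mult (fun _ => RtoC lam) (fun z => slope w (mobius a z))); [apply cdiff_const|].
    apply cdiff_comp; [now apply mobius_cdiff|].
    apply slope_cdiff; [easy|now apply mobius_disk|]. intros E. apply Hn. now apply mobius_zero in E.
  - intros z Hz. rewrite Cmod_mult, Cmod_real by lra.
    assert (S := slope_le_1 w (mobius a z) Hw (mobius_disk _ _ Ha Hz)).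
    assert (S0 := Cmod_ge_0 (slope w (mobius a z))). nra.
  - replace (RtoC lam * (d * RtoC (1 - Cmod a ^ 2))) with
      (0 * slope w (mobius a 0) + RtoC lam * (d * RtoC (1 - Cmod a ^ 2))) by ring.
    apply (cderiv_mult (fun _ => RtoC lam) (fun z => slope w (mobius a z))); [apply cderiv_const|].
    apply (cderiv_comp (mobius a) (slope w)); [apply mobius_cderiv_0|]. now rewrite mobius_0. }
assert (x0 : (0 <= x)%R).
{ apply Rmult_le_pos; [apply Cmod_ge_0|nra]. }
assert (L : (x + y ^ 2 <= 1)%R).
{ apply Rnot_lt_le. intros L. set (v := (x + y ^ 2)%R) in *.
  (* The passage [lam -> 1] in a single choice: if [v > 1] then [lam^2 v = (v + 2 + 1 / v) / 4 > 1],
     whereas [lam^2 v <= lam x + lam^2 y^2 <= 1]. *)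
  set (lam := ((1 + / v) / 2)%R).
  assert (Hv : (0 < / v)%R) by (apply Rinv_0_lt_compat; lra).
  assert (Hv1 : (v * / v = 1)%R) by (field; lra).
  assert (Hv2 : (/ v < 1)%R) by nra.
  assert (Hlam : (0 < lam < 1)%R) by (unfold lam; lra).
  specialize (K lam Hlam).
  assert (X : (lam ^ 2 * v <= 1)%R).
  { assert (0 <= (1 - lam) * (lam * x))%R by (apply Rmult_le_pos; [|apply Rmult_le_pos]; lra).
    unfold v. simpl. simpl in K. lra. }
  assert (Y : (lam ^ 2 * v = (v + 2 * (v * / v) + (v * / v) * / v) / 4)%R) by (unfold lam; field; lra).
  rewrite Hv1 in Y.
  assert (0 < (v - 1) * (1 - / v))%R by (apply Rmult_lt_0_compat; lra). nra. }
assert (E1 : (Cmod (a * l - w a) = Cmod d * Cmod a ^ 2)%R).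
{ rewrite <- Cmod_pow, <- Cmod_mult. f_equal. unfold d. simpl. field. easy. }
assert (E2 : (Cmod (w a) = y * Cmod a)%R).
{ unfold y. rewrite <- Cmod_mult. f_equal. unfold slope. destruct (Ceq_dec a 0) as [?|_]; [easy|].
  field. easy. }
rewrite E1, E2. unfold x in L.
replace (Cmod d * Cmod a ^ 2 * (1 - Cmod a ^ 2))%R with (Cmod a ^ 2 * (Cmod d * (1 - Cmod a ^ 2)))%R by ring.
replace (Cmod a ^ 2 - (y * Cmod a) ^ 2)%R with (Cmod a ^ 2 * (1 - y ^ 2))%R by ring.
apply Rmult_le_compat_l; nra.
Qed.

(** * Cauchy's formula and the differentiability of the derivative *)

(* On the circle the kernel is the conjugate of [1 / (1 - conj a z / rho^2)],
   which is holomorphic on a larger disk. *)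
Lemma cauchy_kernel_mean (a : C) (s : R) : (Cmod a < exp s)%R ->
  is_cint (fun t => Cexp (s, t) / (Cexp (s, t) - a)) 0 (2 * PI) (RtoC (2 * PI)).
Proof.
intros Ha. set (rho := exp s) in *. assert (rho0 : (0 < rho)%R) by apply exp_pos.
assert (r0 := Cmod_ge_0 a). assert (P := two_PI_pos).
set (k := fun z => 1 / (1 - Cconj a * z / RtoC (rho * rho))).
(* [R1] exceeds [rho] but satisfies [|a| R1 < rho^2], so the pole of [k] stays outside; unlike a
   fraction of [rho^2 / |a|], it also makes sense at [a = 0]. *)
set (R1 := (2 * (rho * rho) / (rho + Cmod a))%R).
assert (nr : RtoC (rho * rho) <> 0) by (apply RtoC_neq_0; nra).
assert (HR : (rho < R1)%R) by (apply Rlt_div_r; nra).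
assert (D : forall z, (Cmod z < R1)%R -> 1 - Cconj a * z / RtoC (rho * rho) <> 0).
{ intros z Hz E. assert (E2 : Cconj a * z / RtoC (rho * rho) = 1).
  { replace (Cconj a * z / RtoC (rho * rho)) with (1 - (1 - Cconj a * z / RtoC (rho * rho))) by ring.
    rewrite E. ring. }
  assert (E3 : Cmod (Cconj a * z / RtoC (rho * rho)) = 1%R) by (rewrite E2; apply Cmod_1).
  rewrite Cmod_div, Cmod_mult, Cmod_conj, Cmod_real in E3 by (easy || nra).
  assert (E4 : (Cmod a * Cmod z = rho * rho)%R).
  { replace (Cmod a * Cmod z)%R with (Cmod a * Cmod z / (rho * rho) * (rho * rho))%R by (field; lra).
    rewrite E3. ring. }
  assert (Hz2 : (Cmod z * (rho + Cmod a) < 2 * (rho * rho))%R) by (apply Rlt_div_r; [lra|exact Hz]).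
  assert (Hz3 : (Cmod z < rho)%R) by (apply (Rmult_lt_reg_r rho); nra).
  assert (z0 := Cmod_ge_0 z). nra. }
assert (Kd : forall z, (Cmod z < R1)%R -> cdiff k z).
{ intros z Hz. apply cdiff_div; [apply cdiff_const| |auto].
  apply cdiff_minus; [apply cdiff_const|]. apply cdiff_div; [|apply cdiff_const|easy].
  apply (cdiff_mult (fun _ => Cconj a) (fun y => y)); [apply cdiff_const|apply cdiff_id]. }
assert (M : circle_int k s = RtoC (2 * PI) * k 0).
{ apply (mean_value_property k (ln R1) 0).
  - rewrite <- (ln_exp s). fold rho. apply ln_increasing; lra.
  - rewrite exp_ln by lra. intros. apply cdiff_ccont, Kd. easy.
  - rewrite exp_ln by lra. intros. apply Kd. lra. }
assert (I := circle_int_correct k s). rewrite M in I.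
replace (RtoC (2 * PI) * k 0) with (RtoC (2 * PI)) in I.
2:{ unfold k. replace (1 - Cconj a * 0 / RtoC (rho * rho)) with (RtoC 1) by (field; easy). field. }
assert (I' : is_cint (fun t => k (Cexp (s, t))) 0 (2 * PI) (RtoC (2 * PI))).
{ apply I. fold rho. intros z Hz. apply cdiff_ccont, Kd. lra. }
apply is_cint_conj in I'.
replace (Cconj (RtoC (2 * PI))) with (RtoC (2 * PI)) in I'.
2:{ unfold Cconj, RtoC; simpl. f_equal. ring. }
revert I'. apply is_cint_ext; [lra|]. intros t _.
assert (Hz := Cmod_Cexp_pair s t). fold rho in Hz. set (z := Cexp (s, t)) in *.
assert (Dz := D z ltac:(lra)).
assert (zz : RtoC (rho * rho) = z * Cconj z).
{ rewrite <- Cmod2_conj, Hz. f_equal. ring. }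
assert (nz : z <> 0) by (apply Cmod_gt_0; lra).
assert (ncz : Cconj z <> 0) by (apply Cmod_gt_0; rewrite Cmod_conj; lra).
assert (nza : z - a <> 0).
{ intros E. apply Ceq_minus in E. rewrite <- E in Ha. lra. }
unfold k. rewrite Cdiv_conj, !Cminus_conj, Cdiv_conj, Cmult_conj, Cconj_conj by easy.
replace (Cconj (RtoC (rho * rho))) with (RtoC (rho * rho)).
2:{ unfold Cconj, RtoC; simpl. f_equal. ring. }
replace (Cconj 1) with (RtoC 1) by (unfold Cconj, RtoC; simpl; f_equal; ring).
rewrite zz. replace (1 - a * Cconj z / (z * Cconj z)) with ((z - a) / z) by (field; auto).
field; auto.
Qed.

(** With the slope function [q] of [f] at [a], [f(z) z / (z - a) = q(z) z + f(a) z / (z - a)]. The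
    first summand vanishes at 0, so its mean is zero, with exceptional circle through [a]; the
    second is the kernel. *)
Theorem cauchy_formula (f : C -> C) (s : R) (a : C) : (s < 0)%R -> (Cmod a < exp s)%R ->
  (forall z, unit_disk z -> cdiff f z) ->
  is_cint (fun t => f (Cexp (s, t)) * Cexp (s, t) / (Cexp (s, t) - a)) 0 (2 * PI) (RtoC (2 * PI) * f a).
Proof.
intros Hs Ha Hf. assert (P := two_PI_pos).
assert (E1 : (exp s < 1)%R) by (rewrite <- exp_0; now apply exp_increasing).
assert (Da : unit_disk a) by (unfold unit_disk; lra).
destruct (Hf a Da) as [l [q [Hq [_ Hq2]]]].
assert (Hn : forall z, z <> a -> z - a <> 0) by (intros; now apply Cminus_eq_contra).
assert (Qd : forall z, unit_disk z -> z <> a -> cdiff q z).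
{ intros z Hz n. apply (cdiff_ext_loc (fun y => (f y - f a) / (y - a)) _ _ (Cmod (z - a))).
  - apply Cmod_pos; auto.
  - intros y Hy. rewrite Hq2. field. apply Hn. intros ->. rewrite Cmod_minus_sym in Hy. lra.
  - apply cdiff_div; [apply cdiff_minus; [auto|apply cdiff_const]| |auto].
    apply cdiff_minus; [apply cdiff_id|apply cdiff_const]. }
assert (Qc : forall z, unit_disk z -> ccont q z).
{ intros z Hz. destruct (Ceq_dec z a) as [->|n]; [easy|]. apply cdiff_ccont. auto. }
assert (M : circle_int (fun z => q z * z) s = RtoC (2 * PI) * (q 0 * 0)).
{ apply (mean_value_property (fun z => q z * z) 0 (Cmod a)); [easy| |].
  - rewrite exp_0. intros z Hz. apply ccont_mult; [auto|apply ccont_id].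
  - rewrite exp_0. intros z Hz Hn'. apply (cdiff_mult q (fun y => y)); [|apply cdiff_id].
    apply Qd; [apply Hz|congruence]. }
assert (I := circle_int_correct (fun z => q z * z) s). rewrite M in I.
assert (I2 := is_cint_scal (f a) _ _ _ _ (cauchy_kernel_mean a s Ha)).
assert (I3 := is_cint_plus _ _ _ _ _ _ (I ltac:(intros z Hz; apply ccont_mult;
  [apply Qc; unfold unit_disk; lra|apply ccont_id])) I2).
replace (RtoC (2 * PI) * (q 0 * 0) + f a * RtoC (2 * PI)) with (RtoC (2 * PI) * f a) in I3 by ring.
revert I3. apply is_cint_ext; [lra|]. intros t _.
assert (Hz := Cmod_Cexp_pair s t). set (z := Cexp (s, t)) in *.
rewrite (Hq2 z). field. apply Hn. intros ->. lra.
Qed.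

(** A remainder quadratic in [y - a], uniformly in [t], remains quadratic after integration. *)
Lemma cint_param_cderiv (Phi : C -> R -> C) (Phi' : R -> C) (a : C) (u v r M : R) : (u <= v)%R ->
  (0 < r)%R ->
  (forall y t, (Cmod (y - a) < r)%R -> (u <= t <= v)%R -> pcont (Phi y) t) ->
  (forall t, (u <= t <= v)%R -> pcont Phi' t) ->
  (forall y t, (Cmod (y - a) < r)%R -> (u <= t <= v)%R ->
     (Cmod (Phi y t - Phi a t - (y - a) * Phi' t) <= M * Cmod (y - a) ^ 2)%R) ->
  cderiv (fun y => cint (Phi y) u v) a (cint Phi' u v).
Proof.
intros Huv Hr H1 H2 H3. apply cderiv_iff. intros e He.
set (K := (Rabs M * (v - u) + 1)%R).
assert (HK : (0 < K)%R) by (unfold K; assert (X := Rabs_pos M); nra).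
exists (Rmin r (e / K)). split; [apply Rmin_glb_lt; [easy|now apply Rdiv_lt_0_compat]|].
intros y Hy. assert (Y1 := Rlt_le_trans _ _ _ Hy (Rmin_l _ _)).
assert (Y2 := Rlt_le_trans _ _ _ Hy (Rmin_r _ _)).
assert (Ya : (Cmod (a - a) < r)%R).
{ replace (a - a) with (RtoC 0) by ring. now rewrite Cmod_0. }
assert (I := is_cint_bound (fun t => Phi y t - Phi a t - (y - a) * Phi' t) u v
  (M * Cmod (y - a) ^ 2) (cint (Phi y) u v - cint (Phi a) u v - (y - a) * cint Phi' u v) Huv).
rewrite (Cmult_comm (cint Phi' u v)).
eapply Rle_trans; [apply I|].
- intros t Ht. auto.
- apply is_cint_minus; [apply is_cint_minus|apply is_cint_scal]; apply cint_correct; auto.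
- set (m := Cmod (y - a)) in *. assert (m0 : (0 <= m)%R) by apply Cmod_ge_0.
  assert (MM := Rle_abs M). apply Rlt_div_r in Y2; [|easy].
  assert (X : (M * (v - u) <= K)%R).
  { unfold K. apply Rle_trans with (Rabs M * (v - u))%R; [|lra]. apply Rmult_le_compat_r; lra. }
  replace (M * m ^ 2 * (v - u))%R with (m * m * (M * (v - u)))%R by ring.
  apply Rle_trans with (m * m * K)%R; [apply Rmult_le_compat_l; nra|]. nra.
Qed.

Lemma pcont_bounded (f : R -> C) (u v : R) : (u <= v)%R ->
  (forall t, (u <= t <= v)%R -> pcont f t) ->
  exists M, (0 <= M)%R /\ forall t, (u <= t <= v)%R -> (Cmod (f t) <= M)%R.
Proof.
intros Huv Hf.
destruct (continuity_ab_maj (fun t => Cmod (f t)) u v Huv) as [x [Hx _]].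
- intros t Ht. apply continuity_pt_filterlim, continuous_eps. intros e He.
  destruct (Hf t Ht e He) as [d [Hd Hd']]. exists d. split; [easy|]. intros y Hy.
  eapply Rle_lt_trans; [|apply (Hd' y Hy)].
  assert (T1 := Cmod_triangle_rev (f y) (f t)). assert (T2 := Cmod_triangle_rev (f t) (f y)).
  rewrite Cmod_minus_sym in T2. apply Rabs_le. lra.
- exists (Cmod (f x)). split; [apply Cmod_ge_0|easy].
Qed.

(** Used with [u = z - a], [v = y - a] for the Cauchy kernel and its derivative. The remainders are
    exactly [v^2 / (u^2 (u - v))] and [v^2 (1 / (u^2 (u - v)^2) + 2 / (u^3 (u - v)))]; since
    [|u - v| >= d / 2], the constants are 2 and [4 + 4]. *)
Lemma kernel_expansion (u v : C) (d : R) : (0 < d)%R -> (d <= Cmod u)%R -> (Cmod v < d / 2)%R ->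
  (Cmod (/ (u - v) - / u - v * (/ (u * u))) <= 2 / d ^ 3 * Cmod v ^ 2)%R /\
  (Cmod (/ ((u - v) * (u - v)) - / (u * u) - v * (2 / (u * u * u))) <= 8 / d ^ 4 * Cmod v ^ 2)%R.
Proof.
intros Hd Hu Hv.
assert (Huv : (d / 2 <= Cmod (u - v))%R) by (assert (T := Cmod_triangle_rev u v); lra).
assert (nu : u <> 0) by (apply Cmod_gt_0; lra).
assert (nuv : u - v <> 0) by (apply Cmod_gt_0; lra).
assert (I1 : (Cmod (/ u) <= / d)%R).
{ rewrite Cmod_inv by easy. apply Rinv_le_contravar; lra. }
assert (I2 : (Cmod (/ (u - v)) <= 2 * / d)%R).
{ rewrite Cmod_inv by easy. replace (2 * / d)%R with (/ (d / 2))%R by (field; lra).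
  apply Rinv_le_contravar; lra. }
assert (J1 := Cmod_ge_0 (/ u)). assert (J2 := Cmod_ge_0 (/ (u - v))).
assert (Hid : (0 < / d)%R) by now apply Rinv_0_lt_compat.
split.
- replace (/ (u - v) - / u - v * / (u * u)) with ((/ (u - v) * (/ u * / u)) * (v * v)) by (field; auto).
  rewrite !Cmod_mult. replace (Cmod v ^ 2)%R with (Cmod v * Cmod v)%R by ring.
  apply Rmult_le_compat_r; [assert (X := Cmod_ge_0 v); nra|].
  replace (2 / d ^ 3)%R with ((2 * / d) * (/ d * / d))%R by (field; lra).
  apply Rmult_le_compat; try nra. 
- replace (/ ((u - v) * (u - v)) - / (u * u) - v * (2 / (u * u * u))) with
   (((/ u * / u) * (/ (u - v) * / (u - v)) + 2 * ((/ u * / u) * (/ u * / (u - v)))) * (v * v)) by (field; auto).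
  rewrite (Cmod_mult _ (v * v)), (Cmod_mult v v). replace (Cmod v ^ 2)%R with (Cmod v * Cmod v)%R by ring.
  apply Rmult_le_compat_r; [assert (X := Cmod_ge_0 v); nra|].
  eapply Rle_trans; [apply Cmod_triangle|]. rewrite !Cmod_mult, (Cmod_real 2) by lra.
  assert (A1 : (Cmod (/ u) * Cmod (/ u) <= / d * / d)%R) by (apply Rmult_le_compat; easy).
  assert (A2 : (Cmod (/ (u - v)) * Cmod (/ (u - v)) <= (2 * / d) * (2 * / d))%R) by (apply Rmult_le_compat; easy).
  assert (A3 : (Cmod (/ u) * Cmod (/ (u - v)) <= / d * (2 * / d))%R) by (apply Rmult_le_compat; easy).
  replace (8 / d ^ 4)%R with ((/ d * / d) * ((2 * / d) * (2 * / d)) + 2 * ((/ d * / d) * (/ d * (2 * / d))))%R by (field; lra).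
  apply Rplus_le_compat; [|apply Rmult_le_compat_l; [lra|]]; apply Rmult_le_compat; nra.
Qed.

(** Cauchy's formula is differentiated twice under the integral: [K1] represents [f], its derivative
    [K2] represents [f'], and [K2] is differentiable again. *)
Theorem C_derive_cdiff (f : C -> C) : (forall z, unit_disk z -> cdiff f z) ->
  forall z, unit_disk z -> cdiff (C_derive f) z.
Proof.
intros Hf a0 Ha0. assert (Ha0' := Ha0). unfold unit_disk in Ha0'. assert (P := two_PI_pos).
assert (r0 := Cmod_ge_0 a0).
set (rho := ((1 + Cmod a0) / 2)%R). set (s := ln rho).
assert (Hrho : (Cmod a0 < rho < 1)%R) by (unfold rho; lra).
assert (Es : exp s = rho) by (apply exp_ln; lra).
assert (Hs : (s < 0)%R) by (unfold s; rewrite <- ln_1; apply ln_increasing; lra).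
set (h := fun t => f (Cexp (s, t)) * Cexp (s, t)).
set (Z := fun t : R => Cexp (s, t)).
assert (HZ : forall t, Cmod (Z t) = rho) by (intros t; unfold Z; now rewrite Cmod_Cexp_pair).
assert (hc : forall t, pcont h t).
{ intros t. apply (circle_pcont (fun z => f z * z)). apply ccont_mult; [|apply ccont_id].
  apply cdiff_ccont, Hf. unfold unit_disk. rewrite Cmod_Cexp_pair, Es. lra. }
destruct (pcont_bounded h 0 (2 * PI) ltac:(lra) ltac:(auto)) as [M [HM HM']].
assert (nz : forall y t, (Cmod y < rho)%R -> Z t - y <> 0).
{ intros y t Hy E. apply Ceq_minus in E. rewrite <- E, HZ in Hy. lra. }
assert (pc : forall (k : C -> C) t, ccont k (Z t) -> pcont (fun t => h t * k (Z t)) t).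
{ intros k t Hk. apply pcont_mult; [auto|]. now apply circle_pcont. }
assert (pc1 : forall y t, (Cmod y < rho)%R -> pcont (fun t => h t * / (Z t - y)) t).
{ intros y t Hy. apply (pc (fun z => / (z - y))). apply ccont_inv; [|auto].
  apply ccont_minus; [apply ccont_id|apply ccont_const]. }
assert (pc2 : forall y t, (Cmod y < rho)%R -> pcont (fun t => h t * / ((Z t - y) * (Z t - y))) t).
{ intros y t Hy. apply (pc (fun z => / ((z - y) * (z - y)))).
  apply ccont_inv; [|apply Cmult_neq_0; auto].
  apply ccont_mult; (apply ccont_minus; [apply ccont_id|apply ccont_const]). }
assert (pc3 : forall y t, (Cmod y < rho)%R ->
  pcont (fun t => h t * (2 / ((Z t - y) * (Z t - y) * (Z t - y)))) t).
{ intros y t Hy. apply (pc (fun z => 2 / ((z - y) * (z - y) * (z - y)))).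
  apply ccont_div; [apply ccont_const| |repeat apply Cmult_neq_0; auto].
  apply ccont_mult; [apply ccont_mult|]; (apply ccont_minus; [apply ccont_id|apply ccont_const]). }
set (K1 := fun y => cint (fun t => h t * / (Z t - y)) 0 (2 * PI)).
set (K2 := fun y => cint (fun t => h t * / ((Z t - y) * (Z t - y))) 0 (2 * PI)).
assert (near : forall a y, (Cmod a < rho)%R -> (Cmod (y - a) < (rho - Cmod a) / 2)%R -> (Cmod y < rho)%R).
{ intros a y Ha Hy. assert (T := Cmod_triangle_rev y a). lra. }
assert (du : forall a t, (rho - Cmod a <= Cmod (Z t - a))%R).
{ intros a t. assert (T := Cmod_triangle_rev (Z t) a). rewrite HZ in T. lra. }
assert (D1 : forall a, (Cmod a < rho)%R -> cderiv K1 a (K2 a)).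
{ intros a Ha. set (d := (rho - Cmod a)%R).
  apply (cint_param_cderiv (fun y t => h t * / (Z t - y)) _ a 0 (2 * PI) (d / 2) (M * (2 / d ^ 3)));
    try (unfold d; lra).
  - intros y t Hy _. apply pc1. unfold d in Hy. eauto.
  - intros t _. auto.
  - intros y t Hy Ht. destruct (kernel_expansion (Z t - a) (y - a) d ltac:(unfold d; lra) (du a t) Hy) as [X _].
    replace (Z t - a - (y - a)) with (Z t - y) in X by ring.
    replace (h t * / (Z t - y) - h t * / (Z t - a) - (y - a) * (h t * / ((Z t - a) * (Z t - a))))
      with (h t * (/ (Z t - y) - / (Z t - a) - (y - a) * / ((Z t - a) * (Z t - a)))) by ring.
    rewrite Cmod_mult, Rmult_assoc. apply Rmult_le_compat; try apply Cmod_ge_0; auto. }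
assert (D2 : cdiff K2 a0).
{ eexists. set (d := (rho - Cmod a0)%R).
  apply (cint_param_cderiv (fun y t => h t * / ((Z t - y) * (Z t - y)))
    (fun t => h t * (2 / ((Z t - a0) * (Z t - a0) * (Z t - a0)))) a0 0 (2 * PI) (d / 2) (M * (8 / d ^ 4)));
    try (unfold d; lra).
  - intros y t Hy _. apply pc2. unfold d in Hy. apply (near a0); [lra|easy].
  - intros t _. apply pc3. lra.
  - intros y t Hy Ht. destruct (kernel_expansion (Z t - a0) (y - a0) d ltac:(unfold d; lra) (du a0 t) Hy) as [_ X].
    replace (Z t - a0 - (y - a0)) with (Z t - y) in X by ring.
    match goal with |- (Cmod ?E <= _)%R => replace E with
      (h t * (/ ((Z t - y) * (Z t - y)) - / ((Z t - a0) * (Z t - a0))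
        - (y - a0) * (2 / ((Z t - a0) * (Z t - a0) * (Z t - a0))))) by ring end.
    rewrite Cmod_mult, Rmult_assoc. apply Rmult_le_compat; try apply Cmod_ge_0; auto. }
assert (np : RtoC (2 * PI) <> 0) by (apply RtoC_neq_0; lra).
assert (FK : forall y, (Cmod y < rho)%R -> / RtoC (2 * PI) * K1 y = f y).
{ intros y Hy. unfold K1. rewrite (is_cint_unique _ _ _ (RtoC (2 * PI) * f y)).
  - field. easy.
  - apply (cauchy_formula f s y); [easy|now rewrite Es|easy]. }
apply (cdiff_ext_loc (fun y => / RtoC (2 * PI) * K2 y) _ _ (rho - Cmod a0)); [lra| |].
- intros y Hy. assert (Hy' : (Cmod y < rho)%R) by (assert (T := Cmod_triangle_rev y a0); lra).
  symmetry. apply cderiv_C_derive.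
  apply (cderiv_ext_loc (fun y => / RtoC (2 * PI) * K1 y) _ _ _ (rho - Cmod y)); [lra| |].
  + intros x Hx. apply FK. assert (T := Cmod_triangle_rev x y). lra.
  + replace (/ RtoC (2 * PI) * K2 y) with (0 * K1 y + / RtoC (2 * PI) * K2 y) by ring.
    apply (cderiv_mult (fun _ => / RtoC (2 * PI)) K1); [apply cderiv_const|auto].
- apply (cdiff_mult (fun _ => / RtoC (2 * PI)) K2); [apply cdiff_const|easy].
Qed.

(** * The parabolic region and the inverse of [phi_PAR] *)

Lemma Re_Cmod_bounds (z : C) : (- Cmod z <= Re z <= Cmod z)%R.
Proof. apply Rabs_le_between, re_le_Cmod. Qed.

Lemma Csqrt_sq (z : C) : Csqrt z * Csqrt z = z.
Proof.
assert (B := Re_Cmod_bounds z). assert (N := Cmod2_alt z).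
set (m := Cmod z) in *. set (x := Re z) in *. set (y := Im z) in *.
assert (A1 := sqrt_sqrt ((m + x) / 2) ltac:(lra)). assert (A2 := sqrt_sqrt ((m - x) / 2) ltac:(lra)).
assert (A3 : (sqrt ((m + x) / 2) * sqrt ((m - x) / 2) = Rabs y / 2)%R).
{ rewrite <- sqrt_mult by lra.
  replace ((m + x) / 2 * ((m - x) / 2))%R with (Rsqr (y / 2)).
  - rewrite sqrt_Rsqr_abs. unfold Rdiv. rewrite Rabs_mult, (Rabs_pos_eq (/ 2)) by lra. easy.
  - unfold Rsqr. nra. }
replace z with (x, y) at 3 by (unfold x, y; now destruct z).
unfold Csqrt. fold m x y. destruct (Rle_dec 0 y) as [H|H]; unfold Cmult; simpl; f_equal.
- lra.
- rewrite (Rmult_comm (sqrt ((m - x) / 2))), A3, Rabs_pos_eq; lra.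
- lra.
- rewrite Rabs_left in A3 by lra. lra.
Qed.

Lemma Csqrt_Re_ge_0 (z : C) : (0 <= Re (Csqrt z))%R.
Proof. apply sqrt_pos. Qed.

Lemma Csqrt_Re_pos (z : C) : (0 < Re z)%R -> (0 < Re (Csqrt z))%R.
Proof.
intros H. unfold Csqrt; simpl. apply sqrt_lt_R0. assert (B := Re_Cmod_bounds z). lra.
Qed.

Lemma Cmod_Csqrt (z : C) : (Cmod (Csqrt z) * Cmod (Csqrt z) = Cmod z)%R.
Proof. now rewrite <- Cmod_mult, Csqrt_sq. Qed.

Lemma Csqrt_neq_0 (z : C) : z <> 0 -> Csqrt z <> 0.
Proof. intros n E. apply n. rewrite <- (Csqrt_sq z), E. ring. Qed.

Lemma Re_pos_neq_0 (z : C) : (0 < Re z)%R -> z <> 0.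
Proof. intros H E. rewrite E in H. simpl in H. lra. Qed.

(** The slope function is [1 / (Csqrt y + Csqrt z)]: principal roots have nonnegative real part, so
    the denominator stays away from 0 for every [y], on whichever side of the cut. *)
Lemma Csqrt_cderiv (z : C) : (0 < Re z)%R -> cderiv Csqrt z (1 / (2 * Csqrt z)).
Proof.
intros Hz. assert (Hc := Csqrt_Re_pos z Hz). set (c := Re (Csqrt z)) in *.
assert (L : forall y, (c <= Cmod (Csqrt y + Csqrt z))%R).
{ intros y. assert (B := Re_Cmod_bounds (Csqrt y + Csqrt z)). rewrite re_plus in B. fold c in B.
  assert (N := Csqrt_Re_ge_0 y). lra. }
assert (n : forall y, Csqrt y + Csqrt z <> 0) by (intros y; apply Cmod_gt_0; specialize (L y); lra).
assert (E : forall y, Csqrt y = Csqrt z + / (Csqrt y + Csqrt z) * (y - z)).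
{ intros y. replace (y - z) with (Csqrt y * Csqrt y - Csqrt z * Csqrt z) by (now rewrite !Csqrt_sq).
  field. auto. }
assert (nz := Re_pos_neq_0 _ Hc).
exists (fun y => / (Csqrt y + Csqrt z)). split; [|split; [|exact E]].
- apply ccont_inv; [|auto]. apply ccont_plus; [|apply ccont_const].
  intros e He. exists (e * c)%R. split; [nra|]. intros y Hy.
  replace (Csqrt y - Csqrt z) with ((y - z) / (Csqrt y + Csqrt z)).
  2:{ rewrite (E y) at 2. field. auto. }
  rewrite Cmod_div by auto. specialize (L y). apply Rlt_div_l; [lra|]. nra.
- field. auto.
Qed.

Lemma Csqrt_unique (s z : C) : (0 < Re s)%R -> s * s = z -> Csqrt z = s.
Proof.
intros Hs E. assert (H := Csqrt_sq z). assert (N := Csqrt_Re_ge_0 z).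
assert (D : (Csqrt z - s) * (Csqrt z + s) = 0).
{ replace ((Csqrt z - s) * (Csqrt z + s)) with (Csqrt z * Csqrt z - s * s) by ring. rewrite H, E. ring. }
apply Ceq_minus. apply NNPP. intros n. apply (Cmult_neq_0 _ (Csqrt z + s)) in n; [easy|].
apply Re_pos_neq_0. rewrite re_plus. lra.
Qed.

Lemma Csqrt_1 : Csqrt 1 = 1.
Proof. apply Csqrt_unique; [simpl; lra|ring]. Qed.

Lemma sq_eq_cases (a b : C) : a * a = b * b -> a = b \/ a = - b.
Proof.
intros H. destruct (Ceq_dec a b) as [E|n]; [now left|]. right.
apply NNPP. intros m. apply Cminus_eq_contra in n, m.
apply (Cmult_neq_0 _ _ n m). replace ((a - b) * (a - - b)) with (a * a - b * b) by ring. rewrite H. ring.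
Qed.

(** * The logarithm on the right half-plane, and the parabola as image of a strip *)

Lemma Carg_bound (u : C) : (0 < Re u)%R -> (Rabs (Carg u) < PI / 2)%R.
Proof.
intros Hu. assert (P := Cmod_pos _ (Re_pos_neq_0 _ Hu)). assert (B := Re_Cmod_bounds u).
assert (X : (0 < Re u / Cmod u <= 1)%R).
{ split; [now apply Rdiv_lt_0_compat|]. apply Rle_div_l; lra. }
set (x := (Re u / Cmod u)%R) in *. assert (A := acos_bound x).
assert (A2 : (acos x < PI / 2)%R).
{ apply Rnot_le_lt. intros L. assert (C1 := cos_le_0 (acos x) L ltac:(lra)).
  rewrite cos_acos in C1; lra. }
unfold Carg. fold x. destruct Rle_dec; [|rewrite Rabs_Ropp]; rewrite Rabs_pos_eq; lra.
Qed.

Lemma Clog_Cexp (l : C) : (Rabs (Im l) < PI / 2)%R -> Clog (Cexp l) = l.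
Proof.
intros Hl. apply Rabs_lt_between in Hl. unfold Clog. rewrite Cmod_Cexp, ln_exp.
destruct l as [x y]. unfold Carg. rewrite Cmod_Cexp. simpl in *. f_equal.
assert (E := exp_pos x).
replace (exp x * cos y / exp x)%R with (cos y) by (field; lra).
destruct (Rle_lt_dec 0 y) as [Hy|Hy].
- assert (S := sin_ge_0 y Hy ltac:(lra)). destruct Rle_dec as [_|n]; [|exfalso; apply n; nra].
  apply acos_cos; lra.
- assert (S := sin_lt_0_var y ltac:(lra) Hy). destruct Rle_dec as [n|_]; [exfalso; nra|].
  rewrite <- (cos_neg y), acos_cos; lra.
Qed.

Definition parabolic_region (q : C) : Prop := (Cmod (q - 1) < Re q)%R.

(** For [x = k l^2] with [k = 2 / PI^2] one has [|x| - Re x = 2 k (Im l)^2], which is below 1 iff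
    [(Im l)^2 < PI^2 / 4]. *)
Lemma parabolic_region_iff (l : C) :
  parabolic_region (1 + RtoC (2 / (PI * PI)) * (l * l)) <-> (Rabs (Im l) < PI / 2)%R.
Proof.
unfold parabolic_region. assert (P := PI_RGT_0). assert (P2 : (0 < PI * PI)%R) by nra.
set (k := (2 / (PI * PI))%R). assert (Hk : (0 < k)%R) by (apply Rdiv_lt_0_compat; lra).
replace (1 + RtoC k * (l * l) - 1) with (RtoC k * (l * l)) by ring.
rewrite !Cmod_mult, Cmod_real by lra.
replace (Cmod l * Cmod l)%R with (Cmod l ^ 2)%R by ring. rewrite Cmod2_alt.
rewrite re_plus, re_scal_l, re_mult. destruct l as [x y]. simpl.
assert (E : (k * (PI * PI) = 2)%R) by (unfold k; field; lra).
split; intros H.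
- apply Rnot_le_lt. intros L.
  assert (L2 : (PI / 2 * (PI / 2) <= Rabs y * Rabs y)%R) by (apply Rmult_le_compat; lra).
  replace (Rabs y * Rabs y)%R with (y * y)%R in L2 by (rewrite <- Rabs_mult, Rabs_pos_eq; nra).
  assert (k * (PI / 2 * (PI / 2)) <= k * (y * y))%R by (apply Rmult_le_compat_l; lra). nra.
- assert (L2 : (Rabs y * Rabs y < PI / 2 * (PI / 2))%R).
  { apply Rmult_le_0_lt_compat; try apply Rabs_pos; easy. }
  replace (Rabs y * Rabs y)%R with (y * y)%R in L2 by (rewrite <- Rabs_mult, Rabs_pos_eq; nra).
  assert (k * (y * y) < k * (PI / 2 * (PI / 2)))%R by (apply Rmult_lt_compat_l; lra). nra.
Qed.

Lemma Csqrt_upper_sq (z : C) : Csqrt_upper z * Csqrt_upper z = z.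
Proof.
unfold Csqrt_upper. destruct Rle_dec; rewrite <- (Csqrt_sq z) at 3; ring.
Qed.

Lemma cayley_Re_pos (s : C) : unit_disk s -> (0 < Re ((1 + s) / (1 - s)))%R.
Proof.
intros Hs. unfold unit_disk in Hs.
assert (n : 1 - s <> 0).
{ intros E. apply Ceq_minus in E. rewrite <- E, Cmod_1 in Hs. lra. }
assert (N : (Cmod s ^ 2 < 1)%R) by (assert (X := Cmod_ge_0 s); nra).
assert (Q : (0 < Cmod (1 - s) ^ 2)%R) by (apply pow_lt, Cmod_pos, n).
rewrite Cmod2_alt in N, Q. destruct s as [x y].
unfold Cdiv, Cinv, Cmult, Cplus, Cminus, Copp, RtoC in *; simpl in *.
set (D := ((1 + - x) * ((1 + - x) * 1) + (0 + - y) * ((0 + - y) * 1))%R) in *.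
replace (_ - _)%R with ((1 - (x * x + y * y)) / D)%R by (field; lra).
apply Rdiv_lt_0_compat; lra.
Qed.

Lemma phi_PAR_region (z : C) : unit_disk z -> parabolic_region (phi_PAR z).
Proof.
intros Hz. unfold phi_PAR. apply parabolic_region_iff. apply Carg_bound, cayley_Re_pos.
unfold unit_disk in *. assert (E := Csqrt_upper_sq z).
assert (E2 : (Cmod (Csqrt_upper z) * Cmod (Csqrt_upper z) = Cmod z)%R) by (now rewrite <- Cmod_mult, E).
apply Rnot_le_lt. intros L. nra.
Qed.

(** This is [tanh (l / 2)], the inverse of [s |-> log ((1 + s) / (1 - s))] from the strip to the
    disk. *)
Definition tanh_half (l : C) : C := (Cexp l - 1) / (Cexp l + 1).

Lemma Cexp_opp_r (l : C) : Cexp l * Cexp (- l) = 1.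
Proof. rewrite <- Cexp_plus. replace (l + - l) with (RtoC 0) by ring. apply Cexp_0. Qed.

Lemma tanh_half_opp (l : C) : Cexp l + 1 <> 0 -> tanh_half (- l) = - tanh_half l.
Proof.
intros n. unfold tanh_half. assert (E := Cexp_opp_r l). assert (nl := Cexp_neq_0 l).
replace (Cexp (- l)) with (/ Cexp l).
- field. repeat split; auto. replace (1 + Cexp l) with (Cexp l + 1) by ring. auto.
- rewrite <- (Cmult_1_r (/ Cexp l)), <- E. field. auto.
Qed.

(* Also true at the poles, where the junk value does not depend on the sign. *)
Lemma tanh_half_sq_even (l : C) : tanh_half (- l) * tanh_half (- l) = tanh_half l * tanh_half l.
Proof.
destruct (Ceq_dec (Cexp l + 1) 0) as [E|n].
- assert (E1 : Cexp l = - (1)) by (replace (Cexp l) with (Cexp l + 1 - 1) by ring; rewrite E; ring).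
  assert (E2 : Cexp (- l) = - (1)).
  { replace (Cexp (- l)) with (- (- (1) * Cexp (- l))) by ring. rewrite <- E1, Cexp_opp_r. now rewrite E1. }
  unfold tanh_half. now rewrite E1, E2.
- rewrite (tanh_half_opp l n). ring.
Qed.

Lemma Cexp_Re_pos (l : C) : (Rabs (Im l) < PI / 2)%R -> (0 < Re (Cexp l))%R.
Proof.
intros H. apply Rabs_lt_between in H. unfold Cexp; simpl.
apply Rmult_lt_0_compat; [apply exp_pos|apply cos_gt_0; lra].
Qed.

Lemma Cexp_plus_1_neq_0 (l : C) : (Rabs (Im l) < PI / 2)%R -> Cexp l + 1 <> 0.
Proof.
intros H. apply Re_pos_neq_0. rewrite re_plus. assert (X := Cexp_Re_pos l H). simpl. simpl in X. lra.
Qed.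

Lemma tanh_half_disk (l : C) : (Rabs (Im l) < PI / 2)%R -> unit_disk (tanh_half l).
Proof.
intros H. assert (X := Cexp_Re_pos l H). assert (n := Cexp_plus_1_neq_0 l H).
unfold unit_disk, tanh_half. rewrite Cmod_div by easy. assert (P := Cmod_pos _ n).
apply Rlt_div_l; [easy|]. rewrite Rmult_1_l.
assert (A := Cmod2_alt (Cexp l - 1)). assert (B := Cmod2_alt (Cexp l + 1)).
destruct (Cexp l) as [x y]. simpl in A, B, X.
apply Rnot_le_lt. intros L. nra.
Qed.

Lemma cayley_tanh_half (l : C) : Cexp l + 1 <> 0 ->
  (1 + tanh_half l) / (1 - tanh_half l) = Cexp l.
Proof.
intros n. unfold tanh_half.
assert (n2 : RtoC 2 <> 0) by (apply RtoC_neq_0; lra).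
field. split; [easy|].
replace (Cexp l + 1 - (Cexp l - 1)) with (RtoC 2) by ring. easy.
Qed.

(** [Csqrt_upper] returns [tanh_half l] or its negative; the latter only changes the sign of the
    logarithm, which is squared. *)
Lemma phi_PAR_tanh_half (l : C) : (Rabs (Im l) < PI / 2)%R ->
  phi_PAR (tanh_half l * tanh_half l) = 1 + RtoC (2 / (PI * PI)) * (l * l).
Proof.
intros H. assert (n := Cexp_plus_1_neq_0 l H). unfold phi_PAR.
set (s := Csqrt_upper (tanh_half l * tanh_half l)).
destruct (sq_eq_cases s (tanh_half l)) as [-> | ->]; [apply Csqrt_upper_sq| |].
- now rewrite cayley_tanh_half, Clog_Cexp.
- assert (H' : (Rabs (Im (- l)) < PI / 2)%R) by (rewrite im_opp, Rabs_Ropp; exact H).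
  rewrite <- tanh_half_opp, cayley_tanh_half, Clog_Cexp by (easy || now apply Cexp_plus_1_neq_0).
  ring.
Qed.

(** Solves [q = 1 + (2 / PI^2) l^2] for [l], then takes [z = tanh (l / 2)^2]. This is even in [l],
    so it is analytic although the root is not. *)
Definition phi_PAR_inv (q : C) : C :=
  let t := tanh_half (Csqrt (RtoC (PI * PI / 2) * (q - 1))) in t * t.

Lemma PI_sq_half_pos : (0 < PI * PI / 2)%R.
Proof. assert (P := PI_RGT_0). nra. Qed.

Lemma parabolic_region_root (q : C) : parabolic_region q ->
  (Rabs (Im (Csqrt (RtoC (PI * PI / 2) * (q - 1)))) < PI / 2)%R /\
  q = 1 + RtoC (2 / (PI * PI)) *
    (Csqrt (RtoC (PI * PI / 2) * (q - 1)) * Csqrt (RtoC (PI * PI / 2) * (q - 1))).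
Proof.
intros H. assert (E : q = 1 + RtoC (2 / (PI * PI)) *
    (Csqrt (RtoC (PI * PI / 2) * (q - 1)) * Csqrt (RtoC (PI * PI / 2) * (q - 1)))).
{ rewrite Csqrt_sq, Cmult_assoc, <- RtoC_mult.
  replace (2 / (PI * PI) * (PI * PI / 2))%R with 1%R by (field; apply PI_neq0). ring. }
split; [|easy]. apply parabolic_region_iff. now rewrite <- E.
Qed.

Lemma phi_PAR_inv_disk (q : C) : parabolic_region q -> unit_disk (phi_PAR_inv q).
Proof.
intros H. destruct (parabolic_region_root q H) as [B _].
assert (D := tanh_half_disk _ B). unfold phi_PAR_inv, unit_disk in *. cbv zeta. rewrite Cmod_mult.
set (m := Cmod _) in *. assert (0 <= m)%R by apply Cmod_ge_0. nra.
Qed.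

Lemma phi_PAR_invK (q : C) : parabolic_region q -> phi_PAR (phi_PAR_inv q) = q.
Proof.
intros H. destruct (parabolic_region_root q H) as [B E]. unfold phi_PAR_inv. cbv zeta.
rewrite phi_PAR_tanh_half by easy. now rewrite <- E.
Qed.

Lemma tanh_half_cdiff (l : C) : Cexp l + 1 <> 0 -> cdiff tanh_half l.
Proof.
intros n. apply cdiff_div; [| |easy].
- apply cdiff_minus; [apply Cexp_cdiff|apply cdiff_const].
- apply cdiff_plus; [apply Cexp_cdiff|apply cdiff_const].
Qed.

Lemma tanh_half_0 : tanh_half 0 = 0.
Proof. unfold tanh_half. rewrite Cexp_0. field. Qed.

Lemma Csqrt_0 : Csqrt 0 = 0.
Proof.
destruct (Ceq_dec (Csqrt 0) 0) as [E|n]; [easy|].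
exfalso. apply (Cmult_neq_0 _ _ n n). apply Csqrt_sq.
Qed.

Lemma phi_PAR_inv_1 : phi_PAR_inv 1 = 0.
Proof.
unfold phi_PAR_inv. cbv zeta. replace (RtoC (PI * PI / 2) * (1 - 1)) with (RtoC 0) by ring.
rewrite Csqrt_0, tanh_half_0. ring.
Qed.

Lemma Csqrt_ccont_0 : ccont Csqrt 0.
Proof.
intros e He. exists (e * e)%R. split; [nra|]. intros y Hy.
rewrite Csqrt_0. replace (y - 0) with y in Hy by ring. replace (Csqrt y - 0) with (Csqrt y) by ring.
assert (E := Cmod_Csqrt y). apply Rnot_le_lt. intros L. nra.
Qed.

(* Away from [q = 1] a local branch of the root is used; evenness makes the
   choice of the branch irrelevant. *)
Lemma phi_PAR_inv_cdiff (q : C) : parabolic_region q -> cdiff phi_PAR_inv q.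
Proof.
intros H. destruct (parabolic_region_root q H) as [B _].
assert (K := PI_sq_half_pos). set (k := (PI * PI / 2)%R) in *.
assert (nk : RtoC k <> 0) by (apply RtoC_neq_0; lra).
destruct (Ceq_dec q 1) as [->|n].
(* The root is only continuous at [q = 1]. But [tanh_half l = t(l) l] with [t] continuous at 0, so
   the square is [t(l)^2 l^2 = t(l)^2 k (q - 1)], which exhibits a continuous slope. *)
- assert (T : cdiff tanh_half 0).
  { apply tanh_half_cdiff. rewrite Cexp_0, <- RtoC_plus. apply RtoC_neq_0. lra. }
  destruct T as [l [t [Ht [_ E]]]]. eexists.
  exists (fun q => t (Csqrt (RtoC k * (q - 1))) * t (Csqrt (RtoC k * (q - 1))) * RtoC k).
  split; [|split; [reflexivity|]].
  + assert (Z : RtoC k * (1 - 1) = 0) by ring.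
    assert (C0 : ccont (fun q => t (Csqrt (RtoC k * (q - 1)))) 1).
    { apply (ccont_comp (fun q => Csqrt (RtoC k * (q - 1))) t).
      - apply (ccont_comp (fun q => RtoC k * (q - 1)) Csqrt).
        + apply ccont_mult; [apply ccont_const|]. apply ccont_minus; [apply ccont_id|apply ccont_const].
        + rewrite Z. apply Csqrt_ccont_0.
      - now rewrite Z, Csqrt_0. }
    apply ccont_mult; [now apply ccont_mult|apply ccont_const].
  + intros y. rewrite phi_PAR_inv_1. unfold phi_PAR_inv. fold k. cbv zeta.
    set (l' := Csqrt (RtoC k * (y - 1))). rewrite (E l'), tanh_half_0.
    replace ((0 + t l' * (l' - 0)) * (0 + t l' * (l' - 0))) with (t l' * t l' * (l' * l')) by ring.
    unfold l' at 3 4. rewrite Csqrt_sq. ring.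
- set (U0 := RtoC k * (q - 1)) in *. set (l0 := Csqrt U0) in *.
  assert (nq : q - 1 <> 0) by now apply Cminus_eq_contra.
  assert (nU : U0 <> 0) by now apply Cmult_neq_0.
  (* The ratio is 1 at [q], far from the cut, so [L] is a root of [k (y - 1)] differentiable at [q]
     even if [U0] lies on the cut. *)
  set (L := fun y => l0 * Csqrt (RtoC k * (y - 1) / U0)).
  assert (U1 : RtoC k * (q - 1) / U0 = 1) by (unfold U0; field; auto).
  assert (Lq : L q = l0) by (unfold L; rewrite U1, Csqrt_1; ring).
  apply (cdiff_ext_loc (fun y => tanh_half (L y) * tanh_half (L y)) _ _ 1); [lra| |].
  + intros y _. unfold phi_PAR_inv. fold k. cbv zeta. set (l' := Csqrt (RtoC k * (y - 1))).
    destruct (sq_eq_cases (L y) l') as [-> | ->]; [|easy|apply tanh_half_sq_even].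
    unfold L, l'. rewrite Csqrt_sq.
    match goal with |- ?X * ?Y * (?X * ?Y) = _ => replace (X * Y * (X * Y)) with ((X * X) * (Y * Y)) by ring end.
    unfold l0. rewrite !Csqrt_sq. field. auto.
  + assert (D : cdiff (fun y => tanh_half (L y)) q).
    { apply cdiff_comp; [|rewrite Lq; now apply tanh_half_cdiff, Cexp_plus_1_neq_0].
      unfold L. apply (cdiff_mult (fun _ => l0)); [apply cdiff_const|].
      apply (cdiff_comp (fun y => RtoC k * (y - 1) / U0) Csqrt).
      - apply cdiff_div; [|apply cdiff_const|easy].
        apply (cdiff_mult (fun _ => RtoC k)); [apply cdiff_const|].
        apply cdiff_minus; [apply cdiff_id|apply cdiff_const].
      - rewrite U1. eexists. apply Csqrt_cderiv. simpl. lra. }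
    now apply cdiff_mult.
Qed.

(** * The radii *)

Lemma parabolic_region_shift (x : C) : (Cmod x - Re x < 1)%R -> parabolic_region (1 + x).
Proof.
unfold parabolic_region. replace (1 + x - 1) with x by ring. rewrite re_plus. simpl. lra.
Qed.

Lemma dilation_disk (r : R) (z : C) : (0 < r <= 1)%R -> unit_disk z ->
  (Cmod (RtoC r * z) < r)%R /\ unit_disk (RtoC r * z).
Proof.
unfold unit_disk. intros Hr Hz. rewrite Cmod_mult, Cmod_real by lra. assert (H := Cmod_ge_0 z). nra.
Qed.

Lemma scale_cderiv (r : R) (z : C) : cderiv (fun y => RtoC r * y) z (RtoC r).
Proof.
assert (D := cderiv_mult _ _ _ _ _ (cderiv_const (RtoC r) z) (cderiv_id z)). cbv beta in D.
now replace (0 * z + RtoC r * 1) with (RtoC r) in D by ring.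
Qed.

Lemma dilation_cderiv (f : C -> C) (r : R) (z l : C) : (0 < r)%R ->
  cderiv f (RtoC r * z) l -> cderiv (dilation r f) z l.
Proof.
intros Hr Hf. assert (n : RtoC r <> 0) by (apply RtoC_neq_0; lra).
unfold dilation.
replace l with ((l * RtoC r * RtoC r - f (RtoC r * z) * 0) / (RtoC r * RtoC r)) by (field; easy).
apply (cderiv_div (fun y => f (RtoC r * y)) (fun _ => RtoC r)); [|apply cderiv_const|easy].
apply (cderiv_comp (fun y => RtoC r * y) f); [apply scale_cderiv|easy].
Qed.

(** Here [q] is [z f' / f] with its value 1 at the origin, and the dilation replaces it by
    [q (r z)]. If the values lie in the region, [phi_PAR_inv] composed with [q (r z)] is the Schwarz
    function required for subordination. *)
Lemma parabolic_starlike_dilation (f q : C -> C) (r : R) : (0 < r <= 1)%R -> class_A f ->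
  (forall z, unit_disk z -> cdiff q z) -> q 0 = 1 ->
  (forall z, unit_disk z -> z <> 0 -> f z <> 0 /\ z * C_derive f z = q z * f z) ->
  (parabolic_starlike (dilation r f) <-> forall z, (Cmod z < r)%R -> parabolic_region (q z)).
Proof.
intros Hr [Hf [f0 f1]] Hq q0 Hfq. rewrite analytic_iff in Hf.
assert (n : RtoC r <> 0) by (apply RtoC_neq_0; lra).
assert (Hd : forall y, unit_disk y -> C_derive (dilation r f) y = C_derive f (RtoC r * y)).
{ intros y Hy. apply cderiv_C_derive, dilation_cderiv; [lra|].
  apply cdiff_C_derive, Hf, dilation_disk; easy. }
assert (Hquot : forall y, unit_disk y -> y <> 0 -> dilation r f y <> 0 /\
  q (RtoC r * y) = y * C_derive (dilation r f) y / dilation r f y).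
{ intros y Hy ny. destruct (dilation_disk r y Hr Hy) as [_ Dy].
  destruct (Hfq _ Dy) as [E1 E2]; [now apply Cmult_neq_0|].
  split.
  - unfold dilation. intros E. apply E1.
    replace (f (RtoC r * y)) with (f (RtoC r * y) / RtoC r * RtoC r) by (field; easy). rewrite E. ring.
  - rewrite Hd by easy. unfold dilation.
    replace (y * C_derive f (RtoC r * y) / (f (RtoC r * y) / RtoC r))
      with ((RtoC r * y * C_derive f (RtoC r * y)) / f (RtoC r * y)) by (field; auto).
    rewrite E2. field. easy. }
split.
- intros [_ [q' [[_ Q1] [_ [w [_ [Hw [_ Q2]]]]]]]] z Hz.
  destruct (Ceq_dec z 0) as [->|nz].
  { rewrite q0. unfold parabolic_region. replace (1 - 1) with (RtoC 0) by ring. rewrite Cmod_0. simpl. lra. }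
  set (y := z / RtoC r). assert (Ez : z = RtoC r * y) by (unfold y; field; easy).
  assert (Dy : unit_disk y).
  { unfold unit_disk, y. rewrite Cmod_div, Cmod_real by (easy || lra). apply Rlt_div_l; lra. }
  assert (ny : y <> 0) by (intros E; apply nz; rewrite Ez, E; ring).
  destruct (Q1 y Dy ny) as [_ E1]. destruct (Hquot y Dy ny) as [_ E2].
  rewrite Ez, E2, <- E1, Q2 by easy. now apply phi_PAR_region, Hw.
- intros H. split; [split; [|split]|].
  + apply analytic_iff. intros y Hy. destruct (dilation_disk r y Hr Hy) as [_ Dy].
    destruct (Hf _ Dy) as [l Hl]. exists l. apply dilation_cderiv; [lra|easy].
  + unfold dilation. rewrite Cmult_0_r, f0. field. easy.
  + apply is_derive_cderiv, dilation_cderiv; [lra|]. rewrite Cmult_0_r. now apply is_derive_cderiv.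
  + assert (Qd : forall y, unit_disk y -> cdiff (fun y => q (RtoC r * y)) y).
    { intros y Hy. apply (cdiff_comp (fun y => RtoC r * y) q).
      - eexists. apply scale_cderiv.
      - now apply Hq, dilation_disk. }
    exists (fun y => q (RtoC r * y)). split; [split|split].
    * now apply analytic_iff.
    * exact Hquot.
    * now apply analytic_iff.
    * exists (fun y => phi_PAR_inv (q (RtoC r * y))).
      assert (Hin : forall y, unit_disk y -> parabolic_region (q (RtoC r * y))).
      { intros y Hy. now apply H, dilation_disk. }
      split; [|split; [|split]].
      -- apply analytic_iff. intros y Hy.
         apply (cdiff_comp (fun y => q (RtoC r * y)) phi_PAR_inv); [now apply Qd|].
         now apply phi_PAR_inv_cdiff, Hin.
      -- intros y Hy. now apply phi_PAR_inv_disk, Hin.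
      -- rewrite Cmult_0_r, q0. apply phi_PAR_inv_1.
      -- intros y Hy. now rewrite phi_PAR_invK by now apply Hin.
Qed.

(* [kappa] is the logarithmic derivative of the zero-free function [phi]. *)
Definition log_pair (phi kappa : C -> C) : Prop :=
  phi 0 = 1 /\ forall z, unit_disk z ->
    phi z <> 0 /\ cderiv phi z (phi z * kappa z) /\ cdiff kappa z.

(* The logarithmic term [z (phi o w)' / (phi o w)]. *)
Definition log_term (kappa w : C -> C) (z : C) : C := z * C_derive w z * kappa (w z).

Definition log_sum (kphi kpsi w1 w2 w3 : C -> C) (z : C) : C :=
  log_term kphi w1 z + log_term kphi w2 z + log_term kpsi w3 z.

Lemma schwarz_fun_id : schwarz_fun (fun z => z).
Proof. split; [|split]; auto. intros z _. apply cdiff_id. Qed.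

Lemma log_pair_comp (phi kappa w : C -> C) (z : C) : log_pair phi kappa -> schwarz_fun w ->
  unit_disk z -> phi (w z) <> 0 /\
  cderiv (fun y => phi (w y)) z (phi (w z) * kappa (w z) * C_derive w z).
Proof.
intros [_ Hp] [Hw1 [Hw2 _]] Hz. destruct (Hp _ (Hw2 z Hz)) as [n [Hd _]].
split; [easy|]. apply (cderiv_comp w phi); [|easy]. apply cdiff_C_derive. auto.
Qed.

Lemma log_term_cdiff (phi kappa w : C -> C) (z : C) : log_pair phi kappa -> schwarz_fun w ->
  unit_disk z -> cdiff (log_term kappa w) z.
Proof.
intros [_ Hp] [Hw1 [Hw2 _]] Hz.
apply (cdiff_mult (fun z => z * C_derive w z) (fun z => kappa (w z))).
- apply (cdiff_mult (fun z => z)); [apply cdiff_id|]. now apply C_derive_cdiff.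
- apply cdiff_comp; [auto|]. apply Hp. auto.
Qed.

Lemma product_log_derivative (phi kphi psi kpsi f w1 w2 w3 : C -> C) (z : C) :
  log_pair phi kphi -> log_pair psi kpsi ->
  schwarz_fun w1 -> schwarz_fun w2 -> schwarz_fun w3 ->
  (forall y, unit_disk y -> f y = y * (phi (w1 y) * phi (w2 y) * psi (w3 y))) ->
  unit_disk z -> z <> 0 ->
  f z <> 0 /\ z * C_derive f z = (1 + log_sum kphi kpsi w1 w2 w3 z) * f z.
Proof.
intros Hphi Hpsi S1 S2 S3 Hf Hz nz.
destruct (log_pair_comp phi kphi w1 z Hphi S1 Hz) as [n1 D1].
destruct (log_pair_comp phi kphi w2 z Hphi S2 Hz) as [n2 D2].
destruct (log_pair_comp psi kpsi w3 z Hpsi S3 Hz) as [n3 D3].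
split.
- rewrite Hf by easy. repeat apply Cmult_neq_0; easy.
- assert (D := cderiv_mult _ _ _ _ _ (cderiv_id z) (cderiv_mult _ _ _ _ _ (cderiv_mult _ _ _ _ _ D1 D2) D3)).
  cbv beta in D.
  assert (D' : cderiv f z (1 * (phi (w1 z) * phi (w2 z) * psi (w3 z)) +
     z * ((phi (w1 z) * kphi (w1 z) * C_derive w1 z * phi (w2 z) +
     phi (w1 z) * (phi (w2 z) * kphi (w2 z) * C_derive w2 z)) * psi (w3 z) +
     phi (w1 z) * phi (w2 z) * (psi (w3 z) * kpsi (w3 z) * C_derive w3 z)))).
  { revert D. apply (cderiv_ext_loc _ _ _ _ (1 - Cmod z)).
    - unfold unit_disk in Hz. lra.
    - intros y Hy. symmetry. apply Hf. unfold unit_disk. assert (T := Cmod_triangle_rev y z). lra. }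
  rewrite (cderiv_C_derive _ _ _ D'), Hf by easy. unfold log_sum, log_term. ring.
Qed.

(** * Product representation, extremal functions and the general radius theorem *)

Lemma subordinate_schwarz (f g : C -> C) : subordinate f g ->
  exists w, schwarz_fun w /\ forall z, unit_disk z -> f z = g (w z).
Proof.
intros [_ [w [H1 [H2 [H3 H4]]]]]. exists w. split; [|easy]. split; [|easy]. now apply analytic_iff.
Qed.

(** The quotients multiply up, [f = q1 g = q1 q2 z p], where [p] has no zero off the origin because
    [z p] is an admissible denominator. At the origin both sides vanish. *)
Lemma class_T_product (phi psi f : C -> C) : class_T phi psi f ->
  exists w1 w2 w3, schwarz_fun w1 /\ schwarz_fun w2 /\ schwarz_fun w3 /\
    forall z, unit_disk z -> f z = z * (phi (w1 z) * phi (w2 z) * psi (w3 z)).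
Proof.
intros [[_ [f0 _]] [g [p [_ [Hp [[q1 [[_ Q1] S1]] [q2 [[_ Q2] S2]]]]]]]].
destruct (subordinate_schwarz _ _ S1) as [w1 [W1 E1]].
destruct (subordinate_schwarz _ _ S2) as [w2 [W2 E2]].
destruct (subordinate_schwarz _ _ Hp) as [w3 [W3 E3]].
exists w1, w2, w3. repeat (split; [easy|]). intros z Hz.
destruct (Ceq_dec z 0) as [->|n]; [rewrite f0; ring|].
destruct (Q1 z Hz n) as [n1 F1]. destruct (Q2 z Hz n) as [n2 F2].
rewrite <- E1, <- E2, <- E3, F1, F2 by easy.
assert (np : p z <> 0) by (intros E; apply n2; rewrite E; ring).
field. auto.
Qed.

Lemma class_A_product (k : C -> C) : (forall z, unit_disk z -> cdiff k z) -> k 0 = 1 ->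
  class_A (fun z => z * k z).
Proof.
intros Hk k0. split; [|split].
- apply analytic_iff. intros z Hz. apply (cdiff_mult (fun z => z)); [apply cdiff_id|auto].
- ring.
- apply is_derive_cderiv. assert (H := cdiff_C_derive _ _ (Hk 0 unit_disk_0)).
  assert (D := cderiv_mult _ _ _ _ _ (cderiv_id 0) H). cbv beta in D. rewrite k0 in D.
  replace (RtoC 1) with (1 * 1 + 0 * C_derive k 0) by ring. exact D.
Qed.

Lemma log_pair_analytic (phi kappa : C -> C) : log_pair phi kappa -> forall z, unit_disk z -> cdiff phi z.
Proof. intros [_ H] z Hz. eexists. apply H. easy. Qed.

Lemma log_pair_subordinate (phi kappa : C -> C) : log_pair phi kappa -> subordinate phi phi.
Proof.
intros H. split; [apply analytic_iff; now apply (log_pair_analytic _ kappa)|].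
exists (fun z => z). split; [apply analytic_iff; intros; apply cdiff_id|easy].
Qed.

(** All three Schwarz functions are the identity. *)
Lemma extremal_class_T (phi kphi psi kpsi : C -> C) : log_pair phi kphi -> log_pair psi kpsi ->
  class_T phi psi (fun z => z * (phi z * phi z * psi z)).
Proof.
intros Hphi Hpsi.
assert (A1 := log_pair_analytic _ _ Hphi). assert (A2 := log_pair_analytic _ _ Hpsi).
assert (F : forall a : C -> C, (forall z, unit_disk z -> z <> 0 -> a z <> 0) ->
  forall b : C -> C, (forall z, b z = a z * phi z) -> quotient_subordinate b a phi).
{ intros a Ha b Hb. exists phi. split; [|now apply log_pair_subordinate with kphi].
  split; [now apply analytic_iff|]. intros z Hz n. specialize (Ha z Hz n). split; [exact Ha|].
  rewrite Hb. field. easy. }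
split.
- apply class_A_product.
  + intros z Hz. apply cdiff_mult; [apply cdiff_mult|]; auto.
  + destruct Hphi as [-> _], Hpsi as [-> _]. ring.
- exists (fun z => z * (phi z * psi z)), psi. split; [|split; [|split]].
  + apply class_A_product.
    * intros z Hz. apply cdiff_mult; auto.
    * destruct Hphi as [-> _], Hpsi as [-> _]. ring.
  + now apply log_pair_subordinate with kpsi.
  + apply F; [|intros; ring]. intros z Hz n.
    destruct Hphi as [_ Hphi], Hpsi as [_ Hpsi].
    repeat apply Cmult_neq_0; [easy|now apply Hphi|now apply Hpsi].
  + apply F; [|intros; ring]. intros z Hz n.
    destruct Hpsi as [_ Hpsi]. apply Cmult_neq_0; [easy|now apply Hpsi].
Qed.

Lemma log_sum_cdiff (phi kphi psi kpsi w1 w2 w3 : C -> C) (z : C) :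
  log_pair phi kphi -> log_pair psi kpsi ->
  schwarz_fun w1 -> schwarz_fun w2 -> schwarz_fun w3 -> unit_disk z ->
  cdiff (fun z => 1 + log_sum kphi kpsi w1 w2 w3 z) z.
Proof.
intros. apply cdiff_plus; [apply cdiff_const|].
apply cdiff_plus; [apply cdiff_plus|]; eapply log_term_cdiff; eauto.
Qed.

Lemma log_sum_0 (kphi kpsi w1 w2 w3 : C -> C) : 1 + log_sum kphi kpsi w1 w2 w3 0 = 1.
Proof. unfold log_sum, log_term. ring. Qed.

(** The inequality makes [R0] admissible for every member of the class. The last hypothesis says
    that the extremal function has [z f' / f = 1 / 2] at [- R0]; as [|1/2 - 1| = 1/2], this value is
    on the boundary of the region, so no larger radius is admissible for that function. *)
Theorem class_T_radius (phi kphi psi kpsi : C -> C) (R0 : R) :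
  log_pair phi kphi -> log_pair psi kpsi -> (0 < R0 < 1)%R ->
  (forall w1 w2 w3 z, schwarz_fun w1 -> schwarz_fun w2 -> schwarz_fun w3 -> (Cmod z < R0)%R ->
     (Cmod (log_sum kphi kpsi w1 w2 w3 z) - Re (log_sum kphi kpsi w1 w2 w3 z) < 1)%R) ->
  - RtoC R0 * (2 * kphi (- RtoC R0) + kpsi (- RtoC R0)) = - (/ 2) ->
  is_class_radius parabolic_starlike (class_T phi psi) R0.
Proof.
intros Hphi Hpsi HR Hb Hs.
assert (Char : forall f w1 w2 w3, class_A f -> schwarz_fun w1 -> schwarz_fun w2 -> schwarz_fun w3 ->
  (forall z, unit_disk z -> f z = z * (phi (w1 z) * phi (w2 z) * psi (w3 z))) ->
  forall r, (0 < r <= 1)%R -> (parabolic_starlike (dilation r f) <->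
    forall z, (Cmod z < r)%R -> parabolic_region (1 + log_sum kphi kpsi w1 w2 w3 z))).
{ intros f w1 w2 w3 Hf W1 W2 W3 E r Hr.
  apply (parabolic_starlike_dilation f (fun z => 1 + log_sum kphi kpsi w1 w2 w3 z)); try easy.
  - intros. now apply (log_sum_cdiff phi kphi psi kpsi).
  - apply log_sum_0.
  - intros. now apply (product_log_derivative phi kphi psi kpsi). }
assert (Adm : forall f, class_T phi psi f -> admissible_radius parabolic_starlike f R0).
{ intros f Hf. destruct (class_T_product _ _ _ Hf) as [w1 [w2 [w3 [W1 [W2 [W3 E]]]]]].
  split; [lra|]. intros r Hr.
  apply (Char f w1 w2 w3 (proj1 Hf) W1 W2 W3 E r ltac:(lra)).
  intros z Hz. apply parabolic_region_shift, Hb; try easy. lra. }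
assert (Ex : forall f, class_T phi psi f -> exists rho, is_function_radius parabolic_starlike f rho).
{ intros f Hf. destruct (class_T_product _ _ _ Hf) as [w1 [w2 [w3 [W1 [W2 [W3 E]]]]]].
  destruct (completeness (admissible_radius parabolic_starlike f)) as [rho [U L]].
  - exists 1%R. intros x [Hx _]. lra.
  - exists R0. auto.
  - exists rho. assert (L1 : (R0 <= rho)%R) by (apply U; auto).
    assert (L2 : (rho <= 1)%R) by (apply L; intros x [Hx _]; lra).
    split; [|intros x Hx; now apply U]. split; [lra|]. intros r Hr.
    apply (Char f w1 w2 w3 (proj1 Hf) W1 W2 W3 E r ltac:(lra)). intros z Hz.
    (* The supremum [rho] is itself admissible: the condition concerns open disks, and a point with
       [|z| < rho] already lies within some admissible radius. *)
    destruct (classic (exists x, admissible_radius parabolic_starlike f x /\ (Cmod z < x)%R))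
      as [[x [[Hx Ax] Lx]]|N].
    + assert (P := Ax x ltac:(lra)).
      now apply (proj1 (Char f w1 w2 w3 (proj1 Hf) W1 W2 W3 E x Hx) P).
    + exfalso. assert (rho <= Cmod z)%R; [|lra]. apply L. intros x Hx.
      apply Rnot_lt_le. intros K. apply N. now exists x. }
split; [easy|]. split.
- intros x [f [Hf [_ Hx]]]. simpl. auto.
- intros b Hbl. set (f := fun z => z * (phi z * phi z * psi z)).
  assert (Hf : class_T phi psi f) by now apply extremal_class_T with kphi kpsi.
  destruct (Ex f Hf) as [rho Hrho].
  assert (L : (rho <= R0)%R).
  { apply Rnot_lt_le. intros K. destruct Hrho as [[H1 H2] _].
    assert (P := H2 rho ltac:(lra)).
    assert (I := schwarz_fun_id).
    assert (P' := proj1 (Char f _ _ _ (proj1 Hf) I I I (fun y _ => eq_refl) rho ltac:(lra)) P). clear P. rename P' into P.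
    specialize (P (- RtoC R0)).
    rewrite Cmod_opp, Cmod_real in P by lra. specialize (P K).
    assert (El : log_sum kphi kpsi (fun z => z) (fun z => z) (fun z => z) (- RtoC R0) = - (/ 2)).
    { rewrite <- Hs. unfold log_sum, log_term. rewrite (cderiv_C_derive _ _ _ (cderiv_id _)). ring. }
    rewrite El in P. revert P. unfold parabolic_region. replace (1 + - (/ 2) - 1) with (- (/ RtoC 2)) by ring.
    rewrite <- RtoC_inv by lra. rewrite Cmod_opp, Cmod_real by lra. rewrite re_plus, re_opp. simpl. lra. }
  specialize (Hbl rho (ex_intro _ f (conj Hf Hrho))).
  eapply Rbar_le_trans; [exact Hbl|]. simpl. easy.
Qed.

(** * The three functions: logarithmic derivatives and bounds for their terms *)

Lemma log_pair_Cexp : log_pair Cexp (fun _ => 1).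
Proof.
split; [apply Cexp_0|]. intros z _. split; [apply Cexp_neq_0|split; [|apply cdiff_const]].
replace (Cexp z * 1) with (Cexp z) by ring. apply Cexp_cderiv.
Qed.

Lemma Re_1_plus_pos (x : C) : (Cmod x < 1)%R -> (0 < Re (1 + x))%R.
Proof. intros H. rewrite re_plus. assert (B := Re_Cmod_bounds x). simpl. simpl in B. lra. Qed.

Lemma log_pair_sqrt : log_pair phi_sqrt (fun z => 1 / (2 * (1 + z))).
Proof.
split.
- unfold phi_sqrt. replace (1 + 0) with (RtoC 1) by ring. apply Csqrt_1.
- intros z Hz. assert (P := Re_1_plus_pos z Hz). assert (n := Re_pos_neq_0 _ P).
  assert (n2 : RtoC 2 <> 0) by (apply RtoC_neq_0; lra).
  unfold phi_sqrt. split; [now apply Csqrt_neq_0|split].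
  + replace (Csqrt (1 + z) * (1 / (2 * (1 + z)))) with (1 / (2 * Csqrt (1 + z)) * (0 + 1)).
    * apply (cderiv_comp (fun z => 1 + z) Csqrt); [|now apply Csqrt_cderiv].
      apply cderiv_plus; [apply cderiv_const|apply cderiv_id].
    * rewrite <- (Csqrt_sq (1 + z)) at 3. assert (n1 := Csqrt_neq_0 _ n). field. auto.
  + apply cdiff_div; [apply cdiff_const| |now apply Cmult_neq_0].
    apply cdiff_mult; [apply cdiff_const|]. apply cdiff_plus; [apply cdiff_const|apply cdiff_id].
Qed.

Lemma Re_1_plus_sq_pos (z : C) : unit_disk z -> (0 < Re (1 + z * z))%R.
Proof.
intros Hz. apply Re_1_plus_pos. rewrite Cmod_mult. unfold unit_disk in Hz.
assert (H := Cmod_ge_0 z). nra.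
Qed.

(** With [s = sqrt (1 + z^2)], the identity [(s + z) (s - z) = 1] excludes zeros, and the derivative
    [1 + z / s] equals [(z + s) / s]. *)
Lemma log_pair_lune : log_pair phi_lune (fun z => 1 / Csqrt (1 + z * z)).
Proof.
split.
- unfold phi_lune. replace (1 + 0 * 0) with (RtoC 1) by ring. rewrite Csqrt_1. ring.
- intros z Hz. assert (P := Re_1_plus_sq_pos z Hz). assert (n := Re_pos_neq_0 _ P).
  assert (n1 := Csqrt_neq_0 _ n). assert (n2 : RtoC 2 <> 0) by (apply RtoC_neq_0; lra).
  assert (E := Csqrt_sq (1 + z * z)).
  assert (D : cderiv (fun z => Csqrt (1 + z * z)) z (1 / (2 * Csqrt (1 + z * z)) * (0 + (1 * z + z * 1)))).
  { apply (cderiv_comp (fun z => 1 + z * z) Csqrt); [|now apply Csqrt_cderiv].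
    apply cderiv_plus; [apply cderiv_const|].
    apply (cderiv_mult (fun z => z) (fun z => z)); apply cderiv_id. }
  unfold phi_lune. split; [|split].
  + intros X. apply (RtoC_neq_0 1); [lra|].
    replace (RtoC 1) with ((1 + z * z) - z * z) by ring. rewrite <- E.
    replace (Csqrt (1 + z * z)) with (- z) by (rewrite <- (Cplus_0_r (- z)), <- X; ring). ring.
  + replace ((z + Csqrt (1 + z * z)) * (1 / Csqrt (1 + z * z))) with
      (1 + 1 / (2 * Csqrt (1 + z * z)) * (0 + (1 * z + z * 1))) by (field; auto).
    apply cderiv_plus; [apply cderiv_id|easy].
  + apply cdiff_div; [apply cdiff_const| |easy]. eexists. exact D.
Qed.

(** Dieudonné's error is at most [r - t], with [t = |w|], as soon as [r + t <= 1 - r^2]. Since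
    [t <= r], this holds for [r <= sqrt 2 - 1], and [2 / 5] is a rational number below that. *)
Lemma schwarz_fun_zderiv (w : C -> C) (z : C) : schwarz_fun w -> (Cmod z <= 2 / 5)%R ->
  (Cmod (z * C_derive w z) <= Cmod z)%R.
Proof.
intros Hw Hz. assert (Dz : unit_disk z) by (unfold unit_disk; lra).
assert (D := dieudonne w z _ Hw Dz (cdiff_C_derive _ _ (proj1 Hw z Dz))).
assert (S := schwarz_lemma w z Hw Dz). assert (T := Cmod_triangle_rev (z * C_derive w z) (w z)).
set (m := Cmod (z * C_derive w z - w z)) in *. set (t := Cmod (w z)) in *. set (r := Cmod z) in *.
assert (t0 : (0 <= t)%R) by apply Cmod_ge_0. assert (r0 : (0 <= r)%R) by apply Cmod_ge_0.
assert (B : (m <= r - t)%R); [|lra].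
apply (Rmult_le_reg_r (1 - r ^ 2)); [nra|]. eapply Rle_trans; [exact D|].
replace (r ^ 2 - t ^ 2)%R with ((r - t) * (r + t))%R by ring. apply Rmult_le_compat_l; nra.
Qed.

Lemma log_term_Cexp_bound (w : C -> C) (z : C) : schwarz_fun w -> (Cmod z <= 2 / 5)%R ->
  (Cmod (log_term (fun _ => 1%C) w z) <= Cmod z)%R.
Proof.
intros Hw Hz. unfold log_term. rewrite Cmult_1_r. now apply schwarz_fun_zderiv.
Qed.

Lemma log_term_sqrt_bound (w : C -> C) (z : C) : schwarz_fun w -> (Cmod z <= 2 / 5)%R ->
  (Cmod (log_term (fun z => 1 / (2 * (1 + z)))%C w z) <= Cmod z / (2 * (1 - Cmod z)))%R.
Proof.
intros Hw Hz. assert (Dz : unit_disk z) by (unfold unit_disk; lra).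
assert (A := schwarz_fun_zderiv w z Hw Hz). assert (S := schwarz_lemma w z Hw Dz).
assert (T := Cmod_triangle_rev 1 (- w z)). rewrite Cmod_opp, Cmod_1 in T.
replace (1 - - w z) with (1 + w z) in T by ring.
assert (n : 2 * (1 + w z) <> 0).
{ apply Cmult_neq_0; [apply RtoC_neq_0; lra|]. apply Cmod_gt_0. lra. }
unfold log_term. replace (z * C_derive w z * (1 / (2 * (1 + w z)))) with
  (z * C_derive w z / (2 * (1 + w z))).
2:{ unfold Cdiv. ring. }
rewrite Cmod_div, (Cmod_mult 2), (Cmod_real 2) by (easy || lra).
apply Rmult_le_compat; [apply Cmod_ge_0| |easy|].
- left. apply Rinv_0_lt_compat. lra.
- apply Rinv_le_contravar; lra.
Qed.

(** Equality holds at [x = - B], which is where the extremal function puts the sum of its terms. *)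
Lemma Cmod_minus_Re_le (x : C) (B : R) : (Cmod x <= B)%R -> (Cmod x - Re x <= 2 * B)%R.
Proof. intros H. assert (R := Re_Cmod_bounds x). lra. Qed.

Lemma Cmod_triangle3 (x y z : C) : (Cmod (x + y + z) <= Cmod x + Cmod y + Cmod z)%R.
Proof. assert (A := Cmod_triangle (x + y) z). assert (B := Cmod_triangle x y). lra. Qed.

Lemma sqrt_gt (a x : R) : (0 <= a)%R -> (a * a < x)%R -> (a < sqrt x)%R.
Proof. intros Ha H. rewrite <- (sqrt_square a Ha). apply sqrt_lt_1_alt. nra. Qed.

Theorem radius_T1 : is_class_radius parabolic_starlike class_T1 ((3 - sqrt 5) / 4)%R.
Proof.
assert (S := sqrt_sqrt 5 ltac:(lra)). assert (L := sqrt_gt (22 / 10) 5 ltac:(lra) ltac:(lra)).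
assert (U : (sqrt 5 < 3)%R) by nra.
set (R0 := ((3 - sqrt 5) / 4)%R). assert (HR : (0 < R0 < 1 / 5)%R) by (unfold R0; lra).
(* [R0] is the smaller root of [4 r (1 - r) + r = 1 - r], that is
   [2 (2 r + r / (2 (1 - r))) = 1]. *)
assert (E : (4 * R0 * R0 - 6 * R0 + 1 = 0)%R) by (unfold R0; nra).
apply (class_T_radius Cexp (fun _ => 1) phi_sqrt (fun z => 1 / (2 * (1 + z))));
  [apply log_pair_Cexp|apply log_pair_sqrt|lra| |].
- intros w1 w2 w3 z W1 W2 W3 Hz.
  assert (B1 := log_term_Cexp_bound w1 z W1 ltac:(lra)).
  assert (B2 := log_term_Cexp_bound w2 z W2 ltac:(lra)).
  assert (B3 := log_term_sqrt_bound w3 z W3 ltac:(lra)).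
  unfold log_sum.
  eapply Rle_lt_trans; [apply Cmod_minus_Re_le; eapply Rle_trans; [apply Cmod_triangle3|];
    apply Rplus_le_compat; [apply Rplus_le_compat|]; eassumption|].
  set (r := Cmod z) in *. assert (r0 : (0 <= r)%R) by apply Cmod_ge_0.
  replace (2 * (r + r + r / (2 * (1 - r))))%R with ((4 * r * (1 - r) + r) / (1 - r))%R by (field; lra).
  apply Rlt_div_l; [lra|]. nra.
- assert (n1 : (1 - R0)%R <> 0%R) by lra.
  replace (- RtoC R0 * (2 * 1 + 1 / (2 * (1 + - RtoC R0)))) with
    (RtoC (- R0 * (2 + 1 / (2 * (1 - R0))))%R).
  + replace (- R0 * (2 + 1 / (2 * (1 - R0))))%R with (- / 2)%R.
    * now rewrite RtoC_opp, RtoC_inv by lra.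
    * apply (Rmult_eq_reg_r (2 * (1 - R0))); [|lra].
      replace (- R0 * (2 + 1 / (2 * (1 - R0))) * (2 * (1 - R0)))%R with (- R0 * (4 * (1 - R0) + 1))%R by (field; lra).
      nra.
  + rewrite RtoC_mult, RtoC_plus, RtoC_div, RtoC_mult, RtoC_minus, RtoC_opp by lra.
    field. rewrite <- RtoC_opp, <- RtoC_plus. apply RtoC_neq_0. lra.
Qed.

Theorem radius_T2 : is_class_radius parabolic_starlike class_T2 ((5 - sqrt 17) / 4)%R.
Proof.
assert (S := sqrt_sqrt 17 ltac:(lra)). assert (L := sqrt_gt (41 / 10) 17 ltac:(lra) ltac:(lra)).
assert (U : (sqrt 17 < 5)%R) by nra.
set (R0 := ((5 - sqrt 17) / 4)%R). assert (HR : (0 < R0 < 1 / 4)%R) by (unfold R0; lra).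
(* [R0] is the smaller root of [2 r + 2 r (1 - r) = 1 - r], that is [2 (r / (1 - r) + r) = 1]. *)
assert (E : (2 * R0 * R0 - 5 * R0 + 1 = 0)%R) by (unfold R0; nra).
apply (class_T_radius phi_sqrt (fun z => 1 / (2 * (1 + z))) Cexp (fun _ => 1));
  [apply log_pair_sqrt|apply log_pair_Cexp|lra| |].
- intros w1 w2 w3 z W1 W2 W3 Hz.
  assert (B1 := log_term_sqrt_bound w1 z W1 ltac:(lra)).
  assert (B2 := log_term_sqrt_bound w2 z W2 ltac:(lra)).
  assert (B3 := log_term_Cexp_bound w3 z W3 ltac:(lra)).
  unfold log_sum.
  eapply Rle_lt_trans; [apply Cmod_minus_Re_le; eapply Rle_trans; [apply Cmod_triangle3|];
    apply Rplus_le_compat; [apply Rplus_le_compat|]; eassumption|].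
  set (r := Cmod z) in *. assert (r0 : (0 <= r)%R) by apply Cmod_ge_0.
  replace (2 * (r / (2 * (1 - r)) + r / (2 * (1 - r)) + r))%R with ((2 * r + 2 * r * (1 - r)) / (1 - r))%R by (field; lra).
  apply Rlt_div_l; [lra|]. nra.
- replace (- RtoC R0 * (2 * (1 / (2 * (1 + - RtoC R0))) + 1)) with
    (RtoC (- R0 * (1 / (1 - R0) + 1))%R).
  + replace (- R0 * (1 / (1 - R0) + 1))%R with (- / 2)%R.
    * now rewrite RtoC_opp, RtoC_inv by lra.
    * apply (Rmult_eq_reg_r (1 - R0)); [|lra].
      replace (- R0 * (1 / (1 - R0) + 1) * (1 - R0))%R with (- R0 * (1 + (1 - R0)))%R by (field; lra).
      nra.
  + rewrite RtoC_mult, RtoC_plus, RtoC_div, RtoC_minus, RtoC_opp by lra.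
    field. rewrite <- RtoC_opp, <- RtoC_plus. apply RtoC_neq_0. lra.
Qed.

(* Maximising over [|w| = t], the extremal value is taken at [w = - t]. With
   [x = 1 / |1 + w^2|], both [|h|^2 = t^2 x] and [(Re h)^2] are explicit in [x]. *)
Lemma lune_main_term (w S : C) : S * S = 1 + w * w -> (Cmod w <= 1 / 5)%R ->
  (Cmod (w / S) - Re (w / S) <= 2 * (Cmod w / sqrt (1 + Cmod w ^ 2)))%R.
Proof.
intros HS Hw. set (t := Cmod w) in *. assert (t0 : (0 <= t)%R) by apply Cmod_ge_0.
set (T := (t ^ 2)%R). assert (T0 : (0 <= T <= 1 / 25)%R) by (unfold T; nra).
assert (TD := Cmod_triangle 1 (w * w)). assert (TL := Cmod_triangle_rev 1 (- (w * w))).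
replace (1 - - (w * w)) with (1 + w * w) in TL by ring.
rewrite Cmod_opp, Cmod_mult, Cmod_1 in TL. rewrite Cmod_mult, Cmod_1 in TD. fold t in TD, TL.
set (D := Cmod (1 + w * w)) in *.
assert (HD : (1 - T <= D <= 1 + T)%R) by (unfold T; simpl; lra). clear TD TL.
assert (nw : 1 + w * w <> 0) by (apply Cmod_gt_0; fold D; lra).
assert (nS : S <> 0) by (intros X; apply nw; rewrite <- HS, X; ring).
set (h := w / S).
assert (H2 : (Cmod h ^ 2 = T / D)%R).
{ unfold h, T, D. rewrite <- HS, Cmod_div, Cmod_mult by easy. fold t. field. now apply Rgt_not_eq, Cmod_pos. }
assert (H3 : (Cmod (1 - h * h) ^ 2 = 1 / (D * D))%R).
{ replace (1 - h * h) with (/ (1 + w * w)).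
  - rewrite Cmod_inv by easy. fold D. field. lra.
  - unfold h. replace (w / S * (w / S)) with (w * w / (S * S)) by (field; easy). rewrite HS. field. easy. }
set (x := (/ D)%R). assert (xD : (x * D = 1)%R) by (unfold x; field; lra).
assert (x0 : (/ (1 + T) <= x)%R) by (apply Rinv_le_contravar; lra).
(* This sum is the right quantity because [(m - u)^2 <= 2 (m^2 + u^2)] with equality at [u = - m].
   The formula results from expanding [|1 - h^2|^2 = x^2] with [|h|^2 = T x]. *)
assert (H4 : (Re h ^ 2 + Cmod h ^ 2 = (1 + 6 * T * x - (1 - T * T) * x * x) / 4)%R).
{ assert (N := Cmod2_alt h). assert (N2 := Cmod2_alt (1 - h * h)). rewrite H3 in N2. rewrite H2 in N.
  replace (T / D)%R with (T * x)%R in * by (unfold x; field; lra).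
  replace (1 / (D * D))%R with (x * x)%R in * by (unfold x; field; lra). rewrite H2.
  destruct h as [u v]. simpl in *.
  assert (V : (v * v = T * x - u * u)%R) by lra.
  assert (V2 : ((1 + - (u * u - v * v)) * ((1 + - (u * u - v * v)) * 1) + (0 + - (u * v + v * u)) * ((0 + - (u * v + v * u)) * 1)
    = 1 - 2 * (u * u - v * v) + (u * u + v * v) * (u * u + v * v))%R) by ring.
  rewrite V2, V in N2. replace (u * u + (T * x - u * u))%R with (T * x)%R in N2 by ring. nra. }
(* The concave quadratic in [x] has its vertex at [3 T / (1 - T^2)], which is left of
   [y = 1 / (1 + T)] because [T <= 1 / 4]. So over [x >= y] it is largest at [y], the case of real
   [w]. *)
assert (H5 : (Re h ^ 2 + Cmod h ^ 2 <= 2 * (T / (1 + T)))%R).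
{ rewrite H4. set (y := (/ (1 + T))%R) in *. assert (yT : (y * (1 + T) = 1)%R) by (unfold y; field; lra).
  replace (T / (1 + T))%R with (1 - y)%R by (unfold y; field; lra).
  set (e := (x - y)%R). assert (e0 : (0 <= e)%R) by (unfold e; lra).
  replace x with (y + e)%R by (unfold e; ring).
  assert (E1 : ((1 - T * T) * y = 1 - T)%R) by (replace (1 - T * T)%R with ((1 - T) * (1 + T))%R by ring; nra).
  assert (E2 : (T * y = 1 - y)%R) by lra.
  assert (E3 : (0 <= e * (2 - 8 * T))%R) by (apply Rmult_le_pos; lra).
  assert (E4 : (0 <= (1 - T * T) * (e * e))%R) by (apply Rmult_le_pos; nra).
  replace (1 + 6 * T * (y + e) - (1 - T * T) * (y + e) * (y + e))%R with
    (1 + 6 * (T * y) + 6 * T * e - ((1 - T * T) * y) * (y + 2 * e) - (1 - T * T) * (e * e))%R by ring.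
  rewrite E1, E2. replace ((1 - T) * (y + 2 * e))%R with (y - T * y + 2 * e - 2 * T * e)%R by ring.
  rewrite E2. lra. }
set (k := (t / sqrt (1 + T))%R).
assert (sT : (0 < sqrt (1 + T))%R) by (apply sqrt_lt_R0; lra).
assert (k0 : (0 <= k)%R) by (apply Rdiv_le_0_compat; lra).
assert (k2 : (k * k = T / (1 + T))%R).
{ unfold k. replace (t / sqrt (1 + T) * (t / sqrt (1 + T)))%R with (t ^ 2 / (sqrt (1 + T) * sqrt (1 + T)))%R by (field; lra).
  now rewrite sqrt_sqrt by lra. }
rewrite <- k2 in H5. assert (m0 := Cmod_ge_0 h). set (m := Cmod h) in *. set (u := Re h) in *.
apply Rnot_lt_le. intros K. assert (0 <= (m + u) * (m + u))%R by apply Rle_0_sqr.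
assert ((2 * k) * (2 * k) < (m - u) * (m - u))%R by nra. nra.
Qed.

(** The main term for [|w| = t] plus the error from Dieudonné's lemma is largest at [t = r], where
    the error vanishes. The slope [9 / 10] separates the two: [t / sqrt (1 + t^2)] has derivative
    [(1 + t^2)^(-3/2) > 9/10] on this range, and the error is [r - t] times at most
    [(2/5) / (24/25)^2 < 9/10]. *)
Lemma lune_profile (t r : R) : (0 <= t <= r)%R -> (r <= 1 / 5)%R ->
  (t / sqrt (1 + t ^ 2) + (r ^ 2 - t ^ 2) / (1 - r ^ 2) / (1 - t ^ 2) <= r / sqrt (1 + r ^ 2))%R.
Proof.
intros Ht Hr. set (a := sqrt (1 + t ^ 2)). set (b := sqrt (1 + r ^ 2)).
assert (a2 : (a * a = 1 + t ^ 2)%R) by (apply sqrt_sqrt; nra).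
assert (b2 : (b * b = 1 + r ^ 2)%R) by (apply sqrt_sqrt; nra).
assert (a1 : (1 <= a)%R) by (rewrite <- sqrt_1; apply sqrt_le_1_alt; nra).
assert (b1 : (1 <= b)%R) by (rewrite <- sqrt_1; apply sqrt_le_1_alt; nra).
assert (A : ((r - t) * (9 / 10) <= r / b - t / a)%R).
{ replace (r / b - t / a)%R with ((r * a - t * b) / (a * b))%R by (field; lra).
  apply (proj1 (Rle_div_r _ _ _ (Rmult_lt_0_compat a b ltac:(lra) ltac:(lra)))).
  assert (Q : ((r * a - t * b) * (r * a + t * b) = (r - t) * (r + t))%R).
  { replace ((r * a - t * b) * (r * a + t * b))%R with (r ^ 2 * (a * a) - t ^ 2 * (b * b))%R by ring.
    rewrite a2, b2. ring. }
  assert (ub : (a <= 103 / 100)%R) by nra. assert (vb : (b <= 103 / 100)%R) by nra.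
  destruct (Req_dec r t) as [->|n].
  - replace a with b by (unfold a, b; easy). nra.
  - assert (p : (0 < r * a + t * b)%R) by nra.
    apply (Rmult_le_reg_r (r * a + t * b)); [easy|]. rewrite Q.
    replace ((r - t) * (9 / 10) * (a * b) * (r * a + t * b))%R with
      ((r - t) * (9 / 10 * (a * b) * (r * a + t * b)))%R by ring.
    apply Rmult_le_compat_l; [lra|].
    assert (ab : (a * b <= 10609 / 10000)%R) by nra.
    assert (s : (r * a + t * b <= 103 / 100 * (r + t))%R) by nra.
    apply Rle_trans with (9 / 10 * (10609 / 10000) * (103 / 100 * (r + t)))%R; [|nra].
    apply Rmult_le_compat; nra. }
assert (B : ((r ^ 2 - t ^ 2) / (1 - r ^ 2) / (1 - t ^ 2) <= (r - t) * (9 / 10))%R).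
{ apply Rle_div_l; [nra|]. apply Rle_div_l; [nra|].
  replace (r ^ 2 - t ^ 2)%R with ((r - t) * (r + t))%R by ring. rewrite !Rmult_assoc.
  apply Rmult_le_compat_l; [lra|].
  assert (X : (96 / 100 * (96 / 100) <= (1 - t ^ 2) * (1 - r ^ 2))%R) by (apply Rmult_le_compat; nra). lra. }
lra.
Qed.

(** Splitting [z w' / s = w / s + (z w' - w) / s] separates the sharp main term from an error [y]
    controlled by Dieudonné's lemma; the error enters through [|y| - Re y <= 2 |y|], which matches
    the factor 2 of the main term. *)
Lemma log_term_lune_bound (w : C -> C) (z : C) : schwarz_fun w -> (Cmod z <= 1 / 5)%R ->
  (Cmod (log_term (fun z => 1 / Csqrt (1 + z * z))%C w z)
   - Re (log_term (fun z => 1 / Csqrt (1 + z * z))%C w z) <= 2 * (Cmod z / sqrt (1 + Cmod z ^ 2)))%R.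
Proof.
intros Hw Hz. assert (Dz : unit_disk z) by (unfold unit_disk; lra).
assert (D := dieudonne w z _ Hw Dz (cdiff_C_derive _ _ (proj1 Hw z Dz))).
assert (S := schwarz_lemma w z Hw Dz).
assert (M := lune_main_term (w z) _ (Csqrt_sq (1 + w z * w z)) ltac:(lra)).
assert (P := lune_profile (Cmod (w z)) (Cmod z) (conj (Cmod_ge_0 _) S) Hz).
assert (Q := Cmod_Csqrt (1 + w z * w z)).
assert (TL := Cmod_triangle_rev 1 (- (w z * w z))).
replace (1 - - (w z * w z)) with (1 + w z * w z) in TL by ring.
rewrite Cmod_opp, Cmod_mult, Cmod_1 in TL.
unfold log_term. set (s := Csqrt (1 + w z * w z)) in *. set (t := Cmod (w z)) in *. set (r := Cmod z) in *.
assert (t0 : (0 <= t)%R) by apply Cmod_ge_0.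
assert (s0 := Cmod_ge_0 s).
(* From [|s|^2 >= 1 - t^2], weakened so as to be free of roots. *)
assert (Ls : (1 - t ^ 2 <= Cmod s)%R).
{ apply Rnot_lt_le. intros K. assert (0 <= t * t <= 1 / 25)%R by nra. simpl in K. nra. }
assert (ns : s <> 0) by (apply Cmod_gt_0; nra).
replace (z * C_derive w z * (1 / s)) with (w z / s + (z * C_derive w z - w z) / s) by (field; easy).
set (y := (z * C_derive w z - w z) / s).
assert (Hy : (Cmod y <= (r ^ 2 - t ^ 2) / (1 - r ^ 2) / (1 - t ^ 2))%R).
{ unfold y. rewrite Cmod_div by easy. unfold Rdiv. apply Rmult_le_compat; [apply Cmod_ge_0| | |].
  - left. apply Rinv_0_lt_compat. nra.
  - apply Rle_div_r; [|exact D]. assert (r0 : (0 <= r)%R) by apply Cmod_ge_0. nra.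
  - apply Rinv_le_contravar; nra. }
assert (T := Cmod_triangle (w z / s) y). assert (Ry := Re_Cmod_bounds y).
rewrite re_plus. lra.
Qed.

Theorem radius_T3 : is_class_radius parabolic_starlike class_T3 (1 / sqrt 35)%R.
Proof.
assert (S := sqrt_sqrt 35 ltac:(lra)). assert (L := sqrt_gt 5 35 ltac:(lra) ltac:(lra)).
set (R0 := (1 / sqrt 35)%R).
(* Equivalent to [R0 / sqrt (1 + R0^2) = 1 / 6], so that each of the three terms contributes at most
   [2 / 6]; it also gives [sqrt (1 + R0^2) = 6 R0] in the sharpness part. *)
assert (E : (35 * R0 * R0 = 1)%R).
{ rewrite <- S at 1. unfold R0. field. lra. }
assert (HR : (0 < R0 < 1 / 5)%R).
{ unfold R0. split; [apply Rdiv_lt_0_compat; lra|]. apply Rlt_div_l; lra. }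
apply (class_T_radius phi_lune (fun z => 1 / Csqrt (1 + z * z)) phi_lune (fun z => 1 / Csqrt (1 + z * z)));
  [apply log_pair_lune|apply log_pair_lune|lra| |].
- intros w1 w2 w3 z W1 W2 W3 Hz.
  assert (B1 := log_term_lune_bound w1 z W1 ltac:(lra)).
  assert (B2 := log_term_lune_bound w2 z W2 ltac:(lra)).
  assert (B3 := log_term_lune_bound w3 z W3 ltac:(lra)).
  unfold log_sum. rewrite !re_plus.
  match goal with |- (Cmod (?a + ?b + ?c) - _ < 1)%R => assert (T := Cmod_triangle3 a b c) end.
  assert (r0 := Cmod_ge_0 z). set (r := Cmod z) in *.
  assert (K : (r / sqrt (1 + r ^ 2) < 1 / 6)%R).
  { apply Rlt_div_l; [apply sqrt_lt_R0; nra|].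
    assert (X := sqrt_gt (6 * r) (1 + r ^ 2) ltac:(lra) ltac:(nra)). lra. }
  lra.
- assert (Q : Csqrt (1 + - RtoC R0 * - RtoC R0) = RtoC (6 * R0)).
  { apply Csqrt_unique; [simpl; lra|]. rewrite <- !RtoC_mult, <- RtoC_opp, <- RtoC_mult, <- RtoC_plus.
    f_equal. nra. }
  rewrite Q. replace (- RtoC R0 * (2 * (1 / RtoC (6 * R0)) + 1 / RtoC (6 * R0))) with
    (RtoC (- R0 * (2 * (1 / (6 * R0)) + 1 / (6 * R0)))%R).
  + replace (- R0 * (2 * (1 / (6 * R0)) + 1 / (6 * R0)))%R with (- / 2)%R by (field; lra).
    now rewrite RtoC_opp, RtoC_inv by lra.
  + rewrite RtoC_mult, RtoC_plus, RtoC_mult, RtoC_div, RtoC_opp by lra. easy.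
Qed.

Theorem corollary3p2 :
  is_class_radius parabolic_starlike class_T1 ((3 - sqrt 5) / 4)%R /\
  is_class_radius parabolic_starlike class_T2 ((5 - sqrt 17) / 4)%R /\
  is_class_radius parabolic_starlike class_T3 (1 / sqrt 35)%R.
Proof.
exact (conj radius_T1 (conj radius_T2 radius_T3)).
Qed.
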